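(* Consider noisy voter models $\mathrm{NVM}(V_n,P_n,p_n)$, where $P_n$ is the transition matrix of the simple random walk on a graph $G_n=(V_n,E_n)$ with $n$ vertices, $p_n\in(0,1]$, and $(p_n)$ is non-increasing. Then: 1. Let $G_n=C_n$ be the cycle on $n$ vertices. If $p_nn^2\to\infty$ then $W_n$ converges in distribution to $\mathcal N(0,1)$, and if $p_nn^2\to0$ then $S_n$ converges in distribution to a Bernoulli random variable of parameter $1/2$. 2. Let $G_n=\mathbb T_n$ be the 2-dimensional torus on $n$ vertices (with $n$ ranging over square numbers). If $p_nn\log n\to\infty$ then $W_n$ converges in distribution to $\mathcal N(0,1)$, and if $p_nn\log n\to0$ then $S_n$ converges in distribution to a Bernoulli random variable of parameter $1/2$.
   Context: Noisy voter model: let $V$ be a finite set, $P$ an irreducible transition (stochastic) matrix on $V$ with stationary distribution $\pi$, and $p\in(0,1]$. $\mathrm{NVM}(V,P,p)$ is the discrete-time Markov chain on $\{0,1\}^V$ which at each step chooses a vertex $x\in V$ uniformly at random and updates only its opinion: with probability $p$ the opinion of $x$ is replaced by a fair coin flip in $\{0,1\}$; otherwise, with probability $1-p$, a vertex $y$ is chosen with probability $P(x,y)$ and the opinion of $x$ is replaced by the current opinion of $y$. For $p>0$ it has a unique stationary distribution $\Gamma$. With $\xi\sim\Gamma$, set $S=\sum_{x\in V}\pi(x)\xi(x)$, $\sigma^2=\mathrm{Var}(S)$ and $W=(S-\mathbb E(S))/\sigma$. A subscript $n$ denotes these quantities for $\mathrm{NVM}(V_n,P_n,p_n)$. $C_n$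 ($n\ge3$) has vertex set $\{1,\dots,n\}$ and edges $\{1,2\},\dots,\{n-1,n\},\{n,1\}$. For $n$ a square number ($n\ge 9$), $\mathbb T_n$ is the graph with vertex set $(\mathbb Z/\sqrt n\,\mathbb Z)^2$ in which two vertices are adjacent iff they differ by $\pm1$ in exactly one coordinate and agree in the other. The simple random walk moves to a uniformly chosen neighbour at each step. All limits are as $n\to\infty$. *)

(* Defs.v *)
From HB Require Import structures.
From mathcomp Require Export all_boot all_order all_algebra.
From mathcomp Require Export all_classical all_reals all_analysis.
Export Order.TTheory GRing.Theory Num.Theory.
Export numFieldNormedType.Exports.

Set Implicit Arguments.
Unset Strict Implicit.
Unset Printing Implicit Defensive.

Local Open Scope classical_set_scope.
Local Open Scope ring_scope.

Section FiniteMarkovChains.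
Context {R : realType}.

Definition is_stationary (T : finType) (K : T -> T -> R) (mu : T -> R) : Prop :=
  [/\ forall x, 0 <= mu x, \sum_x mu x = 1
    & forall y, \sum_x mu x * K x y = mu y].

Definition simple_random_walk (V : finType) (e : rel V) (x y : V) : R :=
  (e x y)%:R / #|[pred z | e x z]|%:R.

End FiniteMarkovChains.

(* Vertex i of the cycle stands for i + 1 in {1, ..., n}. *)
Definition cycle_edge (n : nat) (i j : 'I_n) : bool :=
  (i.+1 == j :> nat) || ((i == n.-1 :> nat) && (j == 0 :> nat)).

Definition cycle_graph (n : nat) : rel 'I_n :=
  fun i j => cycle_edge i j || cycle_edge j i.

(* The torus with m ^ 2 vertices, used only for m >= 3: recall that 'Z_m is the
   ring of integers modulo m only for m >= 2. *)
Definition torus_vertex (m : nat) : finType := ('Z_m * 'Z_m)%type.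

Definition torus_graph (m : nat) : rel (torus_vertex m) :=
  fun u v =>
    ((u.1 == v.1) && ((v.2 == u.2 + 1) || (v.2 == u.2 - 1)))
 || ((u.2 == v.2) && ((v.1 == u.1 + 1) || (v.1 == u.1 - 1))).

(* Opinions {0,1} are encoded by booleans; configurations carry the discrete
   sigma-algebra, so that a distribution on {0,1}^V is a [probability]. *)
Definition config (V : finType) := {ffun V -> bool}.

HB.instance Definition _ (V : finType) := Finite.on (config V).
HB.instance Definition _ (V : finType) :=
  isPointed.Build (config V) [ffun=> false].
HB.instance Definition _ (V : finType) :=
  @isMeasurable.Build default_measure_display (config V)
    (@discrete_measurable (config V)) (@discrete_measurable0 (config V))
    (@discrete_measurableC (config V)) (@discrete_measurableU (config V)).

Section NoisyVoterModel.
Context {R : realType} (V : finType).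

Definition set_opinion (xi : config V) (x : V) (b : bool) : config V :=
  [ffun z => if z == x then b else xi z].

Definition nvm (P : V -> V -> R) (p : R) (xi eta : config V) : R :=
  \sum_x #|V|%:R^-1 *
    (p * (\sum_(b : bool) 2^-1 * (eta == set_opinion xi x b)%:R)
     + (1 - p) * (\sum_y P x y * (eta == set_opinion xi x (xi y))%:R)).

Definition is_stationary_nvm (P : V -> V -> R) (p : R)
    (Gamma : probability (config V) R) : Prop :=
  is_stationary (nvm P p) (fun xi => fine (Gamma [set xi])).

Definition voter_S (pi : V -> R) (xi : config V) : R :=
  \sum_x pi x * (xi x)%:R.

Definition voter_sigma (pi : V -> R) (Gamma : probability (config V) R) : R :=
  Num.sqrt (fine 'V_Gamma[voter_S pi]).

Definition voter_W (pi : V -> R) (Gamma : probability (config V) R)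
    (xi : config V) : R :=
  (voter_S pi xi - fine 'E_Gamma[voter_S pi]) / voter_sigma pi Gamma.

Lemma measurable_config (f : config V -> R) : measurable_fun [set: config V] f.
Proof. by []. Qed.

HB.instance Definition _ (pi : V -> R) :=
  isMeasurableFun.Build _ _ _ _ (voter_S pi) (measurable_config (voter_S pi)).

HB.instance Definition _ (pi : V -> R) (Gamma : probability (config V) R) :=
  isMeasurableFun.Build _ _ _ _ (voter_W pi Gamma)
    (measurable_config (voter_W pi Gamma)).

End NoisyVoterModel.

Section ConvergenceInDistribution.
Context {R : realType}.

Definition cvg_in_distribution d (T : nat -> measurableType d)
    (Pr : forall n, probability (T n) R) (X : forall n, {RV (Pr n) >-> R})
    (nu : probability (measurableTypeR R) R) : Prop :=
  let F (t : R) : \bar R := nu `]-oo, t]%classic in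
  forall t : R, {for t, continuous F} -> cdf (X n) t @[n --> \oo] --> F t.

Definition real_of_bool (b : bool) : measurableTypeR R := (b%:R : R).

Lemma measurable_real_of_bool : measurable_fun [set: bool] real_of_bool.
Proof. by []. Qed.

HB.instance Definition _ :=
  isMeasurableFun.Build _ _ _ _ real_of_bool measurable_real_of_bool.

Definition bernoulli_law (q : R) : probability (measurableTypeR R) R :=
  distribution (bernoulli_prob q) real_of_bool.

Definition std_normal_law : probability (measurableTypeR R) R :=
  normal_prob 0 1.

End ConvergenceInDistribution.

Arguments cvg_in_distribution {R d T} Pr X nu.

(* Main.v *)
(* Encode opinions as spins s = 2 xi - 1 and let M be the sum of the spins, so
   that S = (M / n + 1) / 2.  Both walks are symmetric, pi is uniform, and
   p E[M^2] = E[H], where H / n is the conditional mean number of spin flips (up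
   to a factor 2) of one step.  Stationarity, tested against antiderivatives of
   solutions of Stein's equation, gives a normal limit for M / sd(M) as soon as
   the relative variance of H tends to 0; and S tends to a Bernoulli variable as
   soon as E[M^2] / n^2 tends to 1.

   Cycle: the stationary law is the Ising measure giving weight t to each wall,
   with t^2 = p / (2 - p), and H is affine in the number of walls, whose moments
   come from the partition function (1 + t)^n + (1 - t)^n.

   Torus: with G the Green function of the walk killed at rate p, the two-point
   correlations are multiples of G, so that E[H] = n / G(0).  The variance of H
   is bounded by running the walk backwards until it hits the origin: the
   probability of not having hit it after k steps is controlled by Green
   functions killed at rate 1 / (2 N).  Finally G(0) is of order log n, from
   below by Dirichlet's principle with a truncated logarithm as test function,
   and from above, up to the term 1 / (p n), by sending a unit flow out of the
   origin along Polya's urn. *)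
From HB Require Import structures.
Require Import Defs.
From mathcomp Require Import measurable_realfun zify ring lra.

Set Implicit Arguments.
Unset Strict Implicit.
Unset Printing Implicit Defensive.

Local Open Scope classical_set_scope.
Local Open Scope ring_scope.

(** * Stein's method *)

(** Stein's method uses stationarity alone, not reversibility: the generator applied to F(W) has
    mean 0, with F' = f solving Stein's equation. As P is symmetric, the drift of M is exactly
    linear, so the first-order term is -p W f(W) without error; the second-order term is p f'(W) H /
    E[H]. The squared jump of W is 4 p / E[H], so the third-order remainder carries the factor p
    too. After division by p the remainder is O(1 / sqrt n) uniformly in p, and only the variance of
    H matters.

    On the torus no partition function is at hand, but the correlations Q(z) obey a closed linear
    equation for z != 0, while Q(0) = n is deterministic. Hence a linear statistic of Q may have its
    coefficients moved by one killed walk step: its mean is unchanged up to a constant, mass that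
    reaches the origin stops fluctuating, and the variance changes by at most 4 E[H] times the
    squared remaining mass. The first N steps cost at most 1 each in these units; later ones gain a
    factor 4 / Gr(0), where Gr is killed at rate 1 / (2 N). Taking N at most 4 sqrt n, but at least
    of order sqrt n, makes N log n / n small while log N stays comparable to log n. *)

Section Calculus.
Context {R : realType}.
Implicit Types (f df : R -> R) (a b x : R).

Lemma MVT_is_derive f df a b : a <= b ->
  (forall x, a <= x <= b -> is_derive x 1 f (df x)) ->
  exists2 c, a <= c <= b & f b - f a = df c * (b - a).
Proof.
move=> ab fdf; have [||c cab ->] := @MVT_segment R f df a b ab.
- by move=> x; rewrite in_itv/= => /andP[/ltW ax /ltW xb]; apply: fdf; rewrite ax.
- apply: derivable_within_continuous => x; rewrite in_itv/= => xab.
  by have := fdf x xab => -[].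
by exists c => //; move: cab; rewrite in_itv.
Qed.

Lemma is_derive_le f df a b : a <= b ->
  (forall x, a <= x <= b -> is_derive x 1 f (df x)) ->
  (forall x, a <= x <= b -> 0 <= df x) -> f a <= f b.
Proof.
move=> ab fdf df0; have [c cab fE] := MVT_is_derive ab fdf.
by rewrite -subr_ge0 fE mulr_ge0 ?df0// subr_ge0.
Qed.

Lemma is_derive_lipschitz f df (K : R) : (forall x, is_derive x 1 f (df x)) ->
  (forall x, `|df x| <= K) -> forall a b, `|f b - f a| <= K * `|b - a|.
Proof.
move=> fdf dfK a b; wlog ab : a b / a <= b.
  move=> H; have [|/ltW ba] := leP a b; first exact: H.
  by rewrite distrC [X in _ * X]distrC H.
have [c _ ->] := MVT_is_derive ab (fun x _ => fdf x).
by rewrite normrM ler_wpM2r.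
Qed.

Lemma is_derive_cube f df (K u : R) : 0 <= K -> f 0 = 0 ->
  (forall x, `|x| <= `|u| -> is_derive x 1 f (df x)) ->
  (forall x, `|x| <= `|u| -> `|df x| <= K * x ^+ 2) ->
  `|f u| <= K * `|u| ^+ 3.
Proof.
move=> K0 f0 fdf dfK.
have bnd c : `|c| <= `|u| -> `|df c| <= K * `|u| ^+ 2.
  move=> cu; rewrite (le_trans (dfK _ cu))// ler_wpM2l// -(real_normK (num_real c)).
  by rewrite lerXn2r// ?nnegrE.
have -> : `|f u| = `|f u - f 0| by rewrite f0 subr0.
have [u0|/ltW u0] := leP 0 u.
  have sub x : 0 <= x <= u -> `|x| <= `|u|.
    by move=> /andP[x0 xu]; rewrite !ger0_norm.
  have [c /sub cu ->] := MVT_is_derive u0 (fun x h => fdf x (sub x h)).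
  by rewrite subr0 normrM exprSr mulrA ler_wpM2r// bnd.
have sub x : u <= x <= 0 -> `|x| <= `|u|.
  by move=> /andP[ux x0]; rewrite !ler0_norm// lerN2.
have [c /sub cu h] := MVT_is_derive u0 (fun x h => fdf x (sub x h)).
by rewrite distrC h sub0r normrM normrN exprSr mulrA ler_wpM2r// bnd.
Qed.

(** A bounded range is enough for the application, where W takes finitely many values; integrating
    from [- B] requires integrability on segments only. *)
Lemma antiderivative f (B : R) : continuous f ->
  exists F : R -> R, forall x, `|x| < B -> is_derive x 1 F (f x).
Proof.
move=> cf; exists (fun y => \int[lebesgue_measure]_(t in `[- B, y]) f t)%R => x.
rewrite ltr_norml => /andP[Bx xB].
have [|dF FE] := @continuous_FTC1_closed R f (- B) x B xB _ Bx (cf x).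
  apply: continuous_compact_integrable; first exact: segment_compact.
  exact: continuous_subspaceT.
by apply: DeriveDef => //; rewrite -derive1E.
Qed.

End Calculus.

(** * Gaussian tails and Stein's equation for a smoothed indicator *)

Section Gaussian.
Context {R : realType}.
Implicit Types x w t : R.
Notation mu := (@lebesgue_measure R).
Notation g := (@normal_pdf R 0 1).

Definition gauss_cdf x : R := fine (normal_prob 0 1 `]-oo, x]).

Let g_gt0 x : 0 < g x.
Proof. by rewrite normal_pdfE ?oner_eq0// mulr_gt0 ?normal_peak_gt0 ?oner_eq0 ?expR_gt0. Qed.

Let is_derive_g x : is_derive x 1 g (- x * g x).
Proof.
have -> : g = fun x => normal_peak 1 * expR (- x ^+ 2 / 2).
  apply/funext => y; rewrite normal_pdfE ?oner_eq0// /normal_fun subr0 expr1n.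
  by congr (_ * expR (_ / _)).
by apply: is_derive_eq; rewrite /GRing.scale/=; field.
Qed.

Let g_le1 x : g x <= 1.
Proof.
have h : normal_peak (1 : R) <= 1.
  rewrite /normal_peak invf_le1 ?sqrtr_gt0 ?expr1n ?mul1r; last first.
    by rewrite mulrn_wgt0// pi_gt0.
  rewrite -[leLHS]sqrtr1 ler_wsqrtr//.
  by have := pi_ge2 R; lra.
by apply: le_trans h; rewrite normal_pdf_ub ?oner_eq0.
Qed.

Let fE (h : R -> R) w : mu.-integrable setT (EFin \o h) ->
  {for w, continuous h} ->
  is_derive w 1 (fun x => \int[mu]_(t in `]-oo, x]) h t)%R (h w).
Proof.
move=> ih ch; have ww : w < w + 1 by rewrite ltrDl.
have iw : mu.-integrable [set` Interval -oo%O (BRight (w + 1))] (EFin \o h).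
  by apply: integrableS ih.
have [dF FE] := @continuous_FTC1 R h -oo%O w (w + 1) ww iw (ltNyr _) ch.
by apply: DeriveDef => //; rewrite -derive1E.
Qed.

Lemma gauss_cdfE x : gauss_cdf x = (\int[mu]_(t in `]-oo, x]) g t)%R.
Proof. by []. Qed.

Lemma is_derive_gauss_cdf x : is_derive x 1 gauss_cdf (g x).
Proof.
apply: fE; first exact: integrable_normal_pdf.
by apply: continuous_normal_pdf; rewrite oner_eq0.
Qed.

Lemma gauss_cdf_lipschitz x y : `|gauss_cdf y - gauss_cdf x| <= `|y - x|.
Proof.
rewrite -[leRHS]mul1r; apply: (is_derive_lipschitz is_derive_gauss_cdf).
by move=> z; rewrite ger0_norm// ltW.
Qed.

(** The identity has the normal law under [normal_prob 0 1], so the limits of [gauss_cdf] are those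
    of the cdf of a random variable. *)
Let idTR : measurableTypeR R -> R := idfun.

#[local] HB.instance Definition _ :=
  @isMeasurableFun.Build _ _ _ _ idTR (@measurable_id _ _ setT).

Let X : {RV (@normal_prob R 0 1) >-> R} := idTR.

Lemma gauss_cdf_cvgy : gauss_cdf x @[x --> +oo] --> (1 : R).
Proof.
apply: (@fine_cvg _ _ _ _ (cdf X)).
exact: cvg_cdfy1.
Qed.

Lemma gauss_cdf_cvgNy : gauss_cdf x @[x --> -oo] --> (0 : R).
Proof.
apply: (@fine_cvg _ _ _ _ (cdf X)).
exact: cvg_cdfNy0.
Qed.

(** Mills' ratio: the difference of the two sides has derivative g z / z^2 >= 0, and far to the left
    it is at least [- gauss_cdf], which tends to 0. *)
Let mills_left x : x < 0 -> gauss_cdf x <= g x / - x.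
Proof.
move=> x0.
have mono u : u <= x -> - gauss_cdf u <= g x / - x - gauss_cdf x.
  move=> ux; apply: (@le_trans _ _ (g u / - u - gauss_cdf u)).
    have u0 : 0 <= - u by lra.
    by rewrite lerDr divr_ge0// ltW.
  apply: (@is_derive_le _ (fun z => g z / - z - gauss_cdf z) (fun z => g z / z ^+ 2)) => //.
    move=> z /andP[uz zx]; have z0 : - z != 0.
      by rewrite oppr_eq0 lt_eqF// (le_lt_trans zx).
    have dN := is_deriveNid z (1 : R).
    have dV := is_deriveV z0 dN.
    have dp := is_derive_gauss_cdf z.
    have dg := is_derive_g z.
    apply: is_derive_eq; rewrite /GRing.scale/=.
    by field; rewrite -oppr_eq0.
  by move=> z _; rewrite divr_ge0 ?sqr_ge0// ltW.
suff : - 0 <= g x / - x - gauss_cdf x by lra.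
apply: (cvgr_to_le (cvgN gauss_cdf_cvgNy)).
by exists x; split => [|u /ltW]; [exact: num_real|exact: mono].
Qed.

Let mills_right x : 0 < x -> 1 - gauss_cdf x <= g x / x.
Proof.
move=> x0.
have mono u : x <= u -> gauss_cdf u <= g x / x + gauss_cdf x.
  move=> xu; have u0 : 0 <= u by lra.
  rewrite -lerN2; apply: (@le_trans _ _ (- (g u / u + gauss_cdf u))); last first.
    by rewrite lerN2 lerDr divr_ge0// ltW.
  apply: (@is_derive_le _ (fun z => - (g z / z + gauss_cdf z)) (fun z => g z / z ^+ 2)) => //.
    move=> z /andP[xz zu]; have z0 : z != 0 by rewrite gt_eqF// (lt_le_trans x0).
    have dV := @is_deriveV _ id _ 1 1 z0 _.
    have dp := is_derive_gauss_cdf z.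
    have dg := is_derive_g z.
    apply: is_derive_eq; rewrite /GRing.scale/=.
    by field.
  by move=> z _; rewrite divr_ge0 ?sqr_ge0// ltW.
suff : 1 <= g x / x + gauss_cdf x by lra.
apply: (cvgr_to_le gauss_cdf_cvgy).
by exists x; split => [|u /ltW]; [exact: num_real|exact: mono].
Qed.

Section Ramp.
Variables t e : R.
Hypothesis e0 : 0 < e.

(** A Lipschitz substitute for the indicator of ]-oo, t], falling from 1 to 0 on [t, t + e]; for the
    indicator itself the derivative of Stein's solution would jump at [t]. *)
Definition ramp x : R := Num.min 1 (Num.max 0 ((t + e - x) / e)).

Lemma ramp_ge0 x : 0 <= ramp x.
Proof. by rewrite /ramp le_min ler01 le_max lexx. Qed.

Lemma ramp_le1 x : ramp x <= 1.
Proof. by rewrite /ramp ge_min lexx. Qed.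

Lemma ramp_left x : x <= t -> ramp x = 1.
Proof.
move=> xt; have h : 1 <= (t + e - x) / e by rewrite ler_pdivlMr//; lra.
by apply/min_idPl; rewrite le_max h orbT.
Qed.

Lemma ramp_right x : t + e <= x -> ramp x = 0.
Proof.
move=> xt; have h : (t + e - x) / e <= 0.
  by rewrite ler_pdivrMr// mul0r; lra.
by rewrite /ramp (max_idPl h); apply/min_idPr.
Qed.

Lemma ramp_lipschitz x y : `|ramp y - ramp x| <= `|y - x| / e.
Proof.
have -> : `|y - x| / e = `|(t + e - y) / e - (t + e - x) / e|.
  rewrite -mulrBl normrM [ `|e^-1|]gtr0_norm ?invr_gt0// distrC; congr (`|_| / _); lra.
rewrite /ramp; move: ((t + e - y) / e) ((t + e - x) / e) => a b.
rewrite ler_norml; have := ler_norm (a - b); have := lerNnormlW (lexx `|a - b|).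
by rewrite !minEle !maxEle; do ! case: ifP; move=> *; apply/andP; split; lra.
Qed.

Lemma continuous_ramp : continuous ramp.
Proof.
move=> x; apply/cvgrPdist_le => /= eps eps0; near=> y.
rewrite (le_trans (ramp_lipschitz y x))// ler_pdivrMr//.
near: y; apply: cvgr_dist_le => //; exact: mulr_gt0.
Unshelve. all: by end_near. Qed.

Let hg_int : mu.-integrable setT (EFin \o (fun x => ramp x * g x)).
Proof.
apply: (le_integrable _ _ _ (@integrable_normal_pdf R 0 1)) => //.
  apply/measurable_EFinP; apply: measurable_funM.
    exact: continuous_measurable_fun continuous_ramp.
  exact: measurable_normal_pdf.
move=> x _ /=; rewrite lee_fin normrM ler_piMl// ger0_norm ?ramp_ge0//.
exact: ramp_le1.
Qed.

Let A w := (\int[mu]_(x in `]-oo, w]) (ramp x * g x))%R.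

Let is_derive_A w : is_derive w 1 A (ramp w * g w).
Proof.
apply: fE; first exact: hg_int.
apply: continuousM; first exact: continuous_ramp.
by apply: continuous_normal_pdf; rewrite oner_eq0.
Qed.

Let A_left w : w <= t -> A w = gauss_cdf w.
Proof.
move=> wt; rewrite gauss_cdfE; apply: eq_Rintegral => x.
by rewrite inE/= in_itv/= => xw; rewrite ramp_left ?mul1r// (le_trans xw).
Qed.

Let A_le x y : x <= y -> A x <= A y.
Proof.
move=> xy; apply: (is_derive_le xy (fun x _ => is_derive_A x)) => z _.
by rewrite mulr_ge0 ?ramp_ge0// ltW.
Qed.

Let BA_le x y : x <= y -> gauss_cdf x - A x <= gauss_cdf y - A y.
Proof.
move=> xy; apply: (@is_derive_le _ (fun z => gauss_cdf z - A z) (fun z => (1 - ramp z) * g z)) => //.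
  move=> z _; have dg := is_derive_gauss_cdf z; have dA := is_derive_A z.
  by apply: is_derive_eq; ring.
by move=> z _; rewrite mulr_ge0 ?subr_ge0 ?ramp_le1// ltW.
Qed.

(** The Gaussian mean of [ramp], since [ramp] vanishes beyond [t + e]. *)
Let c := A (t + e).

Let A_right w : t + e <= w -> A w = c.
Proof.
move=> tw; have [z /andP[tz _] /eqP] := MVT_is_derive tw (fun x _ => is_derive_A x).
by rewrite ramp_right// !mul0r subr_eq0 => /eqP.
Qed.

Let A_ge0 w : 0 <= A w.
Proof. by apply: Rintegral_ge0 => x _; rewrite mulr_ge0 ?ramp_ge0// ltW. Qed.

Let A_le_cdf w : A w <= gauss_cdf w.
Proof.
have h u : u <= t -> u <= w -> A w <= gauss_cdf w.
  by move=> ut uw; have := BA_le uw; rewrite (A_left ut); lra.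
have [wt|/ltW tw] := leP w t; [exact: (h w)|exact: (h t)].
Qed.

Let c_sub_A w : 0 <= c - A w <= 1 - gauss_cdf w.
Proof.
have h u : t + e <= u -> w <= u -> 0 <= c - A w <= gauss_cdf u - gauss_cdf w.
  move=> tu wu; rewrite -(A_right tu); have := BA_le wu; have := A_le wu.
  by move=> *; apply/andP; split; lra.
have c0 : 0 <= c - A w.
  pose u := Num.max (t + e) w.
  have [tu wu] : t + e <= u /\ w <= u by rewrite /u !le_max !lexx orbT.
  by have /andP[] := h u tu wu.
rewrite c0/=; suff : c - A w + gauss_cdf w <= 1 by lra.
apply: (cvgr_to_ge gauss_cdf_cvgy); exists (Num.max (t + e) w).
split; first exact: num_real.
move=> u; rewrite gt_max => /andP[/ltW tu /ltW wu].
by have /andP[_] := h u tu wu; lra.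
Qed.

Let cdf01 w : 0 <= gauss_cdf w <= 1.
Proof.
have /andP[] := c_sub_A w; have := A_ge0 w; have := A_le_cdf w.
by move=> *; apply/andP; split; lra.
Qed.

Let c_bounds : gauss_cdf t <= c <= gauss_cdf t + e.
Proof.
have te : t <= t + e by rewrite lerDl ltW.
have := A_le te; rewrite (A_left (lexx t)) -/c => -> /=.
have := gauss_cdf_lipschitz t (t + e); rewrite addrAC subrr add0r.
rewrite [X in _ <= X]gtr0_norm// => /ler_normlW.
by have := A_le_cdf (t + e); rewrite -/c; lra.
Qed.

Let I w := A w - c * gauss_cdf w.

(** [I] is the integral of (ramp - c) g up to [w]. It is also c (1 - cdf) - (c - A w), a difference
    of two numbers between 0 and 1 - cdf, which yields the bound useful in the right tail. *)
Let I_bound w : `|I w| <= gauss_cdf w /\ `|I w| <= 1 - gauss_cdf w.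
Proof.
have /andP[a b] := cdf01 w.
have /andP[c1 c2] := c_sub_A w; have A0 := A_ge0 w; have A1 := A_le_cdf w.
have c01 : 0 <= c <= 1.
  by have := cdf01 (t + e); have := A_le_cdf (t + e); have := A_ge0 (t + e);
    rewrite -/c => *; apply/andP; split; lra.
have /andP[c0 c1'] := c01.
have m1 : 0 <= c * gauss_cdf w <= gauss_cdf w.
  by rewrite mulr_ge0// ler_piMl.
have m2 : 0 <= c * (1 - gauss_cdf w) <= 1 - gauss_cdf w.
  by rewrite mulr_ge0 ?subr_ge0// ler_piMl// subr_ge0.
rewrite mulrBr mulr1 in m2.
by split; rewrite /I ler_norml; apply/andP; split; lra.
Qed.

(* Stein's solution [f]; Mills' ratio bounds it in the tails. *)
Let f w := I w / g w.

Let f_bound1 w : `|w * f w| <= 1.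
Proof.
have [->|w0] := eqVneq w 0; first by rewrite mul0r normr0.
have [i1 i2] := I_bound w.
have k : `|I w| <= g w / `|w|.
  have [wp|wn] := ger0P w.
    apply: (le_trans i2); apply: mills_right.
    by rewrite lt_neqAle eq_sym w0.
  by apply: (le_trans i1); exact: mills_left.
rewrite /f normrM normf_div (gtr0_norm (g_gt0 _)) mulrA ler_pdivrMr ?g_gt0// mul1r.
by rewrite mulrC -ler_pdivlMr// normr_gt0.
Qed.

Let K := 1 + (g 1)^-1.

Let f_bound2 w : `|f w| <= K.
Proof.
have gi : 0 < (g 1)^-1 by rewrite invr_gt0.
have [w1|w1] := leP `|w| 1.
  apply: (@le_trans _ _ (g 1)^-1); last by rewrite lerDr.
  rewrite /f normf_div (gtr0_norm (g_gt0 _)).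
  have [i1 i2] := I_bound w; have /andP[a b] := cdf01 w.
  rewrite ler_pdivrMr ?g_gt0//; apply: (@le_trans _ _ 1); first lra.
  rewrite ler_pdivlMl ?g_gt0// mulr1 !normal_pdfE ?oner_eq0//.
  rewrite ler_wpM2l ?normal_peak_ge0// ler_expR /normal_fun !subr0 expr1n.
  rewrite ler_wpM2r// lerN2 -(real_normK (num_real w)) exprn_ile1//.
apply: (@le_trans _ _ 1); last by rewrite lerDl ltW.
have w0 : 0 < `|w| by lra.
rewrite -(ler_pM2l w0) -normrM mulr1 (le_trans (f_bound1 w))// ltW//.
Qed.

(** The increment of f' = w f + ramp - c splits into w (f(w + u) - f(w)), u f(w + u) and an
    increment of [ramp]. The first term produces the factor 1 + |w|, which is harmless because only
    a second moment of W is needed later. *)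
Lemma stein_ramp : exists (c : R) (f f' : R -> R) (L : R),
  [/\ gauss_cdf t <= c <= gauss_cdf t + e, 0 <= L,
      forall w, is_derive w 1 f (f' w),
      forall w, f' w - w * f w = ramp w - c
    & (forall w, `|f' w| <= L) /\
      (forall w u, `|f' (w + u) - f' w| <= L * (1 + `|w|) * `|u|)].
Proof.
have gi : 0 < (g 1)^-1 by rewrite invr_gt0.
have K1 : 1 <= K by rewrite lerDl ltW.
have ei : 0 < e^-1 by rewrite invr_gt0.
have f'_bound w : `|w * f w + ramp w - c| <= 2.
  have := f_bound1 w; have := ramp_ge0 w; have := ramp_le1 w.
  have := cdf01 (t + e); have := A_le_cdf (t + e); have := A_ge0 (t + e).
  rewrite -/c !ler_norml => c0 c1 /andP[_ p1] r1 r0 /andP[fa fb].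
  by apply/andP; split; lra.
(* 2 bounds f' (1 from w f, 1 from ramp - c), [K] bounds f, and 1/e is the Lipschitz constant of
   [ramp]. *)
exists c, f, (fun w => w * f w + ramp w - c), (2 + K + e^-1); split.
- exact: c_bounds.
- lra.
- move=> w; have gw : g w != 0 by rewrite gt_eqF.
  have dg := is_derive_g w; have dV := is_deriveV gw dg.
  have dA := is_derive_A w; have dp := is_derive_gauss_cdf w.
  by apply: is_derive_eq; rewrite /f /I /GRing.scale/=; field.
- by move=> w; ring.
split=> w; first by apply: (le_trans (f'_bound w)); lra.
move=> u; have df (z : R) : is_derive z 1 f (z * f z + ramp z - c).
  have gw : g z != 0 by rewrite gt_eqF.
  have dg := is_derive_g z; have dV := is_deriveV gw dg.
  have dA := is_derive_A z; have dp := is_derive_gauss_cdf z.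
  by apply: is_derive_eq; rewrite /f /I /GRing.scale/=; field.
have lf : `|f (w + u) - f w| <= 2 * `|u|.
  by have := is_derive_lipschitz df f'_bound w (w + u); rewrite addrAC subrr add0r.
have lr : `|ramp (w + u) - ramp w| <= e^-1 * `|u|.
  by have := ramp_lipschitz w (w + u); rewrite addrAC subrr add0r mulrC.
have -> : (w + u) * f (w + u) + ramp (w + u) - c - (w * f w + ramp w - c) =
    w * (f (w + u) - f w) + u * f (w + u) + (ramp (w + u) - ramp w) by ring.
have fk := f_bound2 (w + u).
have nu := normr_ge0 u; have nw := normr_ge0 w.
apply: (@le_trans _ _ (`|w| * (2 * `|u|) + `|u| * K + e^-1 * `|u|)).
  apply: (le_trans (ler_normD _ _)); apply: lerD => //.
  apply: (le_trans (ler_normD _ _)); rewrite (normrM w) (normrM u).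
  by apply: lerD; apply: ler_wpM2l.
have h1 : 0 <= `|w| * `|u| by rewrite mulr_ge0.
have Ke : 0 <= K + e^-1 by lra.
have h2 : 0 <= (K + e^-1) * (`|w| * `|u|) by rewrite mulr_ge0.
rewrite -subr_ge0.
have -> : (2 + K + e^-1) * (1 + `|w|) * `|u| -
  (`|w| * (2 * `|u|) + `|u| * K + e^-1 * `|u|) =
  2 * `|u| + (K + e^-1) * (`|w| * `|u|) by ring.
lra.
Qed.

End Ramp.
End Gaussian.

(** * The noisy voter model with a symmetric walk *)

Record symmetric_voter (R : realType) (V : finType) (P : V -> V -> R) (p : R)
    (gam : config V -> R) : Prop := SymmetricVoter {
  voter_P_ge0 : forall x y, 0 <= P x y;
  voter_P1 : forall x, \sum_y P x y = 1;
  voter_PC : forall x y, P x y = P y x;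
  voter_p01 : 0 < p <= 1;
  voter_stationary : is_stationary (nvm P p) gam }.

(** * Second-order Taylor expansion with a cubic remainder *)

Section Taylor.
Context {R : realType}.
Variables (F f f' : R -> R) (B L : R).
Hypothesis dF : forall x : R, `|x| < B -> is_derive x 1 F (f x).
Hypothesis df : forall x : R, is_derive x 1 f (f' x).
Hypothesis L0 : 0 <= L.
Hypothesis f'_lip : forall w u, `|f' (w + u) - f' w| <= L * (1 + `|w|) * `|u|.

Lemma taylor2 w u : `|w| + `|u| < B ->
  `|F (w + u) - F w - (f w * u + f' w / 2 * u ^+ 2)| <= L * (1 + `|w|) * `|u| ^+ 3.
Proof.
move=> wuB; pose G x := F (w + x) - F w - (f w * x + f' w / 2 * x ^+ 2).
have K0 : 0 <= L * (1 + `|w|) by rewrite mulr_ge0// addr_ge0.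
have dS (x : R) : is_derive x 1 (fun x : R => w + x) 1.
  by rewrite -[X in is_derive _ _ _ X]add0r; apply: is_deriveD.
apply: (@is_derive_cube _ G (fun x => f (w + x) - f w - f' w * x)) => //.
- by rewrite /G addr0; ring.
- move=> x xu; have wxB : `|w + x| < B.
    by apply: le_lt_trans wuB; apply: (le_trans (ler_normD _ _)); rewrite lerD2l.
  have dFx := dF wxB; have dSx := dS x.
  have dC : is_derive x 1 (fun x => F (w + x)) (f (w + x) * 1) := is_derive1_comp dFx dSx.
  by apply: is_derive_eq; rewrite /GRing.scale/=; field.
move=> x xu; rewrite -(real_normK (num_real x)).
pose g y := f (w + y) - f w - f' w * y.
have dg (y : R) : is_derive y 1 g (f' (w + y) - f' w).
  have dfy := df (w + y); have dSy := dS y.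
  have dC : is_derive y 1 (fun x => f (w + x)) (f' (w + y) * 1) := is_derive1_comp dfy dSy.
  by apply: is_derive_eq; rewrite /GRing.scale/=; field.
have g0 : g 0 = 0 by rewrite /g addr0; ring.
have gE : f (w + x) - f w - f' w * x = g x - g 0 by rewrite g0 subr0.
have bnd c : `|c| <= `|x| -> `|f' (w + c) - f' w| <= L * (1 + `|w|) * `|x|.
  by move=> cx; apply: (le_trans (f'_lip _ _)); rewrite ler_wpM2l.
rewrite gE; have [x0|/ltW x0] := leP 0 x.
  have [c /andP[c0 cx] ->] := MVT_is_derive x0 (fun y _ => dg y).
  rewrite subr0 normrM expr2 mulrA ler_wpM2r// bnd//.
  by rewrite !ger0_norm.
have [c /andP[xc c0]] := MVT_is_derive x0 (fun y _ => dg y).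
rewrite distrC => ->; rewrite sub0r normrM normrN expr2 mulrA ler_wpM2r// bnd//.
by rewrite !ler0_norm// lerN2.
Qed.

End Taylor.

(** * Spins, the generator, and Stein's bound for the magnetization *)

Section Configurations.
Context {R : realType} (V : finType).
Implicit Types (xi eta : config V) (x y : V) (f g : V -> R).

Definition flip xi x : config V := set_opinion xi x (~~ xi x).

Definition spin xi x : R := (xi x)%:R *+ 2 - 1.

Lemma flipK x : involutive (flip^~ x).
Proof.
move=> xi; apply/ffunP => z; rewrite !ffunE eqxx.
by have [->|] := eqVneq z x; rewrite ?negbK.
Qed.

Lemma spinE xi x : spin xi x = if xi x then 1 else -1.
Proof. by rewrite /spin; case: (xi x); rewrite ?mulr0n ?mul0rn ?sub0r// mulr2n addrK. Qed.

Lemma spin_sqr xi x : spin xi x * spin xi x = 1.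
Proof. by rewrite spinE; case: (xi x); ring. Qed.

Lemma spin_le1 xi x : -1 <= spin xi x <= 1.
Proof. by rewrite spinE; case: (xi x); apply/andP; split; lra. Qed.

Lemma spin_flip xi x y :
  spin (flip xi x) y = spin xi y - 2 * spin xi x * (y == x)%:R.
Proof.
rewrite !spinE ffunE; have [->|] := eqVneq y x; last by rewrite mulr0 subr0.
by case: (xi x) => /=; ring.
Qed.

Lemma set_opinionE xi x b : set_opinion xi x b = if b == xi x then xi else flip xi x.
Proof.
apply/ffunP => z; have [bE|bN] := eqVneq b (xi x); rewrite !ffunE.
  by have [->|//] := eqVneq z x.
by have [//|//] := eqVneq z x; move: bN; case: b (xi x) => -[].
Qed.

Lemma eq_flip xi eta x : (eta == flip xi x) = (xi == flip eta x).
Proof. by apply/eqP/eqP => ->; rewrite flipK. Qed.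

Variables (P : V -> V -> R) (p : R).

Definition transition f x := \sum_y P x y * f y.

Definition flip_rate xi x : R :=
  (1 - (1 - p) * (spin xi x * transition (spin xi) x)) / 2.

Variable gam : config V -> R.

Definition mean (F : config V -> R) : R := \sum_xi gam xi * F xi.

Hypothesis vm : symmetric_voter P p gam.

Let P_ge0 := voter_P_ge0 vm.
Let P1 := voter_P1 vm.
Let PC := voter_PC vm.
Let p01 := voter_p01 vm.
Let gam_stationary := voter_stationary vm.

Lemma nvmE xi eta : nvm P p xi eta = \sum_x #|V|%:R^-1 *
  (flip_rate xi x * (eta == flip xi x)%:R + (1 - flip_rate xi x) * (eta == xi)%:R).
Proof.
apply: eq_bigr => x _; congr (_ * _).
(* The indicator is affine in the spin of the new opinion [b], so averaging over the coin or over
   the copied neighbour only averages that spin. *)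
have indE b : (eta == set_opinion xi x b)%:R =
    (1 + spin xi x * (b%:R *+ 2 - 1)) / 2 * (eta == xi)%:R +
    (1 - spin xi x * (b%:R *+ 2 - 1)) / 2 * (eta == flip xi x)%:R :> R.
  rewrite set_opinionE spinE.
  by case: b (xi x) => -[] /=; rewrite ?mulr0n ?mulr1n; field.
set a := (eta == xi)%:R : R; set b := (eta == flip xi x)%:R : R.
have -> : \sum_(c : bool) 2^-1 * (eta == set_opinion xi x c)%:R = (a + b) / 2 :> R.
  rewrite [LHS](eq_bigr _ (fun c _ => congr1 _ (indE c))) big_bool/= -/a -/b.
  by rewrite ?mulr0n ?mulr1n; field.
have -> : \sum_y P x y * (eta == set_opinion xi x (xi y))%:R =
    (1 + spin xi x * transition (spin xi) x) / 2 * a +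
    (1 - spin xi x * transition (spin xi) x) / 2 * b.
  transitivity (\sum_y (P x y * ((a + b) / 2) + P x y * spin xi y * (spin xi x * (a - b) / 2))).
    by apply: eq_bigr => y _; rewrite indE -/a -/b -/(spin xi y); field.
  by rewrite big_split/= -!mulr_suml P1 /transition mul1r; field.
by rewrite /flip_rate; field.
Qed.

Lemma transition_bound f x c : (forall y, `|f y| <= c) -> `|transition f x| <= c.
Proof.
move=> fc; apply: (le_trans (ler_norm_sum _ _ _)).
rewrite -[leRHS]mul1r -(P1 x) mulr_suml ler_sum// => y _.
by rewrite normrM (ger0_norm (P_ge0 _ _)) ler_wpM2l.
Qed.

Lemma transition_spin xi x : -1 <= spin xi x * transition (spin xi) x <= 1.
Proof.
rewrite -ler_norml normrM.
have -> : `|spin xi x| = 1 by rewrite spinE; case: (xi x); rewrite ?normrN normr1.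
by rewrite mul1r; apply: transition_bound => y; rewrite ler_norml spin_le1.
Qed.

Lemma flip_rate_ge xi x : p / 2 <= flip_rate xi x.
Proof.
rewrite /flip_rate ler_pM2r ?invr_gt0//.
have /andP[_ h] := transition_spin xi x; have /andP[p0 p1] := p01.
have : (1 - p) * (spin xi x * transition (spin xi) x) <= 1 - p.
  by rewrite ler_piMr// subr_ge0.
lra.
Qed.

Lemma flip_rate_ge0 xi x : 0 <= flip_rate xi x.
Proof. by apply: le_trans (flip_rate_ge xi x); case/andP: p01 => p0 _; lra. Qed.

Lemma sum_transition f g : \sum_x transition f x * g x = \sum_x f x * transition g x.
Proof.
transitivity (\sum_x \sum_y P x y * f y * g x).
  by apply: eq_bigr => x _; rewrite mulr_suml.
rewrite exchange_big/=; apply: eq_bigr => y _; rewrite mulr_sumr.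
by apply: eq_bigr => x _; rewrite PC; ring.
Qed.

Lemma transition_cst c x : transition (fun=> c) x = c.
Proof. by rewrite /transition -mulr_suml P1 mul1r. Qed.

Let gam_ge0 xi : 0 <= gam xi. Proof. by have [] := gam_stationary. Qed.
Let gam1 : \sum_xi gam xi = 1. Proof. by have [] := gam_stationary. Qed.

Lemma mean_cst c : mean (fun=> c) = c.
Proof. by rewrite /mean -mulr_suml gam1 mul1r. Qed.

Lemma meanD F G : mean (fun xi => F xi + G xi) = mean F + mean G.
Proof. by rewrite /mean -big_split; apply: eq_bigr => xi _; rewrite mulrDr. Qed.

Lemma meanZ c F : mean (fun xi => c * F xi) = c * mean F.
Proof. by rewrite /mean mulr_sumr; apply: eq_bigr => xi _; rewrite mulrCA. Qed.

Lemma mean_sum (I : finType) (F : I -> config V -> R) :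
  mean (fun xi => \sum_i F i xi) = \sum_i mean (F i).
Proof. by rewrite /mean exchange_big/=; apply: eq_bigr => xi _; rewrite mulr_sumr. Qed.

Lemma meanB F G : mean (fun xi => F xi - G xi) = mean F - mean G.
Proof. by rewrite /mean -sumrB; apply: eq_bigr => xi _; rewrite mulrBr. Qed.

Lemma le_mean F G : (forall xi, F xi <= G xi) -> mean F <= mean G.
Proof. by move=> FG; apply: ler_sum => xi _; rewrite ler_wpM2l. Qed.

Lemma mean_ge0 F : (forall xi, 0 <= F xi) -> 0 <= mean F.
Proof. by move=> F0; apply: sumr_ge0 => xi _; rewrite mulr_ge0. Qed.

Lemma eq_mean F G : F =1 G -> mean F = mean G.
Proof. by move=> FG; apply: eq_bigr => xi _; rewrite FG. Qed.

Lemma normr_mean F : `|mean F| <= mean (fun xi => `|F xi|).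
Proof.
apply: (le_trans (ler_norm_sum _ _ _)); apply: ler_sum => xi _.
by rewrite normrM (ger0_norm (gam_ge0 _)).
Qed.

Lemma mean_sqr_le F : mean F ^+ 2 <= mean (fun xi => F xi ^+ 2).
Proof.
rewrite -subr_ge0; have : 0 <= mean (fun xi => (F xi - mean F) ^+ 2).
  by apply: mean_ge0 => xi; exact: sqr_ge0.
suff -> : mean (fun xi => (F xi - mean F) ^+ 2) =
  mean (fun xi => F xi ^+ 2) - mean F ^+ 2 by [].
rewrite (@eq_mean _ (fun xi => F xi ^+ 2 - (2 * mean F * F xi - mean F ^+ 2))).
  by rewrite meanB meanB meanZ mean_cst; ring.
by move=> xi; ring.
Qed.

(** On an empty vertex set the kernel is an empty sum, hence zero, and no probability is stationary
    for it. *)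
Lemma card_vertices_gt0 : 0 < #|V|%:R :> R.
Proof.
rewrite ltr0n lt0n; apply/eqP => V0.
have [_ _ /(_ [ffun=> false])] := gam_stationary.
have xi0 xi : xi = [ffun=> false].
  by apply/ffunP => x; have := fintype0 x V0.
rewrite big1 => [h|xi _]; last first.
  rewrite /nvm big_pred0 ?mulr0// => x; by have := fintype0 x V0.
move: gam1; rewrite big1 => [/eqP|xi _]; first by rewrite eq_sym oner_eq0.
by rewrite (xi0 xi) -h.
Qed.

(** Stationarity after cancelling the holding probabilities and the factor 1/n: the flow into [eta]
    balances the flow out of it. *)
Lemma master_equation eta :
  \sum_x gam (flip eta x) * flip_rate (flip eta x) x =
  gam eta * \sum_x flip_rate eta x.
Proof.
have n0 := card_vertices_gt0; set n := #|V|%:R : R.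
have [_ _ /(_ eta)] := gam_stationary.
under eq_bigr do rewrite nvmE mulr_sumr.
rewrite exchange_big/=.
have -> : \sum_x \sum_xi gam xi * (n^-1 * (flip_rate xi x * (eta == flip xi x)%:R
    + (1 - flip_rate xi x) * (eta == xi)%:R)) =
  n^-1 * (\sum_x gam (flip eta x) * flip_rate (flip eta x) x +
          gam eta * (n - \sum_x flip_rate eta x)).
  have -> : n - \sum_x flip_rate eta x = \sum_x (1 - flip_rate eta x).
    by rewrite sumrB sumr_const.
  rewrite mulr_sumr -big_split mulr_sumr; apply: eq_bigr => x _ /=.
  transitivity (\sum_xi (if xi == flip eta x then n^-1 * (gam xi * flip_rate xi x) else 0) +
     \sum_xi (if xi == eta then n^-1 * (gam xi * (1 - flip_rate xi x)) else 0)).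
    rewrite -big_split; apply: eq_bigr => xi _ /=; rewrite eq_flip (eq_sym eta xi).
    by do 2 case: eqP => _; rewrite ?mulr0n ?mulr1n; ring.
  by rewrite -!big_mkcond/= !big_pred1_eq; ring.
move=> /(congr1 (fun z => n * z)) /=; rewrite mulVKf ?gt_eqF//; lra.
Qed.

(** Sum the master equation against [F] and reindex by the involution [flip]. All moment identities
    below come from a choice of [F]. *)
Lemma mean_generator F :
  mean (fun xi => \sum_x flip_rate xi x * (F (flip xi x) - F xi)) = 0.
Proof.
have : \sum_eta F eta * \sum_x gam (flip eta x) * flip_rate (flip eta x) x =
       \sum_eta F eta * (gam eta * \sum_x flip_rate eta x).
  by apply: eq_bigr => eta _; rewrite master_equation.
have -> : \sum_eta F eta * \sum_x gam (flip eta x) * flip_rate (flip eta x) x =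
    \sum_eta \sum_x gam eta * flip_rate eta x * F (flip eta x).
  under eq_bigr do rewrite mulr_sumr.
  rewrite exchange_big [RHS]exchange_big; apply: eq_bigr => x _ /=.
  rewrite [LHS](reindex_inj (inv_inj (flipK x))).
  by apply: eq_bigr => eta _ /=; rewrite flipK mulrC.
move/eqP; rewrite -subr_eq0 -sumrB => /eqP h; rewrite -[RHS]h.
apply: eq_bigr => xi _; rewrite !mulr_sumr -sumrB.
by apply: eq_bigr => x _; ring.
Qed.

Notation E := mean.
Notation n := (#|V|%:R : R).

Definition magnetization xi : R := \sum_x spin xi x.

Definition interface xi : R := \sum_x flip_rate xi x *+ 2.

Notation M := magnetization.
Notation H := interface.

Lemma interfaceE xi :
  H xi = n - (1 - p) * \sum_x spin xi x * transition (spin xi) x.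
Proof.
rewrite mulr_sumr /H -sum1_card natr_sum -sumrB; apply: eq_bigr => x _.
by rewrite /flip_rate mulr2n; field.
Qed.

Lemma interface_ge xi : p * n <= H xi.
Proof.
rewrite -sum1_card natr_sum mulr_sumr; apply: ler_sum => x _.
by rewrite mulr1 mulr2n; have := flip_rate_ge xi x; lra.
Qed.

Lemma magnetization_flip xi x : M (flip xi x) = M xi - 2 * spin xi x.
Proof.
rewrite /M; under eq_bigr do rewrite spin_flip.
rewrite sumrB; congr (_ - _); rewrite (bigD1 x)//= eqxx mulr1 big1 ?addr0// => y.
by move=> /negbTE->; rewrite mulr0.
Qed.

(** Symmetry of P makes copying preserve the magnetization on average, so only the noise contributes
    to the drift. *)
Lemma sum_flip_rate_spin xi :
  \sum_x flip_rate xi x * spin xi x = p / 2 * M xi.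
Proof.
transitivity (\sum_x (2^-1 * spin xi x - (1 - p) / 2 * (transition (spin xi) x * 1))).
  apply: eq_bigr => x _; rewrite /flip_rate.
  have h := spin_sqr xi x; set T := transition _ _.
  transitivity (2^-1 * spin xi x - (1 - p) / 2 * T * (spin xi x * spin xi x)).
    by field.
  by rewrite h; ring.
rewrite sumrB -!mulr_sumr sum_transition.
under [X in _ - _ * X]eq_bigr do rewrite transition_cst mulr1.
by rewrite -/(M xi); field.
Qed.

Lemma mean_magnetization : E M = 0.
Proof.
have /andP[p0 _] := p01.
have := mean_generator M.
rewrite (@eq_mean _ (fun xi => - p * M xi)) => [|xi].
  by rewrite meanZ => /eqP; rewrite mulf_eq0 oppr_eq0 gt_eqF//= => /eqP.
transitivity (\sum_x (- 2) * (flip_rate xi x * spin xi x)).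
  by apply: eq_bigr => x _; rewrite magnetization_flip; ring.
by rewrite -mulr_sumr sum_flip_rate_spin; field.
Qed.

Lemma mean_magnetization_sqr : p * E (fun xi => M xi ^+ 2) = E H.
Proof.
have := mean_generator (fun xi => M xi ^+ 2).
rewrite (@eq_mean _ (fun xi => 2 * H xi - 2 * p * M xi ^+ 2)) => [|xi].
  by rewrite meanB !meanZ; lra.
transitivity (\sum_x (4 * flip_rate xi x - 4 * M xi * (flip_rate xi x * spin xi x))).
  apply: eq_bigr => x _; rewrite magnetization_flip.
  transitivity (flip_rate xi x * (4 * (spin xi x * spin xi x) - 4 * M xi * spin xi x)).
    by ring.
  by rewrite spin_sqr; ring.
rewrite sumrB -!mulr_sumr sum_flip_rate_spin /H sumrMnl mulr2n; by field.
Qed.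

Lemma mean_interface_ge : p * n <= E H.
Proof. by rewrite -(mean_cst (p * n)); apply: le_mean; exact: interface_ge. Qed.

Lemma mean_interface_gt0 : 0 < E H.
Proof.
apply: lt_le_trans mean_interface_ge; rewrite mulr_gt0 ?card_vertices_gt0//.
by case/andP: p01.
Qed.

(* The relative fluctuations of the conditional variance of a step are the
   ones of [interface]. *)
Definition interface_dev xi : R := H xi / E H - 1.

Definition interface_variance : R := E (fun xi => interface_dev xi ^+ 2).

Definition magnetization_sd : R := Num.sqrt (E (fun xi => M xi ^+ 2)).

Notation tau := magnetization_sd.
Notation W := (fun xi => M xi / tau).

Lemma magnetization_sd_sqr : tau ^+ 2 = E H / p.
Proof.
rewrite sqr_sqrtr; last by apply: mean_ge0 => xi; exact: sqr_ge0.
by rewrite -mean_magnetization_sqr mulrC mulKf// gt_eqF//; case/andP: p01.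
Qed.

Lemma magnetization_sd_gt0 : 0 < tau.
Proof.
have : tau != 0.
  rewrite -sqrf_eq0 magnetization_sd_sqr gt_eqF// divr_gt0 ?mean_interface_gt0//.
  by case/andP: p01.
by rewrite lt_def sqrtr_ge0 andbT.
Qed.

Lemma magnetization_sd_ge : n <= tau ^+ 2.
Proof.
rewrite magnetization_sd_sqr ler_pdivlMr 1?mulrC ?mean_interface_ge//.
by case/andP: p01.
Qed.

Lemma mean_W_sqr : E (fun xi => W xi ^+ 2) = 1.
Proof.
have t0 := magnetization_sd_gt0.
rewrite (@eq_mean _ (fun xi => (tau ^+ 2)^-1 * M xi ^+ 2)) => [|xi]; last first.
  by rewrite expr_div_n mulrC.
have M0 : 0 <= E (fun xi => M xi ^+ 2) by apply: mean_ge0 => xi; exact: sqr_ge0.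
by rewrite meanZ -[E _](sqr_sqrtr M0) mulVf// expf_eq0/= gt_eqF.
Qed.

Lemma mean_interface_dev_norm :
  E (fun xi => `|interface_dev xi|) <= Num.sqrt interface_variance.
Proof.
have m0 : 0 <= E (fun xi => `|interface_dev xi|) by apply: mean_ge0.
rewrite -(ger0_norm m0) -sqrtr_sqr.
apply: ler_wsqrtr; apply: le_trans (mean_sqr_le _) _.
by apply: le_mean => xi; rewrite real_normK ?num_real.
Qed.

Lemma mean_stein (h f f' : R -> R) (c L : R) : 0 <= L ->
  (forall w : R, is_derive w 1 f (f' w)) ->
  (forall w, f' w - w * f w = h w - c) ->
  (forall w, `|f' w| <= L) ->
  (forall w u, `|f' (w + u) - f' w| <= L * (1 + `|w|) * `|u|) ->
  `|E (fun xi => h (W xi)) - c| <=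
    L * (Num.sqrt interface_variance + 4 * (3 + interface_variance) / Num.sqrt n).
Proof.
move=> L0 df fh f'L f'lip.
have /andP[p0 p1] := p01; have t0 := magnetization_sd_gt0.
have tN0 : tau != 0 by rewrite gt_eqF.
have EH0 := mean_interface_gt0; have EHN0 : E H != 0 by rewrite gt_eqF.
set v := interface_variance; pose d := 2 / tau.
have d0 : 0 <= d by rewrite divr_ge0// ltW.
(* A range that contains every value of W together with all points within one jump [d] of it, where
   the antiderivative is needed. *)
pose B := \sum_xi `|W xi| + d + 1.
have cf : continuous f.
  by move=> x; apply/differentiable_continuous/derivable1_diffP; have [] := df x.
have [F dF] := antiderivative B cf.
pose dev xi x := F (W (flip xi x)) - F (W xi) -
  (f (W xi) * (- d * spin xi x) + f' (W xi) / 2 * (- d * spin xi x) ^+ 2).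
have dev_le xi x : `|dev xi x| <= L * (1 + `|W xi|) * d ^+ 3.
  have -> : d ^+ 3 = `|- d * spin xi x| ^+ 3.
    rewrite normrM normrN (ger0_norm d0) spinE.
    by case: (xi x); rewrite ?normrN normr1 mulr1.
  have WE : W (flip xi x) = W xi + - d * spin xi x.
    by rewrite magnetization_flip /d; field.
  rewrite /dev WE; apply: (taylor2 dF df L0 f'lip).
  have -> : `|- d * spin xi x| = d.
    rewrite normrM normrN (ger0_norm d0) spinE.
    by case: (xi x); rewrite ?normrN normr1 mulr1.
  rewrite /B (bigD1 xi)//= -addrA; set s := \sum_(_ | _) _.
  have : 0 <= s by apply: sumr_ge0.
  lra.
have stepE xi : \sum_x flip_rate xi x * (F (W (flip xi x)) - F (W xi)) =
    p * (f' (W xi) * (H xi / E H) - W xi * f (W xi)) +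
    \sum_x flip_rate xi x * dev xi x.
  transitivity (\sum_x (- d * f (W xi) * (flip_rate xi x * spin xi x) +
     f' (W xi) / 4 * d ^+ 2 * (flip_rate xi x *+ 2) + flip_rate xi x * dev xi x)).
    apply: eq_bigr => x _; have s2 := spin_sqr xi x.
    have -> : f' (W xi) / 4 * d ^+ 2 * (flip_rate xi x *+ 2) =
       f' (W xi) / 4 * d ^+ 2 * (flip_rate xi x *+ 2) * (spin xi x * spin xi x).
      by rewrite s2 mulr1.
    by rewrite /dev mulr2n; field.
  rewrite !big_split/= -!mulr_sumr sum_flip_rate_spin -/(H xi); congr (_ + _).
  have d2 : d ^+ 2 = 4 * p / E H.
    by rewrite /d expr_div_n magnetization_sd_sqr; field; rewrite EHN0 gt_eqF.
  by rewrite d2 /d; field; rewrite EHN0 tN0.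
have stepI : p * (E (fun xi => h (W xi)) - c) +
    p * E (fun xi => f' (W xi) * interface_dev xi) =
    - E (fun xi => \sum_x flip_rate xi x * dev xi x).
  have /eqP := mean_generator (fun xi => F (W xi)).
  rewrite (eq_mean stepE) meanD meanZ addr_eq0 => /eqP <-.
  rewrite -mulrDr; congr (_ * _).
  rewrite -[X in _ - X](mean_cst c) -meanB -meanD; apply: eq_mean => xi.
  by rewrite -fh /interface_dev; ring.
have bound1 : `|E (fun xi => f' (W xi) * interface_dev xi)| <= L * Num.sqrt v.
  apply: (le_trans (normr_mean _)).
  apply: (@le_trans _ _ (E (fun xi => L * `|interface_dev xi|))).
    by apply: le_mean => xi; rewrite normrM ler_wpM2r.
  by rewrite meanZ ler_wpM2l// mean_interface_dev_norm.
have bound2 : `|E (fun xi => \sum_x flip_rate xi x * dev xi x)| <=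
    p * (L * (2 * d * (3 + v))).
  apply: (le_trans (normr_mean _)).
  have h1 xi : `|\sum_x flip_rate xi x * dev xi x| <=
      p * L * d * 2 * ((1 + `|W xi|) * (H xi / E H)).
    apply: (le_trans (ler_norm_sum _ _ _)).
    apply: (@le_trans _ _ (\sum_x (L * (1 + `|W xi|) * d ^+ 3 / 2) * (flip_rate xi x *+ 2))).
      apply: ler_sum => x _; rewrite normrM (ger0_norm (flip_rate_ge0 _ _)).
      apply: (le_trans (ler_wpM2l (flip_rate_ge0 xi x) (dev_le xi x))).
      by rewrite mulr2n le_eqVlt; apply/orP; left; apply/eqP; field.
    rewrite -mulr_sumr -/(H xi) exprS /d.
    have -> : (2 / tau) ^+ 2 = 4 * p / E H.
      by rewrite expr_div_n magnetization_sd_sqr; field; rewrite EHN0 gt_eqF.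
    rewrite le_eqVlt; apply/orP; left; apply/eqP; field.
    by rewrite tN0 EHN0.
  apply: (le_trans (le_mean h1)); rewrite meanZ.
  have -> : p * (L * (2 * d * (3 + v))) = p * L * d * 2 * (3 + v) by ring.
  apply: (ler_wpM2l (mulr_ge0 (mulr_ge0 (mulr_ge0 (ltW p0) L0) d0) (ler0n _ 2))).
  (* A quadratic majorant obtained by completing the square; its mean is 3 + v because E[W^2] = 1
     and [interface_dev] is centred. *)
  have h2 xi : (1 + `|W xi|) * (H xi / E H) <=
      (W xi ^+ 2 + 3) / 2 + (1 + W xi ^+ 2) / 2 + interface_dev xi ^+ 2 * 1 +
      2 * interface_dev xi.
    have -> : H xi / E H = 1 + interface_dev xi by rewrite /interface_dev; ring.
    set y := interface_dev xi; rewrite -(real_normK (num_real (W xi))).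
    set w := `|W xi|; rewrite -subr_ge0.
    have -> : (w ^+ 2 + 3) / 2 + (1 + w ^+ 2) / 2 + y ^+ 2 * 1 + 2 * y -
       (1 + w) * (1 + y) = (y - (w - 1) / 2) ^+ 2 + (3 * w ^+ 2 - 2 * w + 3) / 4.
      by field.
    have := sqr_ge0 (y - (w - 1) / 2); have := sqr_ge0 (w - 1); have := sqr_ge0 w.
    lra.
  apply: (le_trans (le_mean h2)).
  rewrite !meanD meanZ.
  have -> : E interface_dev = 0.
    rewrite /interface_dev meanB mean_cst (@eq_mean _ (fun xi => (E H)^-1 * H xi)).
      by rewrite meanZ mulVf// subrr.
    by move=> xi; rewrite mulrC.
  rewrite (@eq_mean (fun xi => (W xi ^+ 2 + 3) / 2) (fun xi => 2^-1 * W xi ^+ 2 + 3 / 2)) => [|xi]; last by field.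
  rewrite (@eq_mean (fun xi => (1 + W xi ^+ 2) / 2) (fun xi => 2^-1 * W xi ^+ 2 + 1 / 2)) => [|xi]; last by field.
  rewrite (@eq_mean (fun xi => interface_dev xi ^+ 2 * 1) (fun xi => interface_dev xi ^+ 2)) => [|xi]; last by rewrite mulr1.
  rewrite !meanD !meanZ mean_W_sqr !mean_cst -/interface_variance -/v; lra.
have d_le : d <= 2 / Num.sqrt n.
  have sn0 : 0 < Num.sqrt n by rewrite sqrtr_gt0 card_vertices_gt0.
  rewrite ler_wpM2l// lef_pV2 ?posrE//.
  by rewrite -(ger0_norm (ltW t0)) -sqrtr_sqr ler_wsqrtr// magnetization_sd_ge.
have v0 : 0 <= v by apply: mean_ge0 => xi; exact: sqr_ge0.
have : `|p * (E (fun xi => h (W xi)) - c)| <=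
    p * (L * Num.sqrt v) + p * (L * (2 * d * (3 + v))).
  have -> : p * (E (fun xi => h (W xi)) - c) =
    - E (fun xi => \sum_x flip_rate xi x * dev xi x)
    - p * E (fun xi => f' (W xi) * interface_dev xi) by move: stepI => <-; rewrite addrK.
  apply: (le_trans (ler_normB _ _)); rewrite normrN addrC; apply: lerD => //.
  by rewrite normrM (gtr0_norm p0) ler_pM2l.
rewrite normrM (gtr0_norm p0) -mulrDr ler_pM2l// => hE.
apply: (le_trans hE).
rewrite -mulrDr ler_wpM2l// lerD2l.
have -> : 4 * (3 + v) / Num.sqrt n = 2 * (2 / Num.sqrt n) * (3 + v) by ring.
by rewrite ler_wpM2r ?addr_ge0// ler_wpM2l.
Qed.

End Configurations.

(** * Weak limits of the magnetization *)

Section ConfigurationLaw.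
Context {R : realType} (V : finType) (Gamma : probability (config V) R).
Implicit Types (f : config V -> R).

Definition weight (xi : config V) : R := fine (Gamma [set xi]).

Lemma expectation_config f : ('E_Gamma[f] = (mean weight f)%:E)%E.
Proof.
rewrite unlock.
have -> : setT = \big[setU/set0]_(xi <- index_enum (config V)) [set xi].
  by apply/seteqP; split => // xi _; rewrite -bigcup_seq; exists xi; rewrite //= mem_index_enum.
rewrite (@integral_bigsetU_EFin _ _ _ Gamma _ (fun xi => [set xi]))//.
- rewrite /mean -sumEFin; apply: eq_bigr => xi _.
  rewrite (eq_integral (fun=> (f xi)%:E)) => [|eta]; last first.
    by rewrite inE/= => ->.
  rewrite integral_cst// muleC EFinM; congr (_ * _)%E.
  by rewrite fineK// fin_num_measure.
- exact: index_enum_uniq.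
- by apply/trivIsetP => i j _ _ ij; apply/seteqP; split => // x [-> /eqP]; rewrite (negbTE ij).
Qed.

Lemma measure_config (A : set (config V)) :
  Gamma A = (mean weight (fun xi => (xi \in A)%:R))%:E.
Proof.
rewrite -expectation_config -(@expectation_indic _ _ _ Gamma A)//.
Qed.

Variables (P : V -> V -> R) (p : R) (pi : V -> R).
Hypothesis vm : symmetric_voter P p weight.
Hypothesis piE : forall x, pi x = #|V|%:R^-1.

Notation n := (#|V|%:R : R).
Notation M := (@magnetization R V).
Notation tau := (magnetization_sd weight).

Lemma voter_SE xi : voter_S pi xi = (M xi / n + 1) / 2.
Proof.
have n0 := card_vertices_gt0 vm.
transitivity (\sum_x (n^-1 / 2 * spin xi x + n^-1 / 2 : R)).
  apply: eq_bigr => x _; rewrite piE /spin mulr2n; field.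
  by rewrite gt_eqF.
rewrite big_split/= -mulr_sumr -/(M xi) sumr_const -[_ *+ _]mulr_natr.
by field; rewrite gt_eqF.
Qed.

Lemma expectation_voter_S : ('E_Gamma[voter_S pi] = 2^-1%:E)%E.
Proof.
rewrite expectation_config; congr EFin.
rewrite (@eq_mean _ _ _ _ (fun xi => (2 * n)^-1 * M xi + 2^-1)).
  by rewrite meanD meanZ (mean_cst vm) (mean_magnetization vm) mulr0 add0r.
move=> xi; rewrite voter_SE; have n0 := card_vertices_gt0 vm.
by field; rewrite gt_eqF.
Qed.

Lemma voter_sigmaE : voter_sigma pi Gamma = tau / (2 * n).
Proof.
have n0 := card_vertices_gt0 vm.
rewrite /voter_sigma /variance covariance.unlock expectation_voter_S.
rewrite expectation_config/=.
rewrite (@eq_mean _ _ _ _ (fun xi => (2 * n) ^- 2 * M xi ^+ 2)).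
  rewrite meanZ sqrtrM ?invr_ge0 ?sqr_ge0// sqrtrV ?sqr_ge0//.
  by rewrite sqrtr_sqr ger0_norm 1?mulrC// mulr_ge0// ltW.
move=> xi; transitivity ((voter_S pi xi - 2^-1) * (voter_S pi xi - 2^-1)) => //.
by rewrite voter_SE; field; rewrite gt_eqF.
Qed.

Lemma voter_WE xi : voter_W pi Gamma xi = M xi / tau.
Proof.
have n0 := card_vertices_gt0 vm; have t0 := magnetization_sd_gt0 vm.
rewrite /voter_W voter_sigmaE expectation_voter_S voter_SE/=.
by field; rewrite !gt_eqF.
Qed.

Lemma cdf_config (X : {RV Gamma >-> R}) t :
  cdf X t = (mean weight (fun xi => (X xi <= t)%R%:R))%:E.
Proof.
rewrite /cdf /distribution /pushforward measure_config; congr EFin.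
apply: eq_mean => xi; congr (_%:R); congr nat_of_bool.
by apply/idP/idP; rewrite inE/= in_itv.
Qed.

End ConfigurationLaw.

Section Limits.
Context {R : realType} (V : nat -> finType) (P : forall n, V n -> V n -> R)
  (p : nat -> R) (pi : forall n, V n -> R)
  (Gamma : forall n, probability (config (V n)) R).
Hypothesis vm : \forall n \near \oo, symmetric_voter (@P n) (p n) (weight (Gamma n)).
Hypothesis piE : \forall n \near \oo, forall x, @pi n x = #|V n|%:R^-1.

Lemma cvg_std_normal :
  (#|V n|%:R : R) @[n --> \oo] --> +oo ->
  interface_variance (@P n) (p n) (weight (Gamma n)) @[n --> \oo] --> (0 : R) ->
  cvg_in_distribution Gamma
    (fun n => voter_W (@pi n) (Gamma n) : {RV (Gamma n) >-> R}) std_normal_law.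
Proof.
move=> Vy v0 F t _; rewrite /F -[std_normal_law _](@fineK R) ?fin_num_measure//.
rewrite -[fine _]/(gauss_cdf t).
suff : mean (weight (Gamma n)) (fun xi => (voter_W (@pi n) (Gamma n) xi <= t)%R%:R)
    @[n --> \oo] --> gauss_cdf t.
  by move=> h; under eq_fun do rewrite cdf_config; apply/cvg_EFin => //; exact: nearW.
set v := fun n => interface_variance (@P n) (p n) (weight (Gamma n)).
set b := fun n => Num.sqrt (v n) + 4 * (3 + v n) / Num.sqrt (#|V n|%:R : R).
have b0 : b n @[n --> \oo] --> (0 : R).
  have sv : Num.sqrt (v n) @[n --> \oo] --> (0 : R).
    rewrite -[X in _ --> X](@sqrtr0 R); apply: continuous_cvg => //.
    exact: sqrt_continuous.
  have sV : (Num.sqrt (#|V n|%:R : R))^-1 @[n --> \oo] --> (0 : R).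
    apply/gtr0_cvgV0.
      by near=> n; rewrite sqrtr_gt0; near: n; move/cvgryPgt : Vy; exact.
    apply/cvgryPge => A; near=> n.
    apply: (@le_trans _ _ (Num.sqrt (A ^+ 2))); first by rewrite sqrtr_sqr ler_norm.
    by rewrite ler_wsqrtr//; near: n; move/cvgryPge : Vy; exact.
  have v3 : 4 * (3 + v n) @[n --> \oo] --> 4 * (3 + 0 : R).
    by apply: cvgM; [exact: cvg_cst|apply: cvgD => //; exact: cvg_cst].
  by have := cvgD sv (cvgM v3 sV); rewrite mulr0 addr0; exact.
apply/cvgrPdist_le => /= e e0.
have e20 : 0 < e / 2 by lra.
(* The indicator of ]-oo, t] lies between the ramp falling just before [t] and the one falling just
   after it. Half of [e] pays for the smoothing, half for Stein's bound. *)
have [c1 [f1 [f1' [L1 [/andP[c1a c1b] L10 df1 fh1 [f1L f1lip]]]]]] := stein_ramp t e20.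
have [c2 [f2 [f2' [L2 [/andP[c2a c2b] L20 df2 fh2 [f2L f2lip]]]]]] := stein_ramp (t - e / 2) e20.
have small L : 0 <= L -> \forall n \near \oo, L * b n <= e / 2.
  move=> L0; have : L * b n @[n --> \oo] --> (0 : R).
    by rewrite -[X in _ --> X](mulr0 L); apply: cvgM => //; exact: cvg_cst.
  by move=> /cvgr_le; apply.
have s1 := small L1 L10; have s2 := small L2 L20.
near=> n.
have vmn : symmetric_voter (@P n) (p n) (weight (Gamma n)) by near: n.
have pin : forall x, @pi n x = #|V n|%:R^-1 by near: n.
have B1 : L1 * b n <= e / 2 by near: n.
have B2 : L2 * b n <= e / 2 by near: n.
have := mean_stein vmn L10 df1 fh1 f1L f1lip.
have := mean_stein vmn L20 df2 fh2 f2L f2lip.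
rewrite -/(v n) -/(b n).
set E := mean (weight (Gamma n)).
pose W (xi : config (V n)) := magnetization xi / magnetization_sd (weight (Gamma n)).
have -> : E (fun xi => (voter_W (@pi n) (Gamma n) xi <= t)%R%:R) = E (fun xi => (W xi <= t)%R%:R).
  by apply: eq_mean => xi; rewrite (voter_WE vmn pin).
move=> /ler_normlP[h2 _] /ler_normlP[_ h1].
have u1 : E (fun xi => (W xi <= t)%R%:R) <= E (fun xi => ramp t (e / 2) (W xi)).
  apply: (le_mean vmn) => xi; case: (leP (W xi) t) => [wt|_] /=; last by rewrite ramp_ge0.
  by rewrite (ramp_left e20 wt).
have u2 : E (fun xi => ramp (t - e / 2) (e / 2) (W xi)) <= E (fun xi => (W xi <= t)%R%:R).
  apply: (le_mean vmn) => xi; case: (leP (W xi) t) => [_|wt] /=; first by rewrite ramp_le1.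
  by rewrite (ramp_right e20)//; lra.
have := gauss_cdf_lipschitz t (t - e / 2); rewrite addrAC subrr add0r normrN.
rewrite (gtr0_norm e20) => /ler_normlP[g1 _].
move: h1 h2; rewrite -/E -/W => h1 h2.
by rewrite ler_norml; apply/andP; split; lra.
Unshelve. all: by end_near. Qed.

(** The mean of S (1 - S) is (1 - E[M^2] / n^2) / 4, which tends to 0, so S concentrates near 0 and
    1; E[S] = 1/2 then forces equal masses. *)
Lemma cvg_bernoulli :
  mean (weight (Gamma n)) (fun xi => magnetization xi ^+ 2) / #|V n|%:R ^+ 2
    @[n --> \oo] --> (1 : R) ->
  cvg_in_distribution Gamma
    (fun n => voter_S (@pi n) : {RV (Gamma n) >-> R}) (bernoulli_law 2^-1).
Proof.
move=> M1 F t.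
have FE s : F s = (2^-1 * (1 <= s)%R%:R + 2^-1 * (0 <= s)%R%:R)%:E.
  transitivity (bernoulli_prob (2^-1 : R) (real_of_bool @^-1` `]-oo, s])%classic) => //.
  rewrite bernoulli_probE; last by apply/andP; split; lra.
  have -> : unstable.onem (2^-1 : R) = 2^-1 by rewrite /unstable.onem; lra.
  have dE b : (\d_b (real_of_bool @^-1` `]-oo, s]%classic) = ((b%:R <= s)%R%:R : R)%:E)%E.
    rewrite diracE; congr (_%:R%:E); congr nat_of_bool.
    by apply/idP/idP; rewrite inE/= in_itv.
  by rewrite !dE -!EFinM -EFinD.
rewrite FE => Ft.
suff : mean (weight (Gamma n)) (fun xi => (voter_S (@pi n) xi <= t)%R%:R)
    @[n --> \oo] --> (2^-1 * (1 <= t)%R%:R + 2^-1 * (0 <= t)%R%:R : R).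
  by move=> h; under eq_fun do rewrite cdf_config; apply/cvg_EFin => //; exact: nearW.
have S01 : \forall n \near \oo, forall xi, 0 <= voter_S (@pi n) xi <= 1.
  near=> n => xi.
  have vmn : symmetric_voter (@P n) (p n) (weight (Gamma n)) by near: n.
  have pin : forall x, @pi n x = #|V n|%:R^-1 by near: n.
  have n0 := card_vertices_gt0 vmn.
  rewrite (voter_SE vmn pin).
  have : `|magnetization xi / #|V n|%:R| <= 1 :> R.
    rewrite normf_div (gtr0_norm n0) ler_pdivrMr// mul1r -sum1_card natr_sum.
    apply: (le_trans (ler_norm_sum _ _ _)); apply: ler_sum => x _.
    by rewrite ler_norml spin_le1.
  by rewrite ler_norml => /andP[a b]; apply/andP; split; lra.
have [t0|t0|t0] := ltgtP t 0.
- have t1 : t < 1 by lra.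
  rewrite (lt_geF t1) mulr0 addr0; apply: cvg_near_cst; near=> n.
  rewrite /mean big1// => xi _; have /(_ xi)/andP[a _] : forall xi, 0 <= voter_S (@pi n) xi <= 1 by near: n.
  by rewrite lt_geF ?mulr0//; lra.
- have [t1|t1] := leP 1 t.
    have -> : 2^-1 * true%:R + 2^-1 * true%:R = 1 :> R by rewrite /=; lra.
    apply: cvg_near_cst; near=> n.
    have vmn : symmetric_voter (@P n) (p n) (weight (Gamma n)) by near: n.
    have S01n : forall xi, 0 <= voter_S (@pi n) xi <= 1 by near: n.
    rewrite -[RHS](mean_cst vmn); apply: eq_mean => xi.
    by have /andP[_ a] := S01n xi; rewrite (le_trans a t1).
  rewrite mulr0 mulr1 add0r.
  (* For 0 < t < 1 the indicator of s <= t is compared with 1 - s. The error is s when s <= t and 1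
     - s otherwise, hence at most s (1 - s) / (1 - t) or s (1 - s) / t. *)
  pose C := (1 - t)^-1 + t^-1.
  have Ca : 0 < (1 - t)^-1 by rewrite invr_gt0; lra.
  have Cb : 0 < t^-1 by rewrite invr_gt0.
  have pw s : 0 <= s <= 1 -> `|(s <= t)%R%:R - (1 - s)| <= C * (s * (1 - s)).
    move=> /andP[s0 s1]; rewrite /C mulrDl; have ss : 0 <= s * (1 - s) by rewrite mulr_ge0//; lra.
    have [st|ts] := leP s t.
      apply: (@le_trans _ _ ((1 - t)^-1 * (s * (1 - s)))); last by rewrite lerDl mulr_ge0// ltW.
      rewrite opprB addrCA subrr addr0 ger0_norm// mulrC -mulrA ler_peMr//.
      by rewrite ler_pdivlMr; lra.
    apply: (@le_trans _ _ (t^-1 * (s * (1 - s)))); last by rewrite lerDr mulr_ge0// ltW.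
    rewrite sub0r normrN ger0_norm; last lra.
    rewrite mulrA ler_peMl//; first lra.
    by rewrite mulrC ler_pdivlMr//; lra.
  apply/cvgrPdist_le => /= e e0.
  have C0 : 0 < C by rewrite /C; lra.
  have Ce : 0 < e / (C + 1) by rewrite divr_gt0//; lra.
  move/cvgrPdist_le : M1 => /(_ _ Ce) M1.
  near=> n.
  have vmn : symmetric_voter (@P n) (p n) (weight (Gamma n)) by near: n.
  have pin : forall x, @pi n x = #|V n|%:R^-1 by near: n.
  have S01n : forall xi, 0 <= voter_S (@pi n) xi <= 1 by near: n.
  have n0 := card_vertices_gt0 vmn.
  have M1n : `|1 - mean (weight (Gamma n)) (fun xi => magnetization xi ^+ 2) /
      #|V n|%:R ^+ 2| <= e / (C + 1) by near: n.
  set E := mean (weight (Gamma n)) in M1n *.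
  set m := E (fun xi => magnetization xi ^+ 2) / #|V n|%:R ^+ 2 in M1n.
  have ES : E (fun xi => 1 - voter_S (@pi n) xi) = 2^-1.
    rewrite /E meanB (mean_cst vmn).
    have := expectation_voter_S vmn pin; rewrite expectation_config => -[->].
    by field.
  have ESS : E (fun xi => voter_S (@pi n) xi * (1 - voter_S (@pi n) xi)) = (1 - m) / 4.
    rewrite /E (@eq_mean _ _ _ _ (fun xi => 4^-1 - (4^-1 * #|V n|%:R ^- 2) * magnetization xi ^+ 2)).
      by rewrite meanB (mean_cst vmn) meanZ /m /E; field; rewrite gt_eqF.
    by move=> xi; rewrite (voter_SE vmn pin); field; rewrite gt_eqF.
  rewrite -ES -meanB; apply: (le_trans (normr_mean vmn _)).
  apply: (@le_trans _ _ (C * ((1 - m) / 4))).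
    rewrite -ESS -meanZ; apply: (le_mean vmn) => xi.
    by rewrite distrC; exact: pw.
  have m1 : 1 - m <= e / (C + 1) := le_trans (ler_norm _) M1n.
  have : C * (1 - m) <= e.
    apply: (le_trans (ler_wpM2l (ltW C0) m1)).
    by rewrite mulrA ler_pdivrMr; [rewrite mulrC ler_pM2l//; lra|lra].
  lra.
(* The limit law has an atom at 0, so that 0 is not a continuity point. *)
- exfalso; move: Ft; rewrite t0 => Ft.
  have F1 : F x @[x --> 0^'-] --> F 0.
    by apply: cvg_trans Ft; apply: cvg_app; exact: cvg_within.
  have F2 : F x @[x --> 0^'-] --> 0%E.
    apply: cvg_near_cst; near=> x; have x0 : x < 0 by near: x; exact: nbhs_left_lt.
    have x1 : x < 1 by lra.
    by rewrite FE (lt_geF x0) (lt_geF x1) !mulr0 addr0.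
  have F0 : F 0 = 0%E by exact: (cvg_unique (@ereal_hausdorff R) F1 F2).
  move: F0; rewrite FE lexx (lt_geF ltr01)/=.
  by rewrite mulr0 add0r mulr1 => /eqP; rewrite eqe invr_eq0 pnatr_eq0.
Unshelve. all: by end_near. Qed.

End Limits.

(** The Dirichlet form of [mu] expands to twice the sum of mu^2 minus twice the sum of mu (mu P),
    and stationarity makes this vanish. *)
Lemma stationary_symmetric (R : realType) (V : finType) (P : V -> V -> R) (mu : V -> R) :
  (forall x y, 0 <= P x y) -> (forall x, \sum_y P x y = 1) ->
  (forall x y, P x y = P y x) -> is_stationary P mu ->
  forall x y, P x y != 0 -> mu x = mu y.
Proof.
move=> P0 P1 PC [mu0 mu1 muP] x y Pxy.
have : \sum_x \sum_y P x y * (mu x - mu y) ^+ 2 = 0.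
  have h1 : \sum_x \sum_y P x y * mu x ^+ 2 = \sum_x mu x ^+ 2.
    by apply: eq_bigr => z _; rewrite -mulr_suml P1 mul1r.
  have h2 : \sum_x \sum_y P x y * mu y ^+ 2 = \sum_x mu x ^+ 2.
    rewrite exchange_big; apply: eq_bigr => z _.
    by rewrite -mulr_suml; under eq_bigr do rewrite PC; rewrite P1 mul1r.
  have h3 : \sum_x \sum_y mu x * P x y * mu y = \sum_x mu x ^+ 2.
    rewrite exchange_big; apply: eq_bigr => z _.
    by rewrite -mulr_suml muP expr2.
  transitivity (\sum_x (\sum_y P x y * mu x ^+ 2 + \sum_y P x y * mu y ^+ 2
      - 2 * \sum_y mu x * P x y * mu y)).
    apply: eq_bigr => a _; rewrite mulr_sumr -big_split/= -sumrB.
    by apply: eq_bigr => b _; ring.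
  by rewrite sumrB big_split/= -mulr_sumr h1 h2 h3; ring.
have nn a b : 0 <= P a b * (mu a - mu b) ^+ 2 by rewrite mulr_ge0 ?sqr_ge0.
move/psumr_eq0P => /(_ (fun a _ => sumr_ge0 _ (fun b _ => nn a b)) x isT).
move/psumr_eq0P => /(_ (fun b _ => nn x b) y isT) /eqP.
by rewrite mulf_eq0 (negbTE Pxy)/= sqrf_eq0 subr_eq0 => /eqP.
Qed.

Lemma stationary_uniform (R : realType) (V : finType) (P : V -> V -> R) (mu : V -> R) (x0 : V) :
  is_stationary P mu -> (forall x, mu x = mu x0) -> forall x, mu x = #|V|%:R^-1.
Proof.
move=> [_ mu1 _] muE x; rewrite muE.
have h : mu x0 * #|V|%:R = 1.
  rewrite -[RHS]mu1 (eq_bigr (fun=> mu x0)) => [|y _]; last exact: muE.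
  by rewrite sumr_const mulr_natr.
have V0 : #|V|%:R != 0 :> R.
  by apply/eqP => V0; move: h; rewrite V0 mulr0 => /eqP; rewrite eq_sym oner_eq0.
by apply: (mulIf V0); rewrite h mulVf.
Qed.

(** * Identifying the stationary law from a reversible weight *)

Section Uniqueness.
Context {R : realType} (V : finType) (P : V -> V -> R) (p : R) (gam : config V -> R).
Hypothesis vm : symmetric_voter P p gam.
Notation rate := (flip_rate P p).

(** A zero of [mu] spreads to every neighbour by a flip, since all flip rates are at least p/2 > 0;
    induction on the number of disagreements with [xi0] reaches every configuration. *)
Lemma master_eq0 (mu : config V -> R) (xi0 : config V) :
  (forall xi, 0 <= mu xi) ->
  (forall eta, \sum_x mu (flip eta x) * rate (flip eta x) x = mu eta * \sum_x rate eta x) ->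
  mu xi0 = 0 -> forall xi, mu xi = 0.
Proof.
move=> mu0 muP mu00.
have p0 : 0 < p by case/andP: (voter_p01 vm).
have rate_gt0 xi x : 0 < rate xi x.
  by apply: lt_le_trans (flip_rate_ge vm xi x); rewrite divr_gt0.
have step xi x : mu xi = 0 -> mu (flip xi x) = 0.
  move=> h; have := muP xi; rewrite h mul0r => /psumr_eq0P => /(_ _ x isT) /eqP.
  rewrite mulf_eq0 (gt_eqF (rate_gt0 _ _)) orbF => H; apply/eqP; apply: H.
  by move=> y _; rewrite mulr_ge0// ltW.
have main k (xi : config V) : #|[pred x | xi x != xi0 x]| = k -> mu xi = 0.
  elim: k xi => [|k IH] xi.
    move=> /card0_eq e.
    suff -> : xi = xi0 by [].
    apply/ffunP => x; apply/eqP; apply/negPn/negP => h.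
    by have := e x; rewrite !inE h.
  move=> ck; have [x xP] : exists x, x \in [pred x | xi x != xi0 x].
    by apply/card_gt0P; rewrite ck.
  rewrite -(flipK x xi); apply: step; apply: IH.
  move: ck; rewrite (cardD1 x) xP add1n => -[<-].
  apply: eq_card => y; rewrite !inE !ffunE.
  by have [->|//] := eqVneq y x; move: xP; rewrite inE; case: (xi x) (xi0 x) => -[].
by move=> xi; exact: (main _ xi erefl).
Qed.

(* With [r] the least value of [gam / w], the nonnegative function [gam - r w]
   solves the master equation and vanishes somewhere, hence everywhere. *)
Lemma mean_reversible (w : config V -> R) : (forall xi, 0 < w xi) ->
  (forall xi x, w (flip xi x) * rate (flip xi x) x = w xi * rate xi x) ->
  forall F, mean gam F = (\sum_xi w xi * F xi) / \sum_xi w xi.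
Proof.
move=> w0 wrev; pose c0 : config V := [ffun=> false].
pose xi0 := [arg min_(xi < c0) (gam xi / w xi)]%O.
pose r := gam xi0 / w xi0.
have rE xi : r * w xi <= gam xi.
  rewrite -ler_pdivlMr// /r /xi0; case: Order.TotalTheory.arg_minP => // i _; exact.
have gamE xi : gam xi = r * w xi.
  apply/eqP; rewrite -subr_eq0; apply/eqP.
  apply: (@master_eq0 (fun xi => gam xi - r * w xi) xi0).
  - by move=> eta; rewrite subr_ge0.
  - move=> eta; rewrite mulrBl -(master_equation vm) -mulrA mulr_sumr mulr_sumr -sumrB.
    apply: eq_bigr => x _; rewrite mulrBl -mulrA; congr (_ - _ * _); exact: wrev.
  - by rewrite /r divfK ?subrr// gt_eqF.
have W0 : \sum_xi w xi != 0.
  by rewrite gt_eqF// (bigD1 c0)//= ltr_pwDl ?w0// sumr_ge0// => xi _; exact/ltW.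
have rW : r * \sum_xi w xi = 1.
  have [_ <- _] := voter_stationary vm.
  by rewrite mulr_sumr; apply: eq_bigr => xi _; rewrite gamE.
move=> F; have -> : mean gam F = r * \sum_xi w xi * F xi.
  by rewrite /mean mulr_sumr; apply: eq_bigr => xi _; rewrite gamE mulrA.
by rewrite mulrC; congr (_ * _); apply: (mulIf W0); rewrite rW mulVf.
Qed.

End Uniqueness.

(** * The cycle: Ising partition function *)

Section Walls.
Variable k : nat.
Notation n := k.+1.
Implicit Types (xi b : config 'I_n) (i : 'I_n).

Definition walls xi : nat := (\sum_i (xi i != xi (ordS i)))%N.

(** Coordinate 0 keeps the spin at 0 and each other coordinate records a wall. This change of
    variables is injective, so the bonds range freely over all configurations. *)
Definition bonds xi : config 'I_n :=
  [ffun i => if i == ord0 then xi ord0 else xi i (+) xi (ord_pred i)].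

Lemma val_ord_pred i : i != ord0 -> ord_pred i = i.-1 :> nat.
Proof.
move=> i0; have ip : (0 < i)%N by rewrite lt0n.
rewrite /= -[in LHS](prednK ip) addSn/= modnDr modn_small//.
by rewrite (leq_ltn_trans (leq_pred _)).
Qed.

Lemma bondsP xi i : xi i = odd (\sum_(j : 'I_n | (j <= i)%N) bonds xi j).
Proof.
have [m] := ubnP (i : nat); elim: m i => // m IH i im.
have [->|i0] := eqVneq i ord0.
  rewrite (big_pred1 ord0) ?ffunE ?eqxx ?oddb// => j.
  by rewrite /= leqn0.
have pi := val_ord_pred i0; have ip : (0 < i)%N by rewrite lt0n.
rewrite (bigD1 i)//= ffunE (negbTE i0) oddD oddb.
rewrite [X in _ (+) odd X](_ : _ = \sum_(j : 'I_n | (j <= ord_pred i)%N) bonds xi j)%N.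
  rewrite -IH; last by rewrite pi; lia.
  by rewrite -addbA addbb addbF.
apply: eq_bigl => j; rewrite pi; apply/andP/idP.
  by move=> [ji /eqP jN]; have : j != i :> nat by [apply/eqP => /val_inj]; lia.
move=> h; split; first lia.
by apply/eqP => ji; move: h; rewrite ji; lia.
Qed.

Lemma bonds_inj : injective bonds.
Proof. by move=> xi eta e; apply/ffunP => i; rewrite !bondsP e. Qed.

(** Around a cycle the number of walls is even, so the closing bond is a wall exactly when the other
    bonds carry an odd number of walls. *)
Lemma wallsE xi (m := (\sum_(j | j != ord0) bonds xi j)%N) : walls xi = (m + odd m)%N.
Proof.
have -> : walls xi = (\sum_i (xi (ord_pred i) != xi i))%N.
  rewrite /walls (reindex_inj (can_inj (@ord_predK n))).
  by apply: eq_bigr => i _; rewrite ord_predK.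
rewrite (bigD1 ord0)//= addnC; congr (_ + _)%N.
  by apply: eq_bigr => i i0; rewrite ffunE (negbTE i0); move: (xi i) (xi (ord_pred i)) => [] [].
have pmax : ord_pred (@ord0 k) = ord_max by apply: val_inj; rewrite /= modn_small.
have e : xi ord_max = xi ord0 (+) odd m.
  rewrite [LHS]bondsP (eq_bigl xpredT) => [|j]; last by rewrite -ltnS ltn_ord.
  by rewrite (bigD1 ord0)//= ffunE eqxx oddD oddb.
by rewrite pmax e; move: (xi ord0) (odd m) => [] [].
Qed.

Lemma sum_bonds (A : comNzRingType) (x : A) :
  \sum_(b : config 'I_n) x ^+ (\sum_(j | j != ord0) b j)%N = 2%:R * (1 + x) ^+ k.
Proof.
pose F (j : 'I_n) (c : bool) : A := if j == ord0 then 1 else x ^+ c.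
transitivity (\sum_(b : config 'I_n) \prod_j F j (b j)).
  apply: eq_bigr => b _; rewrite [RHS](bigD1 ord0)//= {1}/F eqxx mul1r expr_sum.
  by apply: eq_bigr => j /negbTE j0; rewrite /F j0.
rewrite -(bigA_distr_bigA F) (bigD1 ord0)//=; congr (_ * _).
  by rewrite big_bool /F eqxx.
rewrite (eq_bigr (fun=> 1 + x)) => [|j /negbTE j0]; last first.
  by rewrite big_bool /F j0 expr1 expr0 addrC.
rewrite prodr_const; congr (_ ^+ _).
by rewrite cardC1 card_ord.
Qed.

(* The partition function of the Ising model on the cycle. *)
Lemma sum_walls (A : comNzRingType) (x : A) :
  2%:R * (\sum_xi x ^+ walls xi) = 2%:R * ((1 + x) ^+ n + (1 - x) ^+ n).
Proof.
pose m b := (\sum_(j | j != ord0) b j)%N.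
have -> : \sum_xi x ^+ walls xi = \sum_(b : config 'I_n) x ^+ (m b + odd (m b)).
  rewrite [RHS](reindex_inj bonds_inj).
  by apply: eq_bigr => xi _; rewrite wallsE.
rewrite mulr_sumr.
(* The parity projection: this equals 2 x^m for even m and 2 x^(m + 1) for odd m. The factor 2
   avoids dividing, so that the identity can be used in a polynomial ring. *)
rewrite (eq_bigr (fun b => (1 + x) * x ^+ m b + (1 - x) * (- x) ^+ m b)).
  rewrite big_split/= -!mulr_sumr !sum_bonds !exprS; ring.
move=> b _; rewrite exprD exprNn -signr_odd.
by case: odd; rewrite ?expr1 ?expr0; ring.
Qed.

End Walls.

(** * Wall moments by differentiating the partition function *)

Section Moments.
Context {R : realType} (k : nat) (t : R).
Notation n := k.+1.
Notation N := (@walls k).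

(** As a polynomial identity it can be differentiated formally; evaluating its two derivatives at
    [t] gives the factorial moments. *)
Let ZX : \sum_xi 'X ^+ N xi = (1 + 'X) ^+ n + (1 - 'X) ^+ n :> {poly R}.
Proof.
apply: (@mulfI _ (2%:R : {poly R})); last exact: sum_walls.
by rewrite -polyC_natr polyC_eq0 pnatr_eq0.
Qed.

Let DX : \sum_xi 'X ^+ (N xi).-1 *+ N xi = ((1 + 'X) ^+ k - (1 - 'X) ^+ k) *+ n :> {poly R}.
Proof.
have := congr1 (@deriv R) ZX.
rewrite raddf_sum/=; under eq_bigr do rewrite derivXn.
move=> ->; rewrite derivD !deriv_exp !derivD derivN derivX -[1]polyC1 derivC.
by rewrite !add0r /= mul1r mulN1r mulNrn -mulrnBl.
Qed.

Let DDX : \sum_xi 'X ^+ (N xi).-2 *+ (N xi).-1 *+ N xi =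
  ((1 + 'X) ^+ k.-1 + (1 - 'X) ^+ k.-1) *+ k *+ n :> {poly R}.
Proof.
have := congr1 (@deriv R) DX.
rewrite raddf_sum/=; under eq_bigr do rewrite derivMn derivXn.
move=> ->; rewrite derivMn derivB !deriv_exp !derivD derivN derivX -[1]polyC1 derivC.
rewrite !add0r /= mul1r mulN1r mulNrn opprK -mulrnDl. by [].
Qed.

Lemma sum_wallsE : \sum_xi t ^+ N xi = (1 + t) ^+ n + (1 - t) ^+ n.
Proof.
have := congr1 (horner^~ t) ZX; rewrite /= horner_sum !hornerE => <-.
by apply: eq_bigr => xi _; rewrite hornerXn.
Qed.

Lemma sum_walls1 : \sum_xi t ^+ N xi * (N xi)%:R =
  n%:R * t * ((1 + t) ^+ k - (1 - t) ^+ k).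
Proof.
have h := congr1 (horner^~ t) DX; rewrite /= horner_sum hornerMn !hornerE in h.
rewrite mulrAC mulr_natl -h mulr_suml; apply: eq_bigr => xi _.
rewrite hornerMn hornerXn -[in RHS]mulr_natr [RHS]mulrAC.
by case: (N xi) => [|m]; rewrite ?mulr0n ?mulr0 //= exprSr.
Qed.

Lemma sum_walls2 : \sum_xi t ^+ N xi * ((N xi)%:R * ((N xi)%:R - 1)) =
  n%:R * k%:R * t ^+ 2 * ((1 + t) ^+ k.-1 + (1 - t) ^+ k.-1).
Proof.
have h := congr1 (horner^~ t) DDX; rewrite /= horner_sum !hornerMn !hornerE in h.
transitivity (t ^+ 2 * (((1 + t) ^+ k.-1 + (1 - t) ^+ k.-1) *+ k *+ n)); last first.
  move: (_ + (1 - t) ^+ _) => A; rewrite -(mulr_natr (A *+ k)) -(mulr_natr A).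
  by move: (n%:R) (k%:R : R) => a b; ring.
rewrite -h mulr_sumr; apply: eq_bigr => xi _.
rewrite !hornerMn hornerXn -[_ *+ N xi]mulr_natr -[_ *+ (N xi).-1]mulr_natr.
case: (N xi) => [|[|m]] /=; [by ring|by ring|].
by rewrite !exprSr; move: (t ^+ m) => x; ring.
Qed.

End Moments.

(** * The walk on the cycle and reversibility of the Ising weights *)

Section CycleWalk.
Context {R : realType} (k : nat).
Hypothesis k2 : (2 <= k)%N.
Notation n := k.+1.
Notation P := (simple_random_walk (@cycle_graph n)).
Implicit Types (i j : 'I_n).

Lemma cycle_edgeE i j : cycle_edge i j = (j == ordS i).
Proof.
rewrite /cycle_edge -[RHS](inj_eq val_inj) /=.
have [e|e] := eqVneq (i : nat) k.
  rewrite e modnn /=; have := ltn_ord j; lia.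
rewrite modn_small ?orbF 1?eq_sym//.
by have := ltn_ord i; rewrite ltnS leq_eqVlt (negbTE e).
Qed.

Lemma cycle_graphE i j : cycle_graph i j = (j == ordS i) || (j == ord_pred i).
Proof.
rewrite /cycle_graph !cycle_edgeE; congr (_ || _).
by apply/eqP/eqP => ->; rewrite ?ordSK ?ord_predK.
Qed.

Lemma ordS_neq i : ordS i != i.
Proof.
apply/eqP => /(congr1 val) /=.
have [e|e] := eqVneq (i : nat) k; first by rewrite e modnn; lia.
by rewrite modn_small; [lia|have := ltn_ord i; lia].
Qed.

Lemma ordS_neq_pred i : ordS i != ord_pred i.
Proof.
apply/eqP => h; have : ordS (ordS i) = i by rewrite h ord_predK.
move=> /(congr1 val) /=.
have [e|e] := eqVneq (i : nat) k; first by rewrite e modnn modn_small; lia.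
rewrite (@modn_small i.+1); last by have := ltn_ord i; lia.
have [e'|e'] := eqVneq (i.+1) k; first by rewrite e' modnn; lia.
by rewrite modn_small; [lia|have := ltn_ord i; lia].
Qed.

Lemma cycle_walkE i j : P i j = ((j == ordS i)%:R + (j == ord_pred i)%:R) / 2 :> R.
Proof.
rewrite /simple_random_walk.
have -> : #|[pred z | cycle_graph i z]| = 2%N.
  rewrite (@eq_card _ _ (pred2 (ordS i) (ord_pred i))) ?card2 ?ordS_neq_pred// => j'.
  by rewrite !inE cycle_graphE.
rewrite cycle_graphE; congr (_ / _).
have [->|_] := eqVneq j (ordS i); first by rewrite (negbTE (ordS_neq_pred i)) addr0.
by rewrite add0r.
Qed.

Lemma sum_cycle_walk i (f : 'I_n -> R) :
  \sum_j P i j * f j = (f (ordS i) + f (ord_pred i)) / 2.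
Proof.
rewrite (bigD1 (ordS i))//= (bigD1 (ord_pred i)) ?(eq_sym _ (ordS i)) ?ordS_neq_pred//=.
rewrite big1 ?addr0 => [|j /andP[/negbTE j1 /negbTE j2]]; last first.
  by rewrite cycle_walkE j1 j2 addr0 mul0r mul0r.
rewrite !cycle_walkE !eqxx (negbTE (ordS_neq_pred i)) eq_sym (negbTE (ordS_neq_pred i)).
by rewrite /=; field.
Qed.

Lemma cycle_walk_ge0 i j : 0 <= P i j :> R.
Proof. by rewrite cycle_walkE divr_ge0// addr_ge0. Qed.

Lemma cycle_walk1 i : \sum_j P i j = 1 :> R.
Proof.
under eq_bigr do rewrite -[P i _]mulr1.
by rewrite sum_cycle_walk; field.
Qed.

Lemma cycle_walkC i j : P i j = P j i :> R.
Proof.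
rewrite !cycle_walkE addrC; congr ((_%:R + _%:R) / _); congr nat_of_bool.
  by apply/eqP/eqP => ->; rewrite ?ordSK ?ord_predK.
by apply/eqP/eqP => ->; rewrite ?ordSK ?ord_predK.
Qed.

Lemma cycle_stationary (mu : 'I_n -> R) : is_stationary P mu ->
  forall i, mu i = #|'I_n|%:R^-1.
Proof.
move=> st; apply: (stationary_uniform (x0 := ord0) st) => i.
have step j : mu (ordS j) = mu j.
  apply: (stationary_symmetric cycle_walk_ge0 cycle_walk1 cycle_walkC st).
  by rewrite cycle_walkC cycle_walkE eqxx (negbTE (ordS_neq_pred j)) addr0 mul1r invr_eq0 pnatr_eq0.
have [m] := ubnP (i : nat); elim: m i => // m IH i im.
have [->//|i0] := eqVneq i ord0.
rewrite -(ord_predK i) step IH// val_ord_pred//.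
have ip : (0 < i)%N by rewrite lt0n.
by lia.
Qed.

Variables (p : R) (gam : config 'I_n -> R).
Hypothesis p01 : 0 < p <= 1.
Hypothesis gam_st : is_stationary (nvm P p) gam.

Lemma cycle_voter : symmetric_voter P p gam.
Proof.
by split => //; [exact: cycle_walk_ge0|exact: cycle_walk1|exact: cycle_walkC].
Qed.

(* The heat-bath dynamics of the Ising model on the cycle is the noisy voter
   model, the weight of a wall being [t]. *)
Definition wall_weight : R := Num.sqrt (p / (2 - p)).

Notation t := wall_weight.
Notation N := (@walls k).

Let p0 : 0 < p. Proof. by case/andP: p01. Qed.
Let p1 : p <= 1. Proof. by case/andP: p01. Qed.
Let p2 : 0 < 2 - p. Proof. by have := p1; lra. Qed.

Lemma wall_weight_sqr : t ^+ 2 = p / (2 - p).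
Proof. by rewrite sqr_sqrtr// divr_ge0// ltW. Qed.

Lemma wall_weight_gt0 : 0 < t.
Proof. by rewrite sqrtr_gt0 divr_gt0. Qed.

Lemma wall_weight_le1 : t <= 1.
Proof. by rewrite -[leRHS]sqrtr1 ler_wsqrtr// ler_pdivrMr// mul1r; have := p1; lra. Qed.

Lemma flip_rate_cycle xi i : flip_rate P p xi i =
  (1 - (1 - p) * (spin xi i * ((spin xi (ordS i) + spin xi (ord_pred i)) / 2))) / 2.
Proof. by rewrite /flip_rate /transition sum_cycle_walk. Qed.

(** Only the two bonds at [i] change. If the neighbours of [i] agree, the rates are p/2 and 1 - p/2,
    whose ratio is t^2; if they differ, the number of walls is unchanged and both rates are 1/2. *)
Lemma ising_reversible xi i :
  t ^+ N (flip xi i) * flip_rate P p (flip xi i) i = t ^+ N xi * flip_rate P p xi i.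
Proof.
pose N' (eta : config 'I_n) := (\sum_(j | (j != i) && (j != ord_pred i)) (eta j != eta (ordS j)))%N.
have ip : ord_pred i != i by rewrite -{2}(ord_predK i) eq_sym ordS_neq.
have NE eta : N eta = ((eta i != eta (ordS i)) + ((eta (ord_pred i) != eta i) + N' eta))%N.
  by rewrite /walls (bigD1 i)//= (bigD1 (ord_pred i))//= ord_predK.
have -> : N (flip xi i) = ((~~ xi i != xi (ordS i)) + ((xi (ord_pred i) != ~~ xi i) + N' xi))%N.
  rewrite NE !ffunE eqxx (negbTE (ordS_neq i)) (negbTE ip); do 2 congr (_ + _)%N.
  apply: eq_bigr => j /andP[ji jp]; rewrite !ffunE (negbTE ji).
  suff /negbTE -> : ordS j != i by [].
  by apply/eqP => e; move: jp; rewrite -e ordSK eqxx.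
rewrite NE !exprD !flip_rate_cycle !spinE !ffunE eqxx (negbTE (ordS_neq i)) (negbTE ip).
have t2 : t * t = p / (2 - p) by rewrite -wall_weight_sqr.
have p2' : 2 - p != 0 by rewrite gt_eqF.
move: (t ^+ N' xi) => x.
case: (xi i) (xi (ordS i)) (xi (ord_pred i)) => -[] [] /=; rewrite ?expr0 ?expr1; try by field.
all: rewrite ?mul1r !mulrA t2; by field.
Qed.

End CycleWalk.

Section PowerBounds.
Context {R : realType} (t : R).
Hypothesis t01 : 0 < t <= 1.
Let t0 : 0 < t. Proof. by case/andP: t01. Qed.
Let t1 : 0 <= 1 - t. Proof. by case/andP: t01; lra. Qed.

Lemma power_sum_diff_ge m : 2 <= (1 + t) ^+ m + (1 - t) ^+ m /\
  2 * m%:R * t <= (1 + t) ^+ m - (1 - t) ^+ m.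
Proof.
elim: m => [|m [IH1 IH2]]; first by rewrite !expr0 mulr0 mul0r subrr; split; lra.
have t0' := t0.
have h : 0 <= t * ((1 + t) ^+ m - (1 - t) ^+ m).
  apply: mulr_ge0; first exact: ltW.
  by apply: le_trans IH2; rewrite !mulr_ge0// ltW.
have h' : t * 2 <= t * ((1 + t) ^+ m + (1 - t) ^+ m) by rewrite ler_pM2l.
by rewrite !exprS -[m.+1%:R]natr1; split; lra.
Qed.

Lemma bernoulli_inequalityB m : 1 - m%:R * t <= (1 - t) ^+ m.
Proof.
elim: m => [|m IH]; first by rewrite mul0r subr0 expr0.
rewrite exprS; apply: (le_trans _ (ler_wpM2l t1 IH)).
have : 0 <= m%:R * t * t by rewrite !mulr_ge0// ltW.
by rewrite -natr1; lra.
Qed.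

Lemma bernoulli_inequalityD m : 1 + m%:R * t <= (1 + t) ^+ m.
Proof.
elim: m => [|m IH]; first by rewrite mul0r addr0 expr0.
have t2 : 0 <= 1 + t by have := t0; lra.
rewrite exprS; apply: (le_trans _ (ler_wpM2l t2 IH)).
have : 0 <= m%:R * t * t by rewrite !mulr_ge0// ltW.
by rewrite -natr1; lra.
Qed.

End PowerBounds.

(** * Estimates for the interface on the cycle *)

Section CycleMoments.
Context {R : realType} (k : nat).
Hypothesis k2 : (2 <= k)%N.
Notation n := k.+1.

Let k1_gt0 : (0 < k.-1)%N. Proof. by lia. Qed.
Let n_le3 : (n <= 3 * k.-1)%N. Proof. by lia. Qed.
Let k1Dn : (k.-1 + n = k * 2)%N. Proof. by lia. Qed.

Notation P := (simple_random_walk (@cycle_graph n)).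
Variables (p : R) (gam : config 'I_n -> R).
Hypothesis p01 : 0 < p <= 1.
Hypothesis gam_st : is_stationary (nvm P p) gam.

Notation t := (wall_weight p).
Notation N := (fun xi => (@walls k xi)%:R : R).
Notation E := (mean gam).
Notation H := (interface P p).

Let p0 : 0 < p. Proof. by case/andP: p01. Qed.
Let p1 : p <= 1. Proof. by case/andP: p01. Qed.
Let vm := cycle_voter k2 p01 gam_st.
Let t0 : 0 < t := wall_weight_gt0 p01.
Let t01 : 0 < t <= 1. Proof. by rewrite t0 wall_weight_le1. Qed.
Let x := 1 + t.
Let y := 1 - t.
Let x0 : 0 < x. Proof. by rewrite /x; have := t0; lra. Qed.
Let y0 : 0 <= y. Proof. by rewrite /y; case/andP: t01; lra. Qed.
Let n0 : 0 < n%:R :> R. Proof. by rewrite ltr0n. Qed.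

Lemma interface_cycle xi : H xi = p * n%:R + 2 * (1 - p) * N xi.
Proof.
rewrite (interfaceE P p xi) card_ord.
have -> : \sum_i spin xi i * transition P (spin xi) i =
    \sum_i spin xi i * spin xi (ordS i) :> R.
  transitivity (2^-1 * \sum_i spin xi i * spin xi (ordS i) +
                2^-1 * \sum_i spin xi i * spin xi (ord_pred i) : R).
    rewrite !mulr_sumr -big_split; apply: eq_bigr => i _ /=.
    by rewrite /transition sum_cycle_walk//; field.
  have -> : \sum_i spin xi i * spin xi (ord_pred i) =
      \sum_i spin xi i * spin xi (ordS i) :> R.
    rewrite (reindex_inj (can_inj (@ordSK n))).
    by apply: eq_bigr => i _; rewrite ordSK mulrC.
  by field.
have -> : \sum_i spin xi i * spin xi (ordS i) = n%:R - 2 * N xi :> R.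
  rewrite /walls natr_sum mulr_sumr -[X in X%:R - _](card_ord n) -sum1_card natr_sum.
  rewrite -sumrB; apply: eq_bigr => i _; rewrite !spinE.
  by case: (xi i) (xi (ordS i)) => -[] /=; ring.
by ring.
Qed.

Let Z : R := x ^+ n + y ^+ n.

Let Z0 : 0 < Z.
Proof. by rewrite ltr_pwDl ?exprn_gt0 ?exprn_ge0. Qed.

Let meanE F : E F = (\sum_xi t ^+ walls xi * F xi) / Z.
Proof.
rewrite (mean_reversible vm (w := fun xi => t ^+ walls xi)) ?sum_wallsE//.
  by move=> xi; rewrite exprn_gt0.
exact: ising_reversible.
Qed.

Let mean_walls : E N = n%:R * t * (x ^+ k - y ^+ k) / Z.
Proof. by rewrite meanE sum_walls1. Qed.

Let mean_walls2 : E (fun xi => N xi * (N xi - 1)) =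
  n%:R * k%:R * t ^+ 2 * (x ^+ k.-1 + y ^+ k.-1) / Z.
Proof. by rewrite meanE sum_walls2. Qed.

Lemma mean_interface_cycle : E H = p * n%:R + 2 * (1 - p) * E N.
Proof.
rewrite (eq_mean gam (G := fun xi => p * n%:R + 2 * (1 - p) * N xi)).
  by rewrite meanD (mean_cst vm) meanZ.
by move=> xi; exact: interface_cycle.
Qed.

(** The right-hand side is E[M^2] / n^2. It is bounded below through E[N] >= n k t^2 (1 - n t),
    which is sharp when n t is small. *)
Lemma cycle_interface_lower :
  n%:R * t <= 1 -> 1 - p - n%:R * t <= E H / (p * n%:R ^+ 2).
Proof.
move=> nt1; have [_ d] := power_sum_diff_ge t01 k.
(* Bernoulli's inequality bounds y^n from below; with this product it bounds x^n, hence the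
   partition function, from above. *)
have xy : x ^+ n * y ^+ n <= 1.
  rewrite -exprMn exprn_ile1//; first by rewrite mulr_ge0// ltW.
  by rewrite /x /y -subr_ge0 (_ : 1 - _ = t ^+ 2) ?sqr_ge0//; ring.
have yn := bernoulli_inequalityB t01 n.
have xn : x ^+ n * (1 - n%:R * t) <= 1.
  by apply: le_trans xy; rewrite ler_wpM2l// exprn_ge0// ltW.
have Zx : Z <= 2 * x ^+ n.
  have : y ^+ n <= x ^+ n by rewrite lerXn2r// ?nnegrE// ?ltW// /x /y; have := t0; lra.
  rewrite /Z; lra.
have nt0 : 0 <= n%:R * t by rewrite mulr_ge0// ltW.
have EN : n%:R * k%:R * t ^+ 2 * (1 - n%:R * t) <= E N.
  rewrite mean_walls ler_pdivlMr//.
  apply: (@le_trans _ _ (n%:R * k%:R * t ^+ 2 * (1 - n%:R * t) * (2 * x ^+ n))).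
    by rewrite ler_wpM2l// !mulr_ge0 ?sqr_ge0 ?subr_ge0 ?(ltW t0).
  have -> : n%:R * k%:R * t ^+ 2 * (1 - n%:R * t) * (2 * x ^+ n) =
    (n%:R * t * (2 * k%:R * t)) * (x ^+ n * (1 - n%:R * t)) by ring.
  apply: (@le_trans _ _ (n%:R * t * (2 * k%:R * t))); last by rewrite ler_wpM2l.
  by rewrite ler_piMr// !mulr_ge0// ltW.
have t2 : p <= 2 * t ^+ 2.
  rewrite (wall_weight_sqr p01) mulrA ler_pdivlMr; last by have := p1; lra.
  have : 0 <= p * p by rewrite mulr_ge0// ltW.
  lra.
rewrite ler_pdivlMr; last by rewrite mulr_gt0// exprn_gt0.
set a := (1 - p) * (1 - n%:R * t).
have a0 : 0 <= a by rewrite mulr_ge0 ?subr_ge0// p1.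
have a1 : a <= 1 by rewrite /a mulr_ile1// ?subr_ge0 ?p1//; have := p0; lra.
apply: (@le_trans _ _ (a * (p * n%:R ^+ 2))).
  apply: ler_wpM2r; first by rewrite mulr_ge0 ?sqr_ge0 ?(ltW p0).
  have : 0 <= p * (n%:R * t) by rewrite mulr_ge0// ltW.
  rewrite /a; lra.
rewrite mean_interface_cycle.
apply: (@le_trans _ _ (p * n%:R + 2 * (1 - p) * (n%:R * k%:R * t ^+ 2 * (1 - n%:R * t)))); last first.
  by rewrite lerD2l ler_wpM2l// mulr_ge0// subr_ge0 p1.
have -> : 2 * (1 - p) * (n%:R * k%:R * t ^+ 2 * (1 - n%:R * t)) =
   2 * t ^+ 2 * (a * n%:R * k%:R) by rewrite /a; ring.
apply: (@le_trans _ _ (p * n%:R + p * (a * n%:R * k%:R))); last first.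
  by rewrite lerD2l (ler_wpM2r (mulr_ge0 (mulr_ge0 a0 _) _)).

have : a * (p * n%:R) <= p * n%:R by rewrite ler_piMl// mulr_ge0// ltW.
have -> : n%:R ^+ 2 = n%:R + n%:R * k%:R :> R by rewrite -natr1; ring.
lra.
Qed.

(** A common bound for y^m / x^m over the three exponents k - 1, k, k + 1 in play. Replacing sums
    and differences of powers by powers of x then costs only factors 1 + r and 1 - r. *)
Let r := (y / x) ^+ k.-1.
Let r0 : 0 <= r. Proof. by rewrite exprn_ge0// divr_ge0// ltW. Qed.

(** The small parameter of the Gaussian regime; the 3 comes from n <= 3 (k - 1). *)
Let z := 3 / (n%:R * t).
Hypothesis z_le : z <= 2^-1.

Let z0 : 0 < z. Proof. by rewrite divr_gt0// mulr_gt0. Qed.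

Let r_le : r <= z.
Proof.
have yx : y / x <= x^-1.
  rewrite ler_piMl ?invr_ge0 ?ltW//; rewrite /y; have := t0; lra.
have xk : k.-1%:R * t <= x ^+ k.-1.
  by apply: le_trans (bernoulli_inequalityD t01 k.-1); rewrite lerDr.
have k0 : 0 < k.-1%:R * t by rewrite mulr_gt0// ltr0n.
apply: (@le_trans _ _ (x^-1 ^+ k.-1)).
  by rewrite lerXn2r// ?nnegrE ?divr_ge0 ?invr_ge0 ?(ltW x0).
rewrite exprVn /z; apply: (@le_trans _ _ (k.-1%:R * t)^-1).
  by rewrite lef_pV2 ?posrE// exprn_gt0.
rewrite ler_pdivlMr ?mulr_gt0// mulrC ler_pdivrMr// mulrA ler_wpM2r ?(ltW t0)//.
by rewrite -natrM ler_nat.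
Qed.

Let yk m : (k.-1 <= m)%N -> y ^+ m <= r * x ^+ m.
Proof.
move=> km; have yx : 0 <= y / x <= 1.
  by rewrite divr_ge0 ?(ltW x0)//= ler_pdivrMr// mul1r /x /y; have := t0; lra.
have -> : y ^+ m = (y / x) ^+ m * x ^+ m by rewrite -exprMn divfK// gt_eqF.
rewrite ler_wpM2r ?exprn_ge0 ?(ltW x0)//; case/andP: yx => *.
exact: ler_wiXn2l.
Qed.

Let q := (1 + r) / (1 - r).

Let q_le : 1 <= q <= 1 + 4 * z.
Proof.
have r2 : r <= 2^-1 := le_trans r_le z_le.
have r1 : 0 < 1 - r by lra.
rewrite /q ler_pdivlMr// ler_pdivrMr// mul1r; apply/andP; split; first by have := r0; lra.
have : r * z <= 2^-1 * z by rewrite ler_wpM2r// ltW.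
have := r_le; lra.
Qed.

Let EN_ge : n%:R * t / (2 * q) <= E N.
Proof.
have r2 : r <= 2^-1 := le_trans r_le z_le.
have r1 : 0 < 1 - r by lra.
have r3 : 0 < 1 + r by have := r0; lra.
have q0 : 0 < q by rewrite divr_gt0.
have yk1 := yk (leq_pred k).
have yk2 := yk (leq_trans (leq_pred k) (leqnSn k)).
rewrite mean_walls -!mulrA ler_pM2l// ler_pM2l//.
have q2 : 0 < 2 * q by lra.
rewrite ler_pdivlMr// mulrC ler_pdivrMr//.
apply: (@le_trans _ _ ((1 + r) * x ^+ n)); first by rewrite /Z; lra.
apply: (@le_trans _ _ ((1 - r) * x ^+ k * (2 * q))); last first.
  by apply: ler_wpM2r; lra.
rewrite /q exprS.
have -> : (1 - r) * x ^+ k * (2 * ((1 + r) / (1 - r))) = (1 + r) * (2 * x ^+ k).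
  by field; rewrite gt_eqF.
rewrite ler_pM2l// ler_wpM2r ?exprn_ge0 ?(ltW x0)//.
by rewrite /x; case/andP: t01; lra.
Qed.

Let EN_gt0 : 0 < E N.
Proof.
have q0 : 0 < 2 * q by have /andP[] := q_le; lra.
by apply: lt_le_trans EN_ge; rewrite divr_gt0// mulr_gt0.
Qed.

(** Since (k - 1) + n = 2 k, the leading powers of x on the two sides match exactly, and only k <= n
    and the factor [q] are lost. *)
Let EN2_le : E (fun xi => N xi * (N xi - 1)) <= (q * E N) ^+ 2.
Proof.
have r2 : r <= 2^-1 := le_trans r_le z_le.
have r1 : 0 < 1 - r by lra.
have r3 : 0 < 1 + r by have := r0; lra.
have yk1 := yk (leq_pred k).
have yk2 := yk (leq_trans (leq_pred k) (leqnSn k)).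
have yk3 := yk (leqnn k.-1).
have xk0 m : 0 < x ^+ m by rewrite exprn_gt0.
have d0 : (1 - r) * x ^+ k <= x ^+ k - y ^+ k by lra.
have d1 : x ^+ k <= (x ^+ k - y ^+ k) / (1 - r) by rewrite ler_pdivlMr// mulrC.
rewrite mean_walls2 ler_pdivrMr//.
have -> : (q * E N) ^+ 2 * Z = n%:R ^+ 2 * t ^+ 2 *
    ((1 + r) * ((x ^+ k - y ^+ k) / (1 - r))) ^+ 2 / Z.
  by rewrite mean_walls /q; field; rewrite !gt_eqF.
rewrite ler_pdivlMr//.
move: (t ^+ 2) (sqr_ge0 t) => T T0.
have -> : n%:R * k%:R * T * (x ^+ k.-1 + y ^+ k.-1) * Z =
  n%:R * (k%:R * (T * ((x ^+ k.-1 + y ^+ k.-1) * Z))) by rewrite !mulrA.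
apply: (@le_trans _ _ (n%:R * (n%:R * (T * (((1 + r) * x ^+ k.-1) * ((1 + r) * x ^+ n)))))).
  apply: (ler_wpM2l (ltW n0)); apply: ler_pM => //.
  - by rewrite mulr_ge0// mulr_ge0 ?(ltW Z0)// addr_ge0 ?exprn_ge0 ?(ltW x0).
  - by rewrite ler_nat.
  apply: (ler_wpM2l T0); apply: ler_pM.
  - by rewrite addr_ge0 ?exprn_ge0 ?(ltW x0).
  - exact: ltW.
  - by lra.
  by rewrite /Z; lra.
have -> : n%:R * (n%:R * (T * ((1 + r) * x ^+ k.-1 * ((1 + r) * x ^+ n)))) =
    n%:R ^+ 2 * (T * ((1 + r) * x ^+ k) ^+ 2).
  have -> : (1 + r) * x ^+ k.-1 * ((1 + r) * x ^+ n) = (1 + r) ^+ 2 * x ^+ (k.-1 + n).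
    by rewrite exprD; ring.
  by rewrite k1Dn exprM exprMn; ring.
rewrite -mulrA; apply: (ler_wpM2l (sqr_ge0 _)); apply: (ler_wpM2l T0).
have a0 : 0 <= (1 + r) * x ^+ k by rewrite mulr_ge0 ?ltW.
have a1 : (1 + r) * x ^+ k <= (1 + r) * ((x ^+ k - y ^+ k) / (1 - r)).
  by rewrite ler_pM2l.
by rewrite lerXn2r// ?nnegrE// (le_trans a0).
Qed.

(** H is affine in N and its constant part is nonnegative, so its relative variance is at most that
    of N, bounded by (q^2 - 1) + z q. With q <= 1 + 4 z and z <= 1/2 these are at most 16 z and 3
    z. *)
Lemma cycle_interface_variance : interface_variance P p gam <= 19 * z.
Proof.
have EN0 := EN_gt0; have EH0 := mean_interface_gt0 vm.
have dev_le xi : interface_dev P p gam xi ^+ 2 <= (N xi / E N - 1) ^+ 2.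
  have -> : interface_dev P p gam xi = 2 * (1 - p) * E N / E H * (N xi / E N - 1).
    have pnE : p * n%:R = E H - 2 * (1 - p) * E N by rewrite mean_interface_cycle; ring.
    by rewrite /interface_dev interface_cycle pnE; field; rewrite !gt_eqF.
  rewrite exprMn ler_piMl ?sqr_ge0// exprn_ile1//.
    by rewrite divr_ge0 ?(ltW EH0)// !mulr_ge0 ?subr_ge0 ?p1 ?(ltW EN0).
  rewrite ler_pdivrMr// mul1r mean_interface_cycle lerDr mulr_ge0//; exact: ltW.
apply: (le_trans (le_mean vm dev_le)).
have -> : E (fun xi => (N xi / E N - 1) ^+ 2) =
    (E (fun xi => N xi * (N xi - 1)) - E N ^+ 2) / E N ^+ 2 + (E N)^-1.
  rewrite (eq_mean gam (G := fun xi => E N ^- 2 * (N xi * (N xi - 1)) +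
    (E N ^- 2 - 2 / E N) * N xi + 1)).
    rewrite !meanD !meanZ (mean_cst vm); field; by rewrite gt_eqF.
  by move=> xi; field; rewrite gt_eqF.
have /andP[q1 q2] := q_le; have z00 := z0.
have nt0 : 0 < n%:R * t by rewrite mulr_gt0.
have bE : (E N)^-1 <= z * q.
  have h : 0 < n%:R * t / (2 * q) by rewrite divr_gt0// mulr_gt0//; lra.
  apply: (@le_trans _ _ (n%:R * t / (2 * q))^-1); first by rewrite lef_pV2.
  rewrite invf_div /z [leRHS]mulrAC ler_pM2r ?invr_gt0//; move: (q) q1 => q' q1'; lra.
have bV : (E (fun xi => N xi * (N xi - 1)) - E N ^+ 2) / E N ^+ 2 <= q ^+ 2 - 1.
  rewrite ler_pdivrMr ?exprn_gt0// mulrBl mul1r lerD2r.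
  by rewrite -exprMn; exact: EN2_le.
have q3 : q ^+ 2 <= (1 + 4 * z) ^+ 2 by rewrite lerXn2r// ?nnegrE; lra.
have zq : z * q <= z * (1 + 4 * z) by rewrite ler_pM2l.
have zz : z * z <= z * 2^-1 by rewrite ler_pM2l// z_le.
have : (1 + 4 * z) ^+ 2 = 1 + 8 * z + 16 * (z * z) by ring.
lra.
Qed.

End CycleMoments.

Lemma mean_magnetization_sqr_le (R : realType) (V : finType) (P : V -> V -> R) (p : R)
    (gam : config V -> R) : symmetric_voter P p gam ->
  mean gam (fun xi => magnetization xi ^+ 2) / #|V|%:R ^+ 2 <= 1.
Proof.
move=> vm; have n0 := card_vertices_gt0 vm.
rewrite ler_pdivrMr ?exprn_gt0// mul1r -[leRHS](mean_cst vm); apply: (le_mean vm) => xi.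
rewrite -(real_normK (num_real (magnetization xi))) lerXn2r// ?nnegrE ?(ltW n0)//.
rewrite -sum1_card natr_sum.
apply: (le_trans (ler_norm_sum _ _ _)); apply: ler_sum => x _.
by rewrite ler_norml spin_le1.
Qed.

(** * Limit theorems on the cycle *)

Section Cycle.
Context {R : realType}.
Variables (p : nat -> R) (pi : forall n : nat, 'I_n -> R)
  (Gamma : forall n : nat, probability (config 'I_n) R).
Notation P n := (simple_random_walk (@cycle_graph n)).
Hypothesis p01 : forall n, (3 <= n)%N -> 0 < p n <= 1.
Hypothesis piS : forall n, (3 <= n)%N -> is_stationary (P n) (@pi n).
Hypothesis GammaS : forall n, (3 <= n)%N -> is_stationary_nvm (P n) (p n) (Gamma n).

Let vm n : (3 <= n)%N -> symmetric_voter (P n) (p n) (weight (Gamma n)).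
Proof.
case: n => // k k3; apply: cycle_voter => //; [exact: p01|exact: GammaS].
Qed.

Let piE n : (3 <= n)%N -> forall x, @pi n x = #|'I_n|%:R^-1.
Proof. by case: n => // k k3; apply: cycle_stationary => //; exact: piS. Qed.

Let vm_near : \forall n \near \oo, symmetric_voter (P n) (p n) (weight (Gamma n)).
Proof. by exists 3%N => // n /= n3; exact: vm. Qed.

Let piE_near : \forall n \near \oo, forall x, @pi n x = #|'I_n|%:R^-1.
Proof. by exists 3%N => // n /= n3; exact: piE. Qed.

Let t n := wall_weight (p n).

Let t_bounds n : (3 <= n)%N ->
  Num.sqrt (p n * n%:R ^+ 2 / 2) <= n%:R * t n <= Num.sqrt (p n * n%:R ^+ 2).
Proof.
move=> n3; have p01n := p01 n3; have /andP[p0 p1] := p01n.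
have -> : n%:R * t n = Num.sqrt (n%:R ^+ 2 * t n ^+ 2).
  by rewrite -exprMn sqrtr_sqr ger0_norm// mulr_ge0// ltW// wall_weight_gt0.
have p2 : 0 < 2 - p n by lra.
have pp : 0 <= p n * (1 - p n) by rewrite mulr_ge0 ?subr_ge0 ?(ltW p0).
have n2 : 0 <= n%:R ^+ 2 :> R by exact: sqr_ge0.
rewrite wall_weight_sqr//; apply/andP; split; apply: ler_wsqrtr.
  rewrite mulrAC mulrC; apply: ler_wpM2l => //.
  have pp2 : 0 <= p n * p n by rewrite mulr_ge0// ltW.
  by rewrite ler_pdivlMr//; lra.
rewrite mulrC; apply: ler_wpM2r => //.
by rewrite ler_pdivrMr//; lra.
Qed.

Lemma cycle_cvg_normal : p n * n%:R ^+ 2 @[n --> \oo] --> +oo ->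
  cvg_in_distribution Gamma
    (fun n => voter_W (@pi n) (Gamma n) : {RV (Gamma n) >-> R}) std_normal_law.
Proof.
move=> poo; apply: (cvg_std_normal vm_near piE_near).
  under eq_fun do rewrite card_ord; exact: cvgr_idn.
have ntoo : n%:R * t n @[n --> \oo] --> +oo.
  apply/cvgryPge => A; near=> n.
  have n3 : (3 <= n)%N by near: n; exists 3%N.
  have /andP[h _] := t_bounds n3; apply: le_trans h.
  apply: (@le_trans _ _ (Num.sqrt (A ^+ 2))); first by rewrite sqrtr_sqr ler_norm.
  apply: ler_wsqrtr; rewrite ler_pdivlMr//.
  by near: n; move/cvgryPge : poo; exact.
have z0 : 19 * (3 / (n%:R * t n)) @[n --> \oo] --> (0 : R).
  have h : (n%:R * t n)^-1 @[n --> \oo] --> (0 : R).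
    apply/gtr0_cvgV0 => //; near=> n.
    by near: n; move/cvgryPgt : ntoo; exact.
  rewrite -[X in _ --> X](mulr0 19); apply: cvgM; first exact: cvg_cst.
  by rewrite -[X in _ --> X](mulr0 3); apply: cvgM => //; exact: cvg_cst.
apply: squeeze_cvgr (cvg_cst 0) z0; near=> n.
have n3 : (3 <= n)%N by near: n; exists 3%N.
have zn : 3 / (n%:R * t n) <= 2^-1.
  have h : 6 <= n%:R * t n by near: n; move/cvgryPge : ntoo; exact.
  by rewrite ler_pdivrMr; lra.
rewrite (mean_ge0 (vm n3)) => [|xi]; last exact: sqr_ge0.
move: n3 zn; rewrite /t.
case: (n) => // k k3 zn /=; apply: cycle_interface_variance => //.
  exact: p01.
exact: GammaS.
Unshelve. all: by end_near. Qed.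

Lemma cycle_cvg_bernoulli : p n * n%:R ^+ 2 @[n --> \oo] --> (0 : R) ->
  cvg_in_distribution Gamma
    (fun n => voter_S (@pi n) : {RV (Gamma n) >-> R}) (bernoulli_law 2^-1).
Proof.
move=> p0; apply: (cvg_bernoulli vm_near piE_near).
have lo : 1 - p n * n%:R ^+ 2 - Num.sqrt (p n * n%:R ^+ 2) @[n --> \oo] --> (1 : R).
  have sv : Num.sqrt (p n * n%:R ^+ 2) @[n --> \oo] --> (0 : R).
    rewrite -[X in _ --> X](@sqrtr0 R); apply: continuous_cvg => //.
    exact: sqrt_continuous.
  by have := cvgB (cvgB (cvg_cst (1 : R)) p0) sv; rewrite !subr0; exact.
apply: (squeeze_cvgr _ lo (cvg_cst (1 : R))); near=> n.
have n3 : (3 <= n)%N by near: n; exists 3%N.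
rewrite (mean_magnetization_sqr_le (vm n3)) andbT.
have /andP[pn0 pn1] := p01 n3.
have /andP[_ nt] := t_bounds n3.
have n1 : 1 <= n%:R :> R by rewrite ler1n; lia.
have s1 : Num.sqrt (p n * n%:R ^+ 2) <= 1.
  rewrite -[leRHS]sqrtr1; apply: ler_wsqrtr.
  by near: n; move/cvgr_le : p0; apply.
have pnn : p n <= p n * n%:R ^+ 2 by rewrite ler_peMr ?(ltW pn0)// exprn_ege1.
apply: (@le_trans _ _ (1 - p n - n%:R * t n)); first lra.
have -> : mean (weight (Gamma n)) (fun xi => magnetization xi ^+ 2) / #|'I_n|%:R ^+ 2 =
    mean (weight (Gamma n)) (interface (P n) (p n)) / (p n * n%:R ^+ 2).
  rewrite -(mean_magnetization_sqr (vm n3)) card_ord; field.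
  by rewrite !gt_eqF//; lra.
have nt1 : n%:R * t n <= 1 by exact: le_trans nt s1.
move: n3 nt1; rewrite /t.
case: (n) => // k k3 nt1 /=; apply: cycle_interface_lower => //.
  exact: p01.
exact: GammaS.
Unshelve. all: by end_near. Qed.

End Cycle.

(** * Green functions of walks on finite abelian groups *)

Section KilledWalk.
Context {R : realType} (V : finZmodType) (w : V -> R).
Hypothesis w_ge0 : forall x, 0 <= w x.
Hypothesis w1 : \sum_x w x = 1.
Hypothesis wN : forall x, w (- x) = w x.
Hypothesis w0 : w 0 = 0.
Implicit Types (f g : V -> R) (r : R) (x y z : V).

Definition step x y : R := w (y - x).

Notation P := step.
Notation T := (transition step).

Lemma step_ge0 x y : 0 <= P x y. Proof. exact: w_ge0. Qed.

Lemma step1 x : \sum_y P x y = 1.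
Proof.
rewrite -w1 [RHS](reindex_inj (addIr (- x))).
by apply: eq_bigr.
Qed.

Lemma stepC x y : P x y = P y x.
Proof. by rewrite /P -wN opprB. Qed.

Definition delta0 x : R := (x == 0)%:R.

Lemma sum_delta0 f : \sum_x delta0 x * f x = f 0.
Proof.
rewrite (bigD1 0)//= /delta0 eqxx mul1r big1 ?addr0// => x /negbTE ->.
by rewrite mul0r.
Qed.

Lemma transition_delta0 x : T delta0 x = w x.
Proof.
rewrite /transition; under eq_bigr do rewrite mulrC.
by rewrite sum_delta0 /step sub0r wN.
Qed.

Definition killed r f x : R := f x - (1 - r) * T f x.

Notation A := killed.

Lemma transitionD f g x : T (fun y => f y + g y) x = T f x + T g x.
Proof. by rewrite /transition -big_split; apply: eq_bigr => y _; rewrite mulrDr. Qed.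

Lemma transitionZ (c : R) f x : T (fun y => c * f y) x = c * T f x.
Proof. by rewrite /transition mulr_sumr; apply: eq_bigr => y _; rewrite mulrCA. Qed.

Lemma eq_transition f g x : f =1 g -> T f x = T g x.
Proof. by move=> fg; apply: eq_bigr => y _; rewrite fg. Qed.

Lemma killedC r f g : \sum_x A r f x * g x = \sum_x f x * A r g x.
Proof.
have h : \sum_x T f x * g x = \sum_x f x * T g x.
  transitivity (\sum_x \sum_y P x y * f y * g x).
    by apply: eq_bigr => x _; rewrite mulr_suml.
  rewrite exchange_big/=; apply: eq_bigr => y _; rewrite mulr_sumr.
  by apply: eq_bigr => x _; rewrite stepC; ring.
transitivity (\sum_x f x * g x - (1 - r) * \sum_x T f x * g x).
  by rewrite mulr_sumr -sumrB; apply: eq_bigr => x _; rewrite /A; ring.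
rewrite h mulr_sumr -sumrB; apply: eq_bigr => x _; rewrite /A; ring.
Qed.

Lemma sum_step f : \sum_x T f x = \sum_x f x.
Proof.
rewrite /transition exchange_big; apply: eq_bigr => y _ /=.
by rewrite -mulr_suml; under eq_bigr do rewrite stepC; rewrite step1 mul1r.
Qed.

Lemma sum_killed r f : \sum_x A r f x = r * \sum_x f x.
Proof. by rewrite /A sumrB -mulr_sumr sum_step; ring. Qed.

Lemma killed_energy r f : \sum_x f x * A r f x =
  r * \sum_x f x ^+ 2 + (1 - r) / 2 * \sum_x \sum_y P x y * (f x - f y) ^+ 2.
Proof.
have h1 : \sum_x \sum_y P x y * f x ^+ 2 = \sum_x f x ^+ 2.
  by apply: eq_bigr => z _; rewrite -mulr_suml step1 mul1r.
have h2 : \sum_x \sum_y P x y * f y ^+ 2 = \sum_x f x ^+ 2.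
  by rewrite -[RHS](sum_step (fun x => f x ^+ 2)).
have -> : \sum_x \sum_y P x y * (f x - f y) ^+ 2 =
    2 * (\sum_x f x ^+ 2 - \sum_x f x * T f x).
  transitivity (\sum_x (\sum_y P x y * f x ^+ 2 + \sum_y P x y * f y ^+ 2
      - 2 * (f x * T f x))).
    apply: eq_bigr => a _; rewrite /transition !mulr_sumr -big_split/= -sumrB.
    by apply: eq_bigr => b _; ring.
  by rewrite sumrB big_split/= -mulr_sumr h1 h2; ring.
have -> : \sum_x f x * A r f x = \sum_x f x ^+ 2 - (1 - r) * \sum_x f x * T f x.
  by rewrite mulr_sumr -sumrB; apply: eq_bigr => x _; rewrite /A; ring.
by field.
Qed.

Lemma killed_energy_ge0 r f : 0 <= r <= 1 -> 0 <= \sum_x f x * A r f x.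
Proof.
move=> /andP[r0 r1]; rewrite killed_energy addr_ge0// mulr_ge0 ?sumr_ge0//.
- by move=> x _; exact: sqr_ge0.
- by rewrite divr_ge0// subr_ge0.
move=> x _; apply: sumr_ge0 => y _; by rewrite mulr_ge0 ?sqr_ge0 ?step_ge0.
Qed.

Section Green.
Variable r : R.
Hypothesis r01 : 0 < r <= 1.
Let r0 : 0 < r. Proof. by case/andP: r01. Qed.
Let r1 : 0 <= 1 - r. Proof. by case/andP: r01 => _; rewrite subr_ge0. Qed.

(** Maximum principle: averaging and killing strictly shrink a nonzero maximum of |f|. *)
Lemma killed_inj f : (forall x, A r f x = 0) -> forall x, f x = 0.
Proof.
move=> f0; pose m := [arg max_(x > (0 : V)) `|f x|]%O.
have fm x : `|f x| <= `|f m|.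
  by rewrite /m; case: Order.TotalTheory.arg_maxP => // i _; exact.
have h : `|f m| <= (1 - r) * `|f m|.
  have /eqP := f0 m; rewrite /A subr_eq0 => /eqP {1}->.
  rewrite normrM (ger0_norm r1) ler_wpM2l//.
  apply: (le_trans (ler_norm_sum _ _ _)).
  rewrite -[leRHS]mul1r -(step1 m) mulr_suml; apply: ler_sum => y _.
  by rewrite normrM (ger0_norm (step_ge0 _ _)) ler_wpM2l ?step_ge0.
have : r * `|f m| <= 0 by lra.
rewrite pmulr_rle0// normr_le0 => /eqP m0 x.
by apply/eqP; rewrite -normr_le0 (le_trans (fm x))// m0 normr0.
Qed.

(** In finite dimension injectivity of the killed operator makes its matrix invertible. *)
Lemma green_exists : exists G : V -> R, forall x, A r G x = delta0 x.
Proof.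
pose M : 'M[R]_#|V| := \matrix_(i, j)
  ((i == j)%:R - (1 - r) * P (enum_val i) (enum_val j)).
have ME (u : 'cV[R]_#|V|) i :
    (M *m u) i 0 = A r (fun x => u (enum_rank x) 0) (enum_val i).
  rewrite mxE /A enum_valK.
  transitivity (\sum_j ((i == j)%:R * u j 0 -
      (1 - r) * (P (enum_val i) (enum_val j) * u j 0))).
    by apply: eq_bigr => j _; rewrite mxE; ring.
  rewrite sumrB -mulr_sumr; congr (_ - _ * _).
    rewrite (bigD1 i)//= eqxx mul1r big1 ?addr0// => j ji.
    by rewrite eq_sym (negbTE ji) mul0r.
  rewrite /transition [RHS](reindex (@enum_val V V)) /=; last first.
    by apply: onW_bij; exact: enum_val_bij.
  by apply: eq_bigr => j _; rewrite enum_valK.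
have Mu : M \in unitmx.
  rewrite -unitmx_tr -row_free_unit -kermx_eq0 -nz_row_eq0; apply/eqP.
  set v := nz_row _.
  have /sub_kermxP vM : (v <= kermx M^T)%MS by exact: nz_row_sub.
  have Mv : M *m v^T = 0 by rewrite -[M]trmxK -trmx_mul vM trmx0.
  apply/rowP => j; rewrite mxE.
  have := @killed_inj (fun x => v^T (enum_rank x) 0) _ (enum_val j).
  rewrite enum_valK mxE; apply => x.
  by rewrite -(enum_rankK x) -ME Mv mxE.
pose d : 'cV[R]_#|V| := \col_i delta0 (enum_val i).
exists (fun x => (invmx M *m d) (enum_rank x) 0) => x.
by rewrite -{1}(enum_rankK x) -ME mulKVmx// mxE enum_rankK.
Qed.

Variable G : V -> R.
Hypothesis GE : forall x, A r G x = delta0 x.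

Lemma green_ge0 x : 0 <= G x.
Proof.
pose m := [arg min_(x < (0 : V)) G x]%O.
have Gm y : G m <= G y.
  by rewrite /m; case: Order.TotalTheory.arg_minP => // i _; exact.
apply: le_trans (Gm x); have := GE m; rewrite /A => h.
have : G m <= T G m.
  rewrite -[leLHS]mul1r -(step1 m) mulr_suml; apply: ler_sum => y _.
  by rewrite ler_wpM2l ?step_ge0.
move=> /(ler_wpM2l r1) h'.
have : 0 <= delta0 m by rewrite ler0n.
rewrite -h => h''; have : 0 <= r * G m by lra.
by rewrite pmulr_rge0.
Qed.

Lemma sum_green : \sum_x G x = r^-1.
Proof.
have := sum_killed r G; under eq_bigr do rewrite GE.
have -> : \sum_x delta0 x = 1.
  by under eq_bigr do rewrite -[delta0 _]mulr1; rewrite (sum_delta0 (fun=> 1)).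
by move=> h; apply: (mulfI (lt0r_neq0 r0)); rewrite -h divff// gt_eqF.
Qed.

(** At a maximum off the origin G = (1 - r) T G <= (1 - r) G, so the maximum would be at most 0. *)
Lemma green_le0 x : G x <= G 0.
Proof.
pose m := [arg max_(x > (0 : V)) G x]%O.
have Gm y : G y <= G m.
  by rewrite /m; case: Order.TotalTheory.arg_maxP => // i _; exact.
have [m0|m0] := eqVneq m 0; first by rewrite -m0.
apply: le_trans (Gm x) _; have := GE m; rewrite /A /delta0 (negbTE m0) /= => h.
have : T G m <= G m.
  rewrite -[leRHS]mul1r -(step1 m) mulr_suml; apply: ler_sum => y _.
  by rewrite ler_wpM2l ?step_ge0.
move=> /(ler_wpM2l r1) h'.
have : r * G m <= 0 by lra.
rewrite pmulr_rle0// => /le_trans; apply; exact: green_ge0.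
Qed.

Lemma green0_gt0 : 0 < G 0.
Proof.
rewrite lt0r green_ge0 andbT; apply/eqP => G0.
have Gx x : G x = 0 by apply/eqP; rewrite eq_le green_ge0 -{1}G0 green_le0.
have := sum_green; rewrite big1// => /eqP.
by rewrite eq_sym invr_eq0 gt_eqF.
Qed.

Lemma green_energy : \sum_x G x * A r G x = G 0.
Proof. by under eq_bigr do rewrite GE mulrC; rewrite sum_delta0. Qed.

(** G / G(0) minimises the energy: the difference [h] from it vanishes at the origin, so it is
    orthogonal to G for the energy form, and its own energy is nonnegative. *)
Lemma green_dirichlet f : f 0 = 1 -> (G 0)^-1 <= \sum_x f x * A r f x.
Proof.
move=> f0; have G0 := green0_gt0; have GN := lt0r_neq0 G0.
pose h x := f x - (G 0)^-1 * G x.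
have h0 : h 0 = 0 by rewrite /h f0 mulVf// subrr.
have Ah x : A r h x = A r f x - (G 0)^-1 * delta0 x.
  rewrite -GE /A /h.
  have -> : T (fun y => f y - (G 0)^-1 * G y) x = T f x - (G 0)^-1 * T G x.
    rewrite (@eq_transition _ (fun y => f y + (- (G 0)^-1) * G y)).
      by rewrite transitionD transitionZ; ring.
    by move=> y; ring.
  ring.
have : 0 <= \sum_x h x * A r h x by apply: killed_energy_ge0; rewrite (ltW r0)/= -subr_ge0.
have -> : \sum_x h x * A r h x = \sum_x f x * A r f x - (G 0)^-1; last by lra.
have -> : \sum_x h x * A r h x = \sum_x h x * A r f x - (G 0)^-1 * \sum_x delta0 x * h x.
  rewrite mulr_sumr -sumrB; apply: eq_bigr => x _; rewrite Ah; ring.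
rewrite sum_delta0 h0 mulr0 subr0.
have -> : \sum_x h x * A r f x = \sum_x f x * A r f x - (G 0)^-1 * \sum_x A r G x * f x.
  rewrite killedC mulr_sumr -sumrB; apply: eq_bigr => x _; rewrite /h; ring.
by under [X in _ - _ * X]eq_bigr do rewrite GE; rewrite sum_delta0 f0 mulr1.
Qed.

End Green.

(* The walk started from a neighbour of the origin and stopped upon hitting it. *)
Fixpoint taboo k x : R :=
  if k is k'.+1 then (x != 0)%:R * T (taboo k') x else w x.

Definition survival k : R := \sum_x taboo k x.

Lemma taboo_ge0 k x : 0 <= taboo k x.
Proof.
elim: k x => [|k IH] x //=; rewrite mulr_ge0//; apply: sumr_ge0 => y _.
by rewrite mulr_ge0 ?step_ge0.
Qed.

Lemma survival_ge0 k : 0 <= survival k.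
Proof. by apply: sumr_ge0 => x _; exact: taboo_ge0. Qed.

Lemma survivalS k : survival k.+1 <= survival k.
Proof.
rewrite /survival -(sum_step (taboo k)); apply: ler_sum => x _ /=.
rewrite ler_piMl//; first by apply: sumr_ge0 => y _; rewrite mulr_ge0 ?step_ge0 ?taboo_ge0.
by case: (x != 0).
Qed.

Lemma survival_le i j : (i <= j)%N -> survival j <= survival i.
Proof.
move=> ij; rewrite -(subnK ij); elim: (j - i)%N => // d IH.
by rewrite addSn; apply: le_trans IH; exact: survivalS.
Qed.

Lemma survival_le1 k : survival k <= 1.
Proof. by apply: le_trans (survival_le (leq0n k)) _; rewrite /survival /= w1. Qed.

(** [u K] is the occupation density of one killed excursion from the origin, cut after K steps; A
    maps it to a multiple of the delta at 0 minus a tail. Pairing this with 1 and with G eliminates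
    the multiple, and the tail has the right sign because G <= G(0). *)
Lemma sum_survival_le r G K : 0 < r <= 1 -> (forall x, A r G x = delta0 x) ->
  r * G 0 * (1 + \sum_(k < K) (1 - r) ^+ k.+1 * survival k) <= 1.
Proof.
move=> r01 GE; have /andP[r0 r1] := r01.
pose u K x := delta0 x + \sum_(k < K) (1 - r) ^+ k.+1 * taboo k x.
have [d uE] : exists d, forall x, A r (u K) x = d * delta0 x - (1 - r) ^+ K.+1 * taboo K x.
  elim: K => [|K [d IH]].
    exists 1 => x; rewrite /A /u big_ord0 addr0 /=.
    rewrite (@eq_transition _ delta0); last by move=> y; rewrite big_ord0 addr0.
    by rewrite transition_delta0 expr1; ring.
  exists (d - (1 - r) ^+ K.+2 * T (taboo K) 0) => x.
  have uS y : u K.+1 y = u K y + (1 - r) ^+ K.+1 * taboo K y.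
    by rewrite /u big_ord_recr/= addrA.
  have -> : A r (u K.+1) x = A r (u K) x + (1 - r) ^+ K.+1 * (taboo K x - (1 - r) * T (taboo K) x).
    rewrite /A uS (eq_transition _ uS) transitionD transitionZ; ring.
  rewrite IH /= /delta0 !exprS; have [->|x0] := eqVneq x 0.
    by rewrite /=; ring.
  by rewrite /=; ring.
have u0 : u K 0 = 1.
  rewrite /u /delta0 eqxx big1 ?addr0// => k _.
  by case: k => [[|k] /= _]; rewrite ?w0 ?eqxx ?mul0r ?mulr0.
have G0 := green0_gt0 r01 GE.
have sA : r * (1 + \sum_(k < K) (1 - r) ^+ k.+1 * survival k) = d - (1 - r) ^+ K.+1 * survival K.
  have -> : 1 + \sum_(k < K) (1 - r) ^+ k.+1 * survival k = \sum_x u K x.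
    rewrite big_split/=; congr (_ + _).
      under [RHS]eq_bigr do rewrite -[delta0 _]mulr1; by rewrite (sum_delta0 (fun=> 1)).
    by rewrite exchange_big; apply: eq_bigr => k _; rewrite mulr_sumr.
  rewrite -sum_killed; under eq_bigr do rewrite uE.
  rewrite sumrB -!mulr_sumr; congr (_ - _).
  by under eq_bigr do rewrite -[delta0 _]mulr1; rewrite (sum_delta0 (fun=> 1)) mulr1.
have dE : d * G 0 = 1 + (1 - r) ^+ K.+1 * \sum_x taboo K x * G x.
  have : \sum_x A r G x * u K x = 1.
    by under eq_bigr do rewrite GE; rewrite sum_delta0.
  rewrite killedC => h; rewrite -[X in X + _]h.
  have -> : d * G 0 = \sum_x d * (delta0 x * G x) by rewrite -mulr_sumr sum_delta0.
  by rewrite mulr_sumr -big_split; apply: eq_bigr => x _ /=; rewrite uE; ring.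
have tG : \sum_x taboo K x * G x <= survival K * G 0.
  rewrite mulr_suml; apply: ler_sum => x _.
  by rewrite ler_wpM2l ?taboo_ge0// (green_le0 r01 GE).
have rK : 0 <= (1 - r) ^+ K.+1 by rewrite exprn_ge0// subr_ge0.
have := ler_wpM2l rK tG.
have -> : r * G 0 * (1 + \sum_(k < K) (1 - r) ^+ k.+1 * survival k) =
  d * G 0 - (1 - r) ^+ K.+1 * (survival K * G 0).
  by rewrite mulrAC sA; ring.
by rewrite dE; lra.
Qed.

(** At this killing rate each of the first K weights is at least 1/2, and survival decreases, so
    [sum_survival_le] bounds G(0) times survival K by 4. *)
Lemma survival_green_le G K : (0 < K)%N ->
  (forall x, A (2 * K%:R)^-1 G x = delta0 x) -> survival K <= 4 / G 0.
Proof.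
move=> K0; pose r : R := (2 * K%:R)^-1; rewrite -/r => GE.
have K1 : 1 <= K%:R :> R by rewrite ler1n.
have rK : r * K%:R = 2^-1 by rewrite /r; field; lra.
have r01 : 0 < r <= 1.
  have K2 : 0 < 2 * K%:R :> R by lra.
  by rewrite invr_gt0 K2 invf_le1//; lra.
have /andP[r0 r1] := r01; have G0 := green0_gt0 r01 GE.
have bern m : 1 - m%:R * r <= (1 - r) ^+ m.
  elim: m => [|m IH]; first by rewrite mul0r subr0 expr0.
  have h : 0 <= 1 - r by lra.
  rewrite exprS; apply: (le_trans _ (ler_wpM2l h IH)).
  have : 0 <= m%:R * r * r by rewrite !mulr_ge0// ltW.
  by rewrite -natr1; lra.
have := sum_survival_le K r01 GE; set s := \sum_(_ < _) _.
have sK : K%:R * (2^-1 * survival K) <= s.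
  rewrite mulr_natl -[X in _ *+ X](card_ord K) -sumr_const; apply: ler_sum => k _.
  apply: ler_pM => //; [exact: survival_ge0| |exact/survival_le/ltnW].
  apply: le_trans (bern k.+1).
  have : k.+1%:R * r <= K%:R * r by rewrite ler_wpM2r ?(ltW r0)// ler_nat.
  lra.
move=> h; rewrite ler_pdivlMr//.
have rG : 0 <= r * G 0 by rewrite mulr_ge0// ltW.
have := ler_wpM2l rG sK.
have -> : r * G 0 * (K%:R * (2^-1 * survival K)) = (r * K%:R) * 2^-1 * (survival K * G 0) by ring.
rewrite rK; lra.
Qed.

End KilledWalk.

(** * Two-point correlations and the variance of the interface *)

Section Correlations.
Context {R : realType} (V : finZmodType) (w : V -> R).
Hypothesis w_ge0 : forall x, 0 <= w x.
Hypothesis w1 : \sum_x w x = 1.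
Hypothesis wN : forall x, w (- x) = w x.
Hypothesis w0 : w 0 = 0.
Notation P := (step w).
Notation T := (transition P).
Notation A := (killed w).
Notation n := (#|V|%:R : R).

Definition correlation (xi : config V) (z : V) : R := \sum_x spin xi x * spin xi (x + z).

Notation Q := correlation.

Lemma correlation0 xi : Q xi 0 = n.
Proof.
rewrite /Q -sum1_card natr_sum; apply: eq_bigr => x _.
by rewrite addr0 spin_sqr.
Qed.

Lemma correlation_le xi z : `|Q xi z| <= n.
Proof.
rewrite -sum1_card natr_sum; apply: (le_trans (ler_norm_sum _ _ _)).
apply: ler_sum => x _; rewrite normrM !spinE.
by case: (xi x) (xi (x + z)) => -[]; rewrite ?normrN normr1 mul1r.
Qed.

Lemma transition_shift (f : V -> R) x z : T (fun y => f (y + z)) x = T f (x + z).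
Proof.
rewrite /transition [RHS](reindex_inj (addIr z)); apply: eq_bigr => y _.
by rewrite /step opprD addrACA subrr addr0.
Qed.

Lemma transition_correlation xi z :
  T (Q xi) z = \sum_x spin xi x * T (spin xi) (x + z).
Proof.
rewrite /transition /Q; under eq_bigr do rewrite mulr_sumr.
rewrite exchange_big; apply: eq_bigr => x _ /=; rewrite mulr_sumr.
rewrite [RHS](reindex_inj (addrI x)); apply: eq_bigr => y _.
rewrite /step opprD addrACA subrr add0r; ring.
Qed.

Lemma transition_correlation' xi z :
  T (Q xi) z = \sum_x T (spin xi) x * spin xi (x + z).
Proof.
rewrite transition_correlation.
transitivity (\sum_x \sum_y P x y * spin xi x * spin xi (y + z)).
  apply: eq_bigr => x _; rewrite -transition_shift /transition mulr_sumr.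
  by apply: eq_bigr => y _; ring.
rewrite exchange_big; apply: eq_bigr => x _ /=; rewrite /transition mulr_suml.
by apply: eq_bigr => y _; rewrite (stepC wN).
Qed.

Lemma correlation_flip xi x z : z != 0 ->
  Q (flip xi x) z = Q xi z - 2 * (spin xi x * (spin xi (x + z) + spin xi (x - z))).
Proof.
move=> z0; rewrite /Q.
have e y : spin (flip xi x) y * spin (flip xi x) (y + z) =
    spin xi y * spin xi (y + z) - ((y == x)%:R * (2 * (spin xi x * spin xi (y + z))) +
      (y == x - z)%:R * (2 * (spin xi x * spin xi y))) :> R.
  rewrite !spin_flip.
  have -> : (y + z == x) = (y == x - z) by rewrite eq_sym -subr_eq eq_sym.
  have [->|_] := eqVneq y x; last by rewrite /=; ring.
  have -> : (x == x - z) = false.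
    by rewrite -[X in X == _]subr0 (inj_eq (addrI x)) oppr0 eq_sym oppr_eq0 (negbTE z0).
  by rewrite /=; ring.
rewrite (eq_bigr _ (fun y _ => e y)) sumrB big_split/=; congr (_ - _).
rewrite (bigD1 x)//= eqxx mul1r big1 ?addr0 => [|y /negbTE ->]; last by rewrite mul0r.
rewrite (bigD1 (x - z))//= eqxx mul1r big1 ?addr0 => [|y /negbTE ->]; last by rewrite mul0r.
by ring.
Qed.

Variables (p : R) (gam : config V -> R).
Hypothesis vm : symmetric_voter P p gam.
Notation E := (mean gam).
Notation H := (interface P p).
Notation rate := (flip_rate P p).

Let p0 : 0 < p. Proof. by case/andP: (voter_p01 vm). Qed.
Let p1 : 0 <= 1 - p. Proof. by case/andP: (voter_p01 vm); rewrite subr_ge0. Qed.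

Lemma interface_correlation xi : H xi = A p (Q xi) 0.
Proof.
rewrite interfaceE /killed correlation0 transition_correlation; congr (_ - _ * _).
by apply: eq_bigr => x _; rewrite addr0.
Qed.

(** The equation closes because s_x^2 = 1 removes the higher products. The origin is excluded since
    Q(0) is the constant n. *)
Lemma generator_correlation xi z : z != 0 ->
  \sum_x rate xi x * (Q (flip xi x) z - Q xi z) = - 2 * A p (Q xi) z.
Proof.
move=> z0.
have h1 : \sum_x spin xi x * spin xi (x - z) = Q xi z.
  rewrite /Q [LHS](reindex_inj (addIr z)); apply: eq_bigr => x _.
  by rewrite addrK mulrC.
have h2 : \sum_x T (spin xi) x * spin xi (x - z) = T (Q xi) z.
  rewrite transition_correlation [LHS](reindex_inj (addIr z)); apply: eq_bigr => x _.
  by rewrite addrK mulrC.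
transitivity (- (\sum_x spin xi x * spin xi (x + z) + \sum_x spin xi x * spin xi (x - z)
    - (1 - p) * (\sum_x T (spin xi) x * spin xi (x + z) +
                 \sum_x T (spin xi) x * spin xi (x - z)))).
  rewrite -!big_split mulr_sumr -sumrB -[RHS]sumrN; apply: eq_bigr => x _ /=.
  rewrite correlation_flip// /flip_rate; have s2 := spin_sqr xi x.
  set s := spin xi x in s2 *; set a := spin xi _; set b := spin xi _; set t := T _ _.
  transitivity (- (s * (a + b) - (1 - p) * t * (s * s) * (a + b))); first by field.
  by rewrite s2; ring.
by rewrite h1 h2 -transition_correlation' -/(Q xi z) /killed; ring.
Qed.

Lemma mean_killed_correlation z :
  E (fun xi => A p (Q xi) z) = if z == 0 then E H else 0.
Proof.
have [->|z0] := eqVneq z 0.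
  by apply: eq_mean => xi; rewrite interface_correlation.
have := mean_generator vm (fun xi => Q xi z).
rewrite (eq_mean gam (fun xi => generator_correlation xi z0)) meanZ => /eqP.
by rewrite mulf_eq0 oppr_eq0 pnatr_eq0/= => /eqP.
Qed.

Variable G : V -> R.
Hypothesis GE : forall x, A p G x = delta0 x.

(** E[Q] solves the killed equation with a source E[H] at the origin, so it is E[H] G there, and
    Q(0) = n fixes the multiple. *)
Lemma mean_interface_green : E H * G 0 = n.
Proof.
have -> : E H * G 0 = E (fun xi => \sum_z A p (Q xi) z * G z).
  rewrite [RHS]mean_sum [RHS](bigD1 0)//= [X in _ + X]big1 ?addr0 => [|z z0].
    transitivity (E (fun xi => G 0 * A p (Q xi) 0)).
      by rewrite meanZ mean_killed_correlation eqxx mulrC.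
    by apply: eq_mean => xi; rewrite mulrC.
  rewrite (eq_mean gam (G := fun xi => G z * A p (Q xi) z)) => [|xi]; last exact: mulrC.
  by rewrite meanZ mean_killed_correlation (negbTE z0) mulr0.
rewrite -[RHS](mean_cst vm); apply: eq_mean => xi.
rewrite (killedC wN) -(correlation0 xi) -(sum_delta0 (Q xi)).
by apply: eq_bigr => z _; rewrite GE mulrC.
Qed.

Definition pairing (a : V -> R) xi : R := \sum_z a z * Q xi z.

Definition variance_of (X : config V -> R) : R := E (fun xi => (X xi - E X) ^+ 2).

Lemma variance_shift X c : variance_of (fun xi => X xi + c) = variance_of X.
Proof.
rewrite /variance_of meanD (mean_cst vm); apply: eq_mean => xi; congr (_ ^+ 2); ring.
Qed.

Lemma generator_pairing a xi : a 0 = 0 ->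
  \sum_x rate xi x * (pairing a (flip xi x) - pairing a xi) =
  - 2 * \sum_z A p a z * Q xi z.
Proof.
move=> a0; rewrite (killedC wN) mulr_sumr.
under eq_bigr do rewrite /pairing -sumrB mulr_sumr.
rewrite exchange_big; apply: eq_bigr => z _ /=.
have [->|z0] := eqVneq z 0.
  by rewrite a0 big1 => [|x _]; rewrite ?mul0r ?subrr ?mulr0 ?mul0r ?subrr ?mulr0.
rewrite [RHS]mulrCA -(generator_correlation xi z0) [RHS]mulr_sumr.
by apply: eq_bigr => x _; ring.
Qed.

Lemma mean_pairing a : a 0 = 0 -> E (fun xi => \sum_z A p a z * Q xi z) = 0.
Proof.
move=> a0; have := mean_generator vm (pairing a).
rewrite (eq_mean gam (fun xi => generator_pairing xi a0)) meanZ => /eqP.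
by rewrite mulf_eq0 oppr_eq0 pnatr_eq0/= => /eqP.
Qed.

Lemma pairing_flip_le a xi x : (forall z, 0 <= a z) -> a 0 = 0 ->
  (pairing a (flip xi x) - pairing a xi) ^+ 2 <= 16 * (\sum_z a z) ^+ 2.
Proof.
move=> a_ge0 a0.
have -> : 16 * (\sum_z a z) ^+ 2 = (4 * \sum_z a z) ^+ 2 by ring.
rewrite -(real_normK (num_real (_ - _))) lerXn2r// ?nnegrE ?mulr_ge0 ?sumr_ge0//.
rewrite /pairing -sumrB mulr_sumr.
apply: (le_trans (ler_norm_sum _ _ _)); apply: ler_sum => z _.
have [->|z0] := eqVneq z 0; first by rewrite a0 !mul0r subrr normr0 mulr0.
rewrite -mulrBr correlation_flip// normrM (ger0_norm (a_ge0 z)) mulrC.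
apply: ler_wpM2r => //; rewrite addrAC subrr add0r normrN !spinE.
by case: (xi x) (xi (x + z)) (xi (x - z)) => -[] [] /=; rewrite ler_norml; apply/andP; split; lra.
Qed.

(* Second moments of [pairing a] are balanced by the generator applied to its
   square. *)
Lemma mean_pairing_mul a : (forall z, 0 <= a z) -> a 0 = 0 ->
  E (fun xi => pairing a xi * \sum_z A p a z * Q xi z) <= 2 * (\sum_z a z) ^+ 2 * E H.
Proof.
move=> a_ge0 a0; set q := \sum_z a z.
have := mean_generator vm (fun xi => pairing a xi ^+ 2).
set D := fun xi x => pairing a (flip xi x) - pairing a xi.
rewrite (eq_mean gam (G := fun xi => - 4 * (pairing a xi * \sum_z A p a z * Q xi z) +
    \sum_x rate xi x * D xi x ^+ 2)) => [|xi]; last first.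
  transitivity (2 * pairing a xi * (\sum_x rate xi x * D xi x) +
      \sum_x rate xi x * D xi x ^+ 2); last by rewrite generator_pairing//; ring.
  rewrite mulr_sumr -big_split; apply: eq_bigr => x _ /=; rewrite /D; ring.
rewrite meanD meanZ.
have h : E (fun xi => \sum_x rate xi x * D xi x ^+ 2) <= E (fun xi => 8 * q ^+ 2 * H xi).
  apply: (le_mean vm) => xi; rewrite /interface mulr_sumr; apply: ler_sum => x _.
  have := ler_wpM2l (flip_rate_ge0 vm xi x) (pairing_flip_le xi x a_ge0 a0).
  rewrite -/q -/(D xi x) mulr2n; lra.
rewrite meanZ in h; lra.
Qed.

(** Subtracting the centred variable Y replaces the coefficients [a] by (1 - p) T a, whose value at
    the origin only adds a constant. The variance drops by 2 E[X Y] - E[Y^2], and E[X Y] is at most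
    2 q^2 E[H] with q the mass of [a]. *)
Lemma variance_taboo_step a : (forall z, 0 <= a z) -> a 0 = 0 ->
  variance_of (pairing a) <=
  variance_of (pairing (fun x => (x != 0)%:R * ((1 - p) * T a x))) +
  4 * (\sum_z a z) ^+ 2 * E H.
Proof.
move=> a_ge0 a0; set b := fun x => _.
pose X := pairing a; pose Y xi := \sum_z A p a z * Q xi z.
have bE xi : pairing b xi = X xi - Y xi + (- ((1 - p) * T a 0) * n).
  rewrite /X /Y /pairing -sumrB -(correlation0 xi).
  transitivity (\sum_z ((a z * Q xi z - A p a z * Q xi z) -
      delta0 z * ((1 - p) * T a z * Q xi z))).
    apply: eq_bigr => z _; rewrite /b /killed /delta0.
    by case: (z == 0) => /=; ring.
  have /= d0 := sum_delta0 (fun z => (1 - p) * T a z * Q xi z).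
  by rewrite sumrB d0; ring.
have -> : variance_of (pairing b) = variance_of (fun xi => X xi - Y xi).
  rewrite -(variance_shift (fun xi => X xi - Y xi) (- ((1 - p) * T a 0) * n)).
  by rewrite /variance_of (eq_mean gam bE); apply: eq_mean => xi; rewrite bE.
have EY : E Y = 0 by exact: mean_pairing.
have EXY := mean_pairing_mul a_ge0 a0; rewrite -/X -/Y in EXY.
have -> : variance_of (fun xi => X xi - Y xi) =
    variance_of X - 2 * E (fun xi => X xi * Y xi) + E (fun xi => Y xi ^+ 2).
  rewrite /variance_of meanB EY subr0.
  rewrite (eq_mean gam (G := fun xi => (X xi - E X) ^+ 2 - 2 * (X xi * Y xi) +
    2 * E X * Y xi + Y xi ^+ 2)) => [|xi]; last by ring.
  by rewrite meanD [X in X + _]meanD [X in X + _ + _]meanB !meanZ EY; ring.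
have Y2 : 0 <= E (fun xi => Y xi ^+ 2) by apply: (mean_ge0 vm) => xi; exact: sqr_ge0.
have : E (fun xi => X xi * Y xi) <= 2 * (\sum_z a z) ^+ 2 * E H by exact: EXY.
lra.
Qed.

(** Start from the coefficients (1 - p) w of H, up to sign and constant, and move them K times; the
    remaining statistic is bounded by n times its mass. *)
Lemma variance_interface_le K : variance_of H <=
  4 * E H * \sum_(k < K) ((1 - p) ^+ k.+1 * survival w k) ^+ 2 +
  (n * (1 - p) ^+ K.+1) ^+ 2.
Proof.
pose a k x := (1 - p) ^+ k.+1 * taboo w k x.
have a_ge0 k x : 0 <= a k x by rewrite mulr_ge0 ?exprn_ge0// taboo_ge0.
have ta0 k : taboo w k 0 = 0 by case: k => [|k] //=; rewrite eqxx mul0r.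
have a0 k : a k 0 = 0 by rewrite /a ta0 mulr0.
have aq k : \sum_z a k z = (1 - p) ^+ k.+1 * survival w k by rewrite -mulr_sumr.
have aS k x : (x != 0)%:R * ((1 - p) * T (a k) x) = a k.+1 x.
  by rewrite /a transitionZ /= [(1 - p) ^+ k.+2]exprS; ring.
have HE xi : H xi = - 1 * pairing (a 0%N) xi + n.
  rewrite interface_correlation /killed correlation0 /pairing /transition mulr_sumr.
  rewrite mulN1r [RHS]addrC; congr (_ - _); apply: eq_bigr => z _.
  by rewrite /a expr1 /= /step subr0; ring.
have -> : variance_of H = variance_of (pairing (a 0%N)).
  transitivity (variance_of (fun xi => - 1 * pairing (a 0%N) xi)).
    rewrite -[RHS](variance_shift _ n) /variance_of (eq_mean gam HE).
    by apply: eq_mean => xi; rewrite HE.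
  by rewrite /variance_of meanZ; apply: eq_mean => xi; ring.
have main : variance_of (pairing (a 0%N)) <=
    4 * E H * \sum_(k < K) ((1 - p) ^+ k.+1 * survival w k) ^+ 2 + variance_of (pairing (a K)).
  elim: K => [|K IH]; first by rewrite big_ord0 mulr0 add0r.
  apply: (le_trans IH); rewrite big_ord_recr/= mulrDr -addrA lerD2l.
  apply: (le_trans (variance_taboo_step (a_ge0 K) (a0 K))).
  have -> : (fun x => (x != 0)%:R * ((1 - p) * T (a K) x)) = a K.+1.
    by apply/funext => x; rewrite aS.
  by rewrite aq; lra.
apply: (le_trans main); rewrite lerD2l.
apply: (@le_trans _ _ (E (fun xi => pairing (a K) xi ^+ 2))).
  have -> : variance_of (pairing (a K)) =
      E (fun xi => pairing (a K) xi ^+ 2) - E (pairing (a K)) ^+ 2.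
    rewrite /variance_of (eq_mean gam (G := fun xi => pairing (a K) xi ^+ 2 -
       (2 * E (pairing (a K)) * pairing (a K) xi - E (pairing (a K)) ^+ 2))) => [|xi]; last by ring.
    by rewrite !meanB meanZ (mean_cst vm); ring.
  by rewrite gerBl sqr_ge0.
rewrite -[leRHS](mean_cst vm); apply: (le_mean vm) => xi.
rewrite -(real_normK (num_real (pairing _ _))) lerXn2r// ?nnegrE ?mulr_ge0 ?exprn_ge0//.
apply: (le_trans (ler_norm_sum _ _ _)).
apply: (@le_trans _ _ (\sum_z n * a K z)).
  apply: ler_sum => z _; rewrite normrM (ger0_norm (a_ge0 K z)) mulrC.
  by apply: ler_wpM2r => //; exact: correlation_le.
rewrite -mulr_sumr aq ler_wpM2l// ler_piMr ?exprn_ge0//.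
exact: survival_le1.
Qed.

Lemma interface_variance_green N (Gr : V -> R) : (0 < N)%N ->
  (forall x, A (2 * N%:R)^-1 Gr x = delta0 x) ->
  interface_variance P p gam <= 4 * N%:R * G 0 / n + 16 / (p * n * Gr 0).
Proof.
move=> N0 GrE; have p01 := voter_p01 vm; have /andP[_ p_le1] := p01.
have n0 := card_vertices_gt0 vm; have G0 := green0_gt0 w_ge0 w1 wN p01 GE.
have EH0 := mean_interface_gt0 vm; have EHG := mean_interface_green.
have N1 : 1 <= N%:R :> R by rewrite ler1n.
have N2 : 0 < 2 * N%:R :> R by lra.
have r01 : 0 < (2 * N%:R : R)^-1 <= 1 by rewrite invr_gt0 N2 invf_le1//; lra.
have Gr0 := green0_gt0 w_ge0 w1 wN r01 GrE.
have sN := survival_green_le w_ge0 w1 wN w0 N0 GrE.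
have s0 k := survival_ge0 w_ge0 k; have s1 k := survival_le1 w_ge0 w1 wN k.
have t01 k : 0 <= (1 - p) ^+ k.+1 <= 1.
  by rewrite exprn_ge0//= exprn_ile1// gerBl ltW.
have S K : \sum_(k < K) ((1 - p) ^+ k.+1 * survival w k) ^+ 2 <=
    N%:R + 4 / Gr 0 * (p * G 0)^-1.
  have h1 : \sum_(k < K) (1 - p) ^+ k.+1 * survival w k <= (p * G 0)^-1.
    have := sum_survival_le w_ge0 w1 wN w0 K p01 GE; set s := \sum_(_ < _) _.
    have pG : 0 < p * G 0 by rewrite mulr_gt0.
    rewrite -ler_pdivlMl// mulr1; lra.
  apply: (@le_trans _ _ (\sum_(k < K) ((k < N)%:R +
      4 / Gr 0 * ((1 - p) ^+ k.+1 * survival w k)))).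
    apply: ler_sum => k _; have /andP[ta tb] := t01 k.
    set q := (1 - p) ^+ k.+1 * survival w k.
    have q0 : 0 <= q by rewrite mulr_ge0.
    have q1 : q <= 1 by rewrite mulr_ile1.
    have [kN|Nk] := ltnP k N.
      have : 0 <= 4 / Gr 0 * q by rewrite !mulr_ge0// invr_ge0 ltW.
      by have := mulr_ile1 q0 q0 q1 q1; rewrite expr2 /=; lra.
    (* For k >= N one factor of the square is at most the survival at N, hence at most 4 / Gr(0);
       the other is summed by [sum_survival_le]. *)
    rewrite add0r expr2 ler_wpM2r//; apply: le_trans sN.
    apply: (@le_trans _ _ (survival w k)); first by rewrite ler_piMl.
    exact: (survival_le w_ge0 w1 wN).
  rewrite big_split/= -mulr_sumr lerD// ?ler_wpM2l ?divr_ge0 ?(ltW Gr0)//.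
  rewrite -natr_sum ler_nat.
  have [NK|KN] := leqP N K.
    rewrite (eq_bigr (fun k : 'I_K => if (k < N)%N then 1%N else 0%N)) => [|k _]; last by case: ltnP.
    by rewrite -big_mkcond/= -(big_ord_widen K (fun=> 1%N) NK) sum1_card card_ord.
  apply: leq_trans (ltnW KN); rewrite -[leqRHS](card_ord K) -sum1_card.
  by apply: leq_sum => k _; exact: leq_b1.
set B := N%:R + _ in S.
have VB : variance_of H <= 4 * E H * B.
  (* The bound [B] is uniform in K, and the remainder vanishes in the limit because 0 <= 1 - p <
     1. *)
  have cv : 4 * E H * B + (n * (1 - p) ^+ K.+1) ^+ 2 @[K --> \oo] --> 4 * E H * B.
    have c1 : (n * (1 - p) ^+ K.+1) ^+ 2 @[K --> \oo] --> (0 : R).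
      have c2 : (1 - p) ^+ K.+1 @[K --> \oo] --> (0 : R).
        rewrite (cvg_shiftS (fun K => (1 - p) ^+ K)).
        by apply: cvg_expr; rewrite ger0_norm//; have := p0; lra.
      have c3 : n * (1 - p) ^+ K.+1 @[K --> \oo] --> (0 : R).
        by rewrite -[X in _ --> X](mulr0 n); apply: cvgM => //; exact: cvg_cst.
      rewrite -[X in _ --> X](mulr0 (0 : R)); under eq_fun do rewrite expr2.
      exact: (cvgM c3 c3).
    rewrite -[X in _ --> X]addr0; apply: cvgD => //; exact: cvg_cst.
  apply: (cvgr_to_ge cv); apply: nearW => K.
  apply: (le_trans (variance_interface_le K)); rewrite lerD2r.
  by rewrite ler_wpM2l// mulr_ge0// ltW.
have -> : interface_variance P p gam = (E H) ^- 2 * variance_of H.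
  rewrite /variance_of -meanZ; apply: eq_mean => xi; rewrite /interface_dev.
  by field; rewrite gt_eqF.
apply: (@le_trans _ _ ((E H) ^- 2 * (4 * E H * B))).
  by rewrite ler_wpM2l// invr_ge0 sqr_ge0.
have -> : E H = n / G 0 by rewrite -EHG mulfK// gt_eqF.
rewrite le_eqVlt; apply/orP; left; apply/eqP; rewrite /B; field.
by rewrite !gt_eqF.
Qed.

End Correlations.

(** * The torus *)

(* Joins the Z-module and the finite type structures of a product. *)
HB.instance Definition _ (A B : finZmodType) := Finite.on (A * B)%type.

Section TorusWalk.
Context {R : realType} (k : nat).
Notation m := k.+3.
Notation Z := 'Z_m.
Notation V := ('Z_m * 'Z_m)%type.
Implicit Types (f g : V -> R) (x y u v : V).

Definition east : V := (1, 0).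
Definition north : V := (0, 1).
Definition dirs : seq V := [:: east; - east; north; - north].

Definition torus_step x : R := (x \in dirs)%:R / 4.

Notation w := torus_step.

Lemma Zm_one_neqN1 : (1 : Z) != - 1.
Proof.
rewrite -subr_eq0 opprK; apply/eqP => /(congr1 val) /=.
by rewrite !modn_small.
Qed.

Lemma dirs_uniq : uniq dirs.
Proof.
have e1 : (1 : Z) == 0 = false by [].
have e2 : (-1 : Z) == 0 = false by rewrite oppr_eq0.
have e3 : (0 : Z) == 1 = false by [].
have e4 : (0 : Z) == -1 = false by rewrite eq_sym oppr_eq0.
have n (a b : Z) : (- (a, b) : V) = (- a, - b) by [].
rewrite /= !inE /east /north !n !oppr0 !xpair_eqE e1 e2 e3 e4 /= ?andbF ?orbF.
by rewrite (negbTE Zm_one_neqN1).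
Qed.

Lemma torus_graphE u v : torus_graph (m := m) u v = (v - u \in dirs).
Proof.
case: u v => [u1 u2] [v1 v2]; rewrite /torus_graph /= !inE.
have e (a b c d : Z) : ((a, b) - (c, d) : V) = (a - c, b - d) by [].
have n (a b : Z) : (- (a, b) : V) = (- a, - b) by [].
rewrite /east /north e !n !xpair_eqE !oppr0 !subr_eq0 !subr_eq.
rewrite ![_ + u1]addrC ![_ + u2]addrC (eq_sym v1 u1) (eq_sym v2 u2).
by move: (u1 == v1) (u2 == v2) (v2 == _ + _) (v2 == _ - _) (v1 == _ + _) (v1 == _ - _) => [] [] [] [] [] [].
Qed.

Lemma card_dirs : #|dirs| = 4%N.
Proof. exact: (card_uniqP dirs_uniq). Qed.

Lemma torus_walkE u v : simple_random_walk (@torus_graph m) u v = step w u v :> R.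
Proof.
rewrite /simple_random_walk /step /torus_step torus_graphE; congr (_ / _%:R).
rewrite -[RHS]card_dirs -[RHS](card_imset _ (addrI u)).
apply: eq_card => z; rewrite [LHS]torus_graphE.
apply/idP/imsetP => [zu|[d dd ->]]; last by rewrite addrAC subrr add0r.
by exists (z - u) => //; rewrite addrC subrK.
Qed.

Lemma torus_step_ge0 x : 0 <= w x :> R.
Proof. by rewrite divr_ge0. Qed.

Lemma torus_step0 : w 0 = 0 :> R.
Proof.
have -> : w 0 = (0 \in dirs)%:R / 4 :> R by [].
rewrite !inE 2!(eq_sym 0 (- _)) !oppr_eq0.
have -> : (0 == east) = false by [].
have -> : (0 == north) = false by [].
by rewrite (eq_sym east) (eq_sym north) mul0r.
Qed.

Lemma torus_stepN x : w (- x) = w x :> R.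
Proof.
rewrite /w; congr (_%:R / _); congr nat_of_bool.
rewrite !inE !eqr_oppLR !opprK.
by move: (x == east) (x == - east) (x == north) (x == - north) => [] [] [] [].
Qed.

Lemma sum_torus_step f : \sum_x w x * f x =
  (f east + f (- east) + f north + f (- north)) / 4.
Proof.
transitivity (4^-1 * \sum_(d <- dirs) f d).
  rewrite [X in _ = _ * X]big_uniq ?dirs_uniq//= mulr_sumr [RHS]big_mkcond; apply: eq_bigr => x _.
  by rewrite /w; case: (x \in _) => /=; ring.
by rewrite !big_cons big_nil; field.
Qed.

Lemma torus_step1 : \sum_x w x = 1 :> R.
Proof.
under eq_bigr do rewrite -[w _]mulr1.
by rewrite sum_torus_step; field.
Qed.

(** Each undirected edge is counted once, through its lower endpoint. *)
Definition torus_energy f : R :=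
  \sum_x ((f (x + east) - f x) ^+ 2 + (f (x + north) - f x) ^+ 2).

Lemma torus_energyE f :
  \sum_x \sum_y step w x y * (f x - f y) ^+ 2 = torus_energy f / 2.
Proof.
have sh d : \sum_x (f x - f (x - d)) ^+ 2 = \sum_x (f (x + d) - f x) ^+ 2.
  rewrite (reindex_inj (addIr d)); apply: eq_bigr => x _.
  by rewrite addrK.
transitivity (\sum_x ((f (x + east) - f x) ^+ 2 + (f x - f (x - east)) ^+ 2 +
    (f (x + north) - f x) ^+ 2 + (f x - f (x - north)) ^+ 2) / 4).
  apply: eq_bigr => x _; rewrite (reindex_inj (addrI x)).
  transitivity (\sum_d w d * (f x - f (x + d)) ^+ 2).
    by apply: eq_bigr => d _; rewrite /step addrAC subrr add0r.
  by rewrite (sum_torus_step (fun d => (f x - f (x + d)) ^+ 2)); field.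
by rewrite -mulr_suml !big_split/= !sh /torus_energy big_split/=; field.
Qed.

Lemma torus_walk_ge0 u v : 0 <= simple_random_walk (@torus_graph m) u v :> R.
Proof. by rewrite torus_walkE torus_step_ge0. Qed.

Lemma torus_walk1 u : \sum_v simple_random_walk (@torus_graph m) u v = 1 :> R.
Proof.
under eq_bigr do rewrite torus_walkE.
exact: step1 torus_step1 u.
Qed.

Lemma torus_walkC u v :
  simple_random_walk (@torus_graph m) u v = simple_random_walk (@torus_graph m) v u :> R.
Proof. by rewrite !torus_walkE; apply: stepC; exact: torus_stepN. Qed.

Lemma torus_stationary (mu : torus_vertex m -> R) :
  is_stationary (simple_random_walk (@torus_graph m)) mu ->
  forall x, mu x = #|torus_vertex m|%:R^-1.
Proof.
move=> st; apply: (stationary_uniform (x0 := (0 : V)) st) => x.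
have adj (u d : V) : d \in dirs -> mu (u + d) = mu u.
  move=> dd; apply/esym.
  apply: (stationary_symmetric torus_walk_ge0 torus_walk1 torus_walkC st).
  by rewrite torus_walkE /step /w addrAC subrr add0r dd mulf_neq0// ?invr_eq0 pnatr_eq0.
have adjn (u d : V) j : d \in dirs -> mu (u + d *+ j) = mu u.
  move=> dd; elim: j => [|j IH]; first by rewrite mulr0n addr0.
  by rewrite mulrSr addrA adj.
have xE : x = 0 + east *+ x.1 + north *+ x.2.
  have e1 j : east *+ j = (j%:R, 0).
    by elim: j => // j IH; rewrite mulrS IH -natr1 addrC; congr (_, _); rewrite /= ?addr0.
  have e2 j : north *+ j = (0, j%:R).
    by elim: j => // j IH; rewrite mulrS IH -natr1 addrC; congr (_, _); rewrite /= ?addr0.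
  case: x => [a b]; rewrite add0r e1 e2 /= !natr_Zp.
  by congr (_, _); rewrite /= ?addr0 ?add0r.
rewrite xE adjn ?adjn//; by rewrite !inE eqxx ?orbT.
Qed.

Lemma torus_voter (p : R) (gam : config (torus_vertex m) -> R) : 0 < p <= 1 ->
  is_stationary (nvm (simple_random_walk (@torus_graph m)) p) gam ->
  symmetric_voter (step w) p gam.
Proof.
move=> p01 st; split => //.
- exact: step_ge0 torus_step_ge0.
- exact: step1 torus_step1.
- exact: stepC torus_stepN.
rewrite (_ : step w = simple_random_walk (@torus_graph m))//.
by apply/funext => u; apply/funext => v; rewrite torus_walkE.
Qed.

End TorusWalk.

Definition harm (R : realType) (N : nat) : R := \sum_(j < N) j.+1%:R^-1.

Lemma card_torus k : #|torus_vertex k.+3| = (k.+3 * k.+3)%N.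
Proof. by rewrite card_prod !card_ord. Qed.

(** * A unit flow from the origin of the torus *)

Section Flow.
Context {R : realType} (k : nat).
Notation m := k.+3.
Notation Z := 'Z_m.
Notation V := ('Z_m * 'Z_m)%type.
Variables (f : V -> R) (lam : R).
Hypothesis lam0 : 0 < lam.

Let d1 x := f x - f (x + east k).
Let d2 x := f x - f (x + north k).
Let F x := d1 x ^+ 2 + d2 x ^+ 2.

Let F_ge0 x : 0 <= F x. Proof. by rewrite addr_ge0 ?sqr_ge0. Qed.

Let energyE : torus_energy f = \sum_x F x.
Proof. by apply: eq_bigr => x _; rewrite /F /d1 /d2; ring. Qed.

Let sum_torus (g : V -> R) : \sum_x g x = \sum_a \sum_b g (a, b).
Proof. by rewrite pair_bigA; apply: eq_bigr => -[]. Qed.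

Let S (d : Z) : R := \sum_a F (a, d - a).

Let S_ge0 d : 0 <= S d. Proof. by apply: sumr_ge0 => a _. Qed.

Let sum_diag (g : V -> R) : \sum_d \sum_a g (a, d - a) = \sum_x g x.
Proof.
rewrite exchange_big sum_torus; apply: eq_bigr => a _ /=.
by rewrite (reindex_inj (addIr a)); apply: eq_bigr => b _; rewrite addrK.
Qed.

Let sum_natr (g : Z -> R) : \sum_(i < m) g i%:R = \sum_a g a.
Proof. by apply: eq_bigr => a _; rewrite natr_Zp. Qed.

Let sum_natr_le (g : Z -> R) j : (forall a, 0 <= g a) -> (j <= m)%N ->
  \sum_(i < j) g i%:R <= \sum_a g a.
Proof.
move=> g0 jm; rewrite -sum_natr (big_ord_widen m (fun i => g i%:R) jm) big_mkcond.
by apply: ler_sum => i _; case: ifP.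
Qed.

(** A linear form of Cauchy-Schwarz: [al] is the flow through an edge and [d] the gradient of [f]
    along it. *)
Let amgm (al be d : R) : 0 <= al <= be -> al * d <= lam * d ^+ 2 + be ^+ 2 / (4 * lam).
Proof.
move=> /andP[al0 ab].
have h : al ^+ 2 <= be ^+ 2 by rewrite lerXn2r// ?nnegrE// (le_trans al0).
have l4 : 0 <= (4 * lam)^-1 by rewrite invr_ge0 mulr_ge0// ltW.
have := ler_wpM2r l4 h; have : 0 <= lam * (d - al / (2 * lam)) ^+ 2.
  by rewrite mulr_ge0 ?sqr_ge0// ltW.
have -> : lam * (d - al / (2 * lam)) ^+ 2 = lam * d ^+ 2 - al * d + al ^+ 2 * (4 * lam)^-1.
  by field; rewrite gt_eqF.
lra.
Qed.

(* [U j] is the mean of [f] on the segment reached after [j] steps of Polya's urn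
   started from the origin, which visits it uniformly. *)
Let U (j : nat) : R := j.+1%:R^-1 * \sum_(a < j.+1) f (a%:R, (j - a)%:R).

Let pt_east (a b : nat) : ((a%:R, b%:R) : V) + east k = (a.+1%:R, b%:R).
Proof. by rewrite -natr1; congr (_, _); rewrite /= addr0. Qed.

Let pt_north (a b : nat) : ((a%:R, b%:R) : V) + north k = (a%:R, b.+1%:R).
Proof. by rewrite -[in RHS]natr1; congr (_, _); rewrite /= addr0. Qed.

(** A point of the segment has mass 1 / (j + 1), and from it the urn goes east with probability (a +
    1) / (j + 2) and north otherwise; the coefficients are the resulting edge flows. *)
Let US j : U j - U j.+1 = \sum_(a < j.+1)
  ((a.+1%:R / (j.+1%:R * j.+2%:R)) * d1 (a%:R, (j - a)%:R) +
   ((j - a).+1%:R / (j.+1%:R * j.+2%:R)) * d2 (a%:R, (j - a)%:R)).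
Proof.
have j1 : j.+1%:R != 0 :> R by rewrite pnatr_eq0.
have j2 : j.+2%:R != 0 :> R by rewrite pnatr_eq0.
have h : j.+1%:R * \sum_(a < j.+2) f (a%:R, (j.+1 - a)%:R) =
   \sum_(a < j.+1) a.+1%:R * f (a.+1%:R, (j - a)%:R) +
   \sum_(a < j.+1) (j - a).+1%:R * f (a%:R, (j - a).+1%:R).
  rewrite mulr_sumr.
  transitivity (\sum_(a < j.+2) (a%:R * f (a%:R, (j.+1 - a)%:R)) +
      \sum_(a < j.+2) ((j.+1 - a)%:R * f (a%:R, (j.+1 - a)%:R))).
    rewrite -big_split; apply: eq_bigr => a _ /=; rewrite -mulrDl -natrD subnKC//.
    by rewrite -ltnS.
  congr (_ + _).
    by rewrite big_ord_recl mul0r add0r; apply: eq_bigr => a _.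
  rewrite big_ord_recr /= subnn mul0r addr0; apply: eq_bigr => a _.
  by rewrite subSn// -ltnS.
apply: (mulfI (mulf_neq0 j1 j2)).
transitivity (j.+2%:R * (\sum_(a < j.+1) f (a%:R, (j - a)%:R)) -
   j.+1%:R * \sum_(a < j.+2) f (a%:R, (j.+1 - a)%:R)).
  rewrite /U; move: (\sum_(_ < _) _) (\sum_(_ < _) _) => s s'.
  move: (j.+1%:R : R) (j.+2%:R : R) j1 j2 => x y x0 y0.
  by field; rewrite x0 y0.
rewrite h !mulr_sumr -big_split -sumrB; apply: eq_bigr => a _ /=.
have aj : (a.+1 + (j - a).+1 = j.+2)%N by have := ltn_ord a; lia.
rewrite /d1 /d2 pt_east pt_north -aj natrD in j1 j2 *.
move: (f (_, _)) (f (_, _)) (f (_, _)) => x y z.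
by field; apply/andP; split.
Qed.

(** Each of the 2 (j + 1) edges carries at most 1 / (j + 1), so the cost is of order 1 / (j + 1) and
    sums to a harmonic number. *)
Let US_le j : (j < m)%N -> U j - U j.+1 <= lam * S j%:R + j.+1%:R^-1 / (2 * lam).
Proof.
move=> jm; rewrite US.
have j1 : 0 < j.+1%:R :> R by rewrite ltr0n.
have j2 : 0 < j.+2%:R :> R by rewrite ltr0n.
have coef (i : nat) : (i <= j.+1)%N ->
    0 <= (i%:R / (j.+1%:R * j.+2%:R) : R) <= j.+1%:R^-1.
  move=> ij; have ij' : i%:R <= j.+2%:R :> R by rewrite ler_nat ltnW.
  apply/andP; split; first by rewrite divr_ge0 ?mulr_ge0.
  by rewrite ler_pdivrMr ?mulr_gt0// mulKf// gt_eqF.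
apply: (@le_trans _ _ (\sum_(a < j.+1) (lam * F (a%:R, (j - a)%:R) +
    j.+1%:R^-1 ^+ 2 / (2 * lam)))).
  apply: ler_sum => a _; have ha := ltn_ord a.
  have h1 := amgm (d1 (a%:R, (j - a)%:R)) (coef a.+1 ha).
  have c2 : ((j - a).+1 <= j.+1)%N by lia.
  have h2 := amgm (d2 (a%:R, (j - a)%:R)) (coef _ c2).
  apply: (le_trans (lerD h1 h2)); rewrite /F le_eqVlt; apply/orP; left; apply/eqP.
  by field; rewrite !gt_eqF.
rewrite big_split/= -mulr_sumr sumr_const card_ord; apply: lerD.
  rewrite ler_wpM2l ?(ltW lam0)//.
  apply: (@le_trans _ _ (\sum_(a < j.+1) F (a%:R, j%:R - a%:R))).
    by apply: ler_sum => a _; rewrite natrB// -ltnS.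
  exact: (@sum_natr_le (fun a => F (a, j%:R - a))).
rewrite le_eqVlt; apply/orP; left; apply/eqP.
by rewrite -[LHS]mulr_natr; field; rewrite !gt_eqF.
Qed.

Let E := torus_energy f.

Let sumS : \sum_d S d = E.
Proof. by rewrite /S sum_diag /E energyE. Qed.

Let flow1 : f 0 - U k.+2 <= lam * E + harm R m / (2 * lam).
Proof.
have U0 : U 0 = f 0.
  by rewrite /U invr1 mul1r big_ord1.
have h j : (j <= m)%N -> f 0 - U j <=
    lam * (\sum_(i < j) S i%:R) + (\sum_(i < j) i.+1%:R^-1) / (2 * lam).
  elim: j => [|j IH] jm; first by rewrite !big_ord0 U0 subrr mulr0 mul0r addr0.
  rewrite !big_ord_recr/= mulrDr mulrDl.
  have -> : f 0 - U j.+1 = (f 0 - U j) + (U j - U j.+1) by ring.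
  by rewrite [leRHS]addrACA; exact: lerD (IH (ltnW jm)) (US_le jm).
apply: (le_trans (h k.+2 (leqnSn _))); apply: lerD.
  by rewrite ler_wpM2l ?(ltW lam0)// -sumS; apply: sum_natr_le.
rewrite ler_wpM2r ?invr_ge0 ?mulr_ge0 ?(ltW lam0)// /harm [leRHS]big_ord_recr/= lerDl.
by rewrite invr_ge0.
Qed.

Let W (d : Z) : R := m%:R^-1 * \sum_a f (a, d - a).

Let m0 : 0 < m%:R :> R. Proof. by rewrite ltr0n. Qed.

(** After m - 1 steps the segment has m points, and on the torus it is a whole antidiagonal. *)
Let UW : U k.+2 = W k.+2%:R.
Proof.
rewrite /U /W; congr (_ * _); rewrite -(sum_natr (fun a => f (a, k.+2%:R - a))).
by apply: eq_bigr => a _; rewrite natrB// -ltnS.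
Qed.

Let WS d : W d - W (d + 1) <= lam * S d + m%:R^-1 / (8 * lam).
Proof.
have -> : W d - W (d + 1) = \sum_a ((2 * m%:R)^-1 * d1 (a, d - a) + (2 * m%:R)^-1 * d2 (a, d - a)).
  have h1 : \sum_a f ((a, d - a) + east k) = \sum_a f (a, d + 1 - a).
    rewrite [RHS](reindex_inj (addIr (1 : Z))); apply: eq_bigr => a _.
    by congr f; congr (_, _); rewrite /= addr0 opprD addrACA subrr addr0.
  have h2 : \sum_a f ((a, d - a) + north k) = \sum_a f (a, d + 1 - a).
    apply: eq_bigr => a _.
    by congr f; congr (_, _); rewrite /= ?addr0// addrAC.
  transitivity ((2 * m%:R)^-1 * (2 * \sum_a f (a, d - a) -
     \sum_a f ((a, d - a) + east k) - \sum_a f ((a, d - a) + north k))).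
    rewrite h1 h2 /W; set s := \sum_a f (a, d - a); set s' := \sum_a f (a, d + 1 - a).
    move: (m%:R : R) m0 => x x0.
    by field; rewrite gt_eqF.
  rewrite [2 * \sum_a _]mulr_sumr -!sumrB mulr_sumr; apply: eq_bigr => a _.
  by rewrite /d1 /d2; ring.
apply: (@le_trans _ _ (\sum_(a : Z) (lam * F (a, d - a) + m%:R^-1 ^+ 2 / (8 * lam)))).
  apply: ler_sum => a _.
  have c : 0 <= ((2 * m%:R)^-1 : R) <= (2 * m%:R)^-1 by rewrite lexx invr_ge0 mulr_ge0.
  have h1 := amgm (d1 (a, d - a)) c; have h2 := amgm (d2 (a, d - a)) c.
  apply: (le_trans (lerD h1 h2)); rewrite /F le_eqVlt; apply/orP; left; apply/eqP.
  by field; rewrite !gt_eqF.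
rewrite big_split/= -mulr_sumr sumr_const [X in _ *+ X](card_ord m) lerD2l.
rewrite le_eqVlt; apply/orP; left; apply/eqP.
by rewrite -[LHS]mulr_natr; field; rewrite !gt_eqF.
Qed.

(** From a full antidiagonal the flow spreads evenly over 2 m edges. Passing to the next
    antidiagonal costs 1 / (8 m lam), and fewer than m passages reach any other. *)
Let flow2 d0 : W d0 - m%:R^-1 * \sum_d W d <= lam * E + (8 * lam)^-1.
Proof.
have h j : W d0 - W (d0 + j%:R) <= lam * (\sum_(i < j) S (d0 + i%:R)) + j%:R * (m%:R^-1 / (8 * lam)).
  elim: j => [|j IH]; first by rewrite big_ord0 mulr0 mul0r addr0 subrr addr0.
  have := WS (d0 + j%:R); rewrite -addrA natr1 => hj.
  rewrite big_ord_recr/= mulrDr -[X in X * (_ / _)]natr1 mulrDl mul1r [leRHS]addrACA.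
  have -> : W d0 - W (d0 + j.+1%:R) = (W d0 - W (d0 + j%:R)) + (W (d0 + j%:R) - W (d0 + j.+1%:R)).
    by ring.
  exact: lerD IH hj.
have hd d : W d0 - W d <= lam * E + (8 * lam)^-1.
  have := h (d - d0 : Z); rewrite natr_Zp [d0 + _]addrC subrK => /le_trans; apply; apply: lerD.
    rewrite ler_wpM2l ?(ltW lam0)// -sumS.
    apply: (@le_trans _ _ (\sum_a S (d0 + a))).
      by apply: (@sum_natr_le (fun a => S (d0 + a))) => //; exact/ltnW/ltn_ord.
    by rewrite [leRHS](reindex_inj (addrI d0)).
  rewrite mulrA ler_piMl ?invr_ge0 ?mulr_ge0 ?(ltW lam0)//.
  by rewrite ler_pdivrMr// mul1r ler_nat; exact/ltnW/ltn_ord.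
have -> : W d0 - m%:R^-1 * \sum_d W d = m%:R^-1 * \sum_d (W d0 - W d).
  by rewrite sumrB sumr_const [X in W d0 *+ X](card_ord m) -[_ *+ m]mulr_natr; field; rewrite gt_eqF.
rewrite ler_pdivrMl//.
apply: (@le_trans _ _ (\sum_(d : Z) (lam * E + (8 * lam)^-1))); first exact: ler_sum.
by rewrite sumr_const [X in _ *+ X](card_ord m) [leRHS]mulr_natl lexx.
Qed.

(** [lam] stays free: a fixed value gives the order of G(0), and a small one shows that G is nearly
    flat. *)
Lemma torus_flow : f 0 - (\sum_x f x) / #|torus_vertex m|%:R <=
  2 * lam * torus_energy f + (harm R m + 1) / (2 * lam).
Proof.
have -> : (\sum_x f x) / #|torus_vertex m|%:R = m%:R^-1 * \sum_d W d.
  rewrite /W -mulr_sumr sum_diag card_torus natrM.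
  by field; rewrite gt_eqF.
have f2 := flow2 k.+2%:R; rewrite -UW in f2.
have h := lerD flow1 f2; rewrite addrA subrK in h; apply: (le_trans h).
have l8 : (8 * lam)^-1 <= (2 * lam)^-1.
  by rewrite lef_pV2 ?posrE ?mulr_gt0// ler_pM2r//; lra.
rewrite -/E; have -> : (harm R m + 1) / (2 * lam) = harm R m / (2 * lam) + (2 * lam)^-1.
  by rewrite [LHS]mulrDl mul1r.
move: l8; move: (harm R m / _) => x.
by move: ((8 * lam)^-1) ((2 * lam)^-1) => y z; lra.
Qed.

End Flow.

(** * Harmonic numbers and logarithms *)

Section Harmonic.
Context {R : realType}.
Notation harm := (harm R).

Lemma harmS N : harm N.+1 = harm N + N.+1%:R^-1.
Proof. by rewrite /harm big_ord_recr. Qed.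

Lemma harm_le i j : (i <= j)%N -> harm i <= harm j.
Proof.
move=> ij; rewrite -(subnK ij); elim: (j - i)%N => // d IH.
by rewrite addSn harmS (le_trans IH)// lerDl invr_ge0.
Qed.

Lemma harm_ge1 N : (0 < N)%N -> 1 <= harm N.
Proof. by move=> N0; apply: le_trans (harm_le N0); rewrite harmS /harm big_ord0 add0r invr1. Qed.

Lemma harm_le_nat N : harm N <= N%:R.
Proof.
elim: N => [|N IH]; first by rewrite /harm big_ord0.
by rewrite harmS -[N.+1%:R in leRHS]natr1 lerD// invf_le1// ler1n.
Qed.

Lemma ln_le_harm N : ln (N.+1%:R : R) <= harm N.
Proof.
elim: N => [|N IH]; first by rewrite /harm big_ord0 ln1.
rewrite harmS; have n1 : 0 < N.+1%:R :> R by rewrite ltr0n.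
have -> : N.+2%:R = N.+1%:R * (1 + N.+1%:R^-1) :> R.
  by rewrite mulrDr mulr1 divff ?gt_eqF// -[N.+2%:R]natr1.
have i0 : 0 < 1 + N.+1%:R^-1 :> R by rewrite addr_gt0// invr_gt0.
rewrite lnM ?posrE// lerD//.
by apply: le_ln1Dx; rewrite (lt_trans (ltrN10 _))// invr_gt0.
Qed.

Lemma harm_le_ln N : (0 < N)%N -> harm N <= 1 + ln (N%:R : R).
Proof.
case: N => // N _; elim: N => [|N IH]; first by rewrite harmS /harm big_ord0 add0r ln1 invr1 addr0.
rewrite harmS; have n1 : 0 < N.+1%:R :> R by rewrite ltr0n.
have n2 : 0 < N.+2%:R :> R by rewrite ltr0n.
have h : ln (N.+1%:R : R) <= ln (N.+2%:R : R) - N.+2%:R^-1.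
  have -> : N.+1%:R = N.+2%:R * (1 + - N.+2%:R^-1) :> R.
    by rewrite mulrDr mulr1 mulrN divff ?gt_eqF// -[N.+2%:R]natr1 addrK.
  have i1 : N.+2%:R^-1 < 1 :> R by rewrite invf_lt1// ltr1n.
  rewrite lnM ?posrE ?subr_gt0// lerD2l.
  by apply: le_ln1Dx; rewrite ltrN2.
by apply: (le_trans (lerD IH (lexx _))); rewrite -addrA lerD2l -lerBrDr.
Qed.

End Harmonic.

(** * The truncated logarithm and the lower bound on the Green function *)

Section TestFunction.
Context {R : realType} (k : nat).
Notation m := k.+3.
Notation Z := 'Z_m.
Notation V := ('Z_m * 'Z_m)%type.

Definition absZ (a : Z) : nat := minn a (m - a).

Definition normZ (x : V) : nat := maxn (absZ x.1) (absZ x.2).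

Lemma val_Zp_succ (a : Z) : nat_of_ord (a + 1)%R = (a.+1 %% m)%N.
Proof. by rewrite /= addn1. Qed.

Lemma absZ_step (a : Z) : (absZ (a + 1)%R <= (absZ a).+1)%N /\ (absZ a <= (absZ (a + 1)%R).+1)%N.
Proof.
rewrite /absZ val_Zp_succ; have am := ltn_ord a; rewrite /= in am.
have [e|e] := eqVneq (a.+1) m; first by rewrite e modnn; lia.
have am2 : (a.+1 < m)%N by rewrite ltn_neqAle e.
rewrite modn_small//. move: (nat_of_ord a) am2 => b bm. lia.
Qed.

Lemma normZ_east x : (normZ (x + east k)%R <= (normZ x).+1)%N /\ (normZ x <= (normZ (x + east k)%R).+1)%N.
Proof.
rewrite /normZ [(x + _)%R.1]/= [(x + _)%R.2]/= addr0; have [] := absZ_step x.1.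
by move: (absZ (x.1 + 1)) (absZ x.1) (absZ x.2) => a b c; lia.
Qed.

Lemma normZ_north x : (normZ (x + north k)%R <= (normZ x).+1)%N /\ (normZ x <= (normZ (x + north k)%R).+1)%N.
Proof.
rewrite /normZ [(x + _)%R.1]/= [(x + _)%R.2]/= addr0; have [] := absZ_step x.2.
by move: (absZ (x.2 + 1)) (absZ x.1) (absZ x.2) => a b c; lia.
Qed.

(** Each distance to 0 on the cycle is attained at most twice. *)
Lemma sum_absZ (g : nat -> R) : (forall j, 0 <= g j) ->
  \sum_(a : Z) g (absZ a) <= 2 * \sum_(j < m) g j.
Proof.
move=> g0; rewrite big_ord_recl [X in 2 * X]big_ord_recl /=.
have -> : absZ (ord0 : Z) = 0%N by [].
have h : \sum_(i < k.+2) g (absZ (lift ord0 i : Z)) <=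
    \sum_(i < k.+2) g i.+1 + \sum_(i < k.+2) g (k.+2 - i)%N.
  rewrite -big_split; apply: ler_sum => i _ /=.
  rewrite /absZ /= /bump /= add1n; have ik := ltn_ord i.
  have -> : (m - i.+1 = k.+2 - i)%N by lia.
  by rewrite /minn; case: ifP => _; rewrite ?lerDl ?lerDr.
have e : \sum_(i < k.+2) g (k.+2 - i)%N = \sum_(i < k.+2) g i.+1.
  rewrite [LHS](reindex_inj rev_ord_inj); apply: eq_bigr => i _ /=.
  by congr g; have := ltn_ord i; lia.
rewrite e in h.
have -> : \sum_(i < k.+2) g (bump 0 i) = \sum_(i < k.+2) g i.+1 by apply: eq_bigr.
have := g0 0%N; lra.
Qed.

Lemma sum_indicator_le (g : nat -> R) M K : (forall j, 0 <= g j) ->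
  \sum_(j < M) (j < K)%:R * g j <= \sum_(j < K) g j.
Proof.
move=> g0; pose F j := (j < K)%:R * g j.
have F0 j : 0 <= F j by rewrite mulr_ge0.
apply: (@le_trans _ _ (\sum_(j < M + K) F j)).
  by rewrite [leRHS]big_split_ord/= lerDl sumr_ge0.
rewrite addnC big_split_ord/= [X in _ + X]big1 ?addr0 => [|j _]; last first.
  by rewrite /F ltnNge leq_addr mul0r.
by apply: ler_sum => j _; rewrite /F /= ltn_ord mul1r.
Qed.

Lemma card_absZ j : \sum_(a : Z) ((absZ a <= j)%N%:R : R) <= 2 * j.+1%:R.
Proof.
apply: (le_trans (sum_absZ (fun i => ler0n R (i <= j)%N))).
rewrite ler_pM2l//; have := @sum_indicator_le (fun=> 1) m j.+1 (fun=> ler01).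
rewrite sumr_const card_ord; under eq_bigr do rewrite mulr1; exact.
Qed.

Variable N : nat.
Hypothesis N0 : (0 < N)%N.
Notation hN := (harm R N).

Let hN1 : 1 <= hN. Proof. exact: harm_ge1. Qed.
Let hN0 : 0 < hN. Proof. by have := hN1; lra. Qed.

(** Harmonic numbers play the part of the logarithm, so that increments are exactly 1 / (j + 1) up
    to the normalisation; the profile falls from 1 at 0 to 0 at N. *)
Definition log_profile (j : nat) : R := Num.max 0 (1 - harm R j / hN).

Definition log_test (x : V) : R := log_profile (normZ x).

Let decay (j : nat) : R := (j < N.+1)%:R / j.+1%:R ^+ 2.

Let decay_ge0 j : 0 <= decay j.
Proof. by rewrite divr_ge0// sqr_ge0. Qed.

Lemma log_profile0 j : (N <= j)%N -> log_profile j = 0.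
Proof.
move=> Nj; apply/max_idPl; rewrite subr_le0 ler_pdivlMr// mul1r; exact: harm_le.
Qed.

Let log_profileS i : `|log_profile i.+1 - log_profile i| <= i.+1%:R^-1 / hN.
Proof.
have i0 : 0 <= i.+1%:R^-1 / hN by rewrite divr_ge0 ?invr_ge0// ltW.
rewrite /log_profile harmS mulrDl opprD addrA.
move: (1 - harm R i / hN) (i.+1%:R^-1 / hN) i0 => a b b0.
by rewrite ler_norml !maxEle; do ! case: ifP; move=> *; apply/andP; split; lra.
Qed.

Let log_profile_sqr i j : (i <= j.+1)%N -> (j <= i.+1)%N ->
  (log_profile i - log_profile j) ^+ 2 <= 4 / hN ^+ 2 * decay j.
Proof.
move=> ij ji.
have [jN|Nj] := ltnP j N.+1; last first.
  have iN : (N <= i)%N by rewrite -ltnS (leq_trans Nj).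
  rewrite (log_profile0 iN) (log_profile0 (ltnW Nj)) subrr expr0n /=.
  by rewrite mulr_ge0// divr_ge0 ?sqr_ge0.
(* The factor 2 absorbs 1/j <= 2 / (j + 1), needed when [j] is the larger index. *)
have -> : 4 / hN ^+ 2 * decay j = (2 / j.+1%:R / hN) ^+ 2.
  have j0 : j.+1%:R != 0 :> R by rewrite pnatr_eq0.
  rewrite /decay jN /=; move: (j.+1%:R : R) j0 => y y0.
  by field; rewrite gt_eqF.
have b0 : 0 <= 2 / j.+1%:R / hN by rewrite !divr_ge0// ltW.
rewrite -(real_normK (num_real (_ - _))) lerXn2r// ?nnegrE//.
have [->|neq] := eqVneq i j; first by rewrite subrr normr0.
have [e|e] : i = j.+1 \/ j = i.+1 by lia.
  rewrite e (le_trans (log_profileS j))// ler_wpM2r ?invr_ge0 ?(ltW hN0)//.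
  by rewrite ler_peMl ?invr_ge0 ?ler1n.
rewrite distrC e (le_trans (log_profileS i))// ler_wpM2r ?invr_ge0 ?(ltW hN0)//.
rewrite ler_pdivlMr ?ltr0n// ler_pdivrMl ?ltr0n//.
by rewrite mulrC -natrM ler_nat; lia.
Qed.

Let sum_torus (g : V -> R) : \sum_x g x = \sum_a \sum_b g (a, b).
Proof. by rewrite pair_bigA; apply: eq_bigr => -[]. Qed.

(** Spheres of radius j have O(j + 1) points, which turns the decay 1 / (j + 1)^2 into a harmonic
    sum. Points are charged to the coordinate that realises the norm, whence two copies of the same
    sum. *)
Let sum_decay : \sum_(x : V) decay (normZ x) <= 8 * harm R N.+1.
Proof.
pose D (a b : Z) := decay (absZ a) * (absZ b <= absZ a)%N%:R.
have D0 a b : 0 <= D a b by rewrite mulr_ge0.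
have h1 : \sum_(x : V) decay (normZ x) <= \sum_a \sum_b D a b + \sum_a \sum_b D a b.
  rewrite [X in _ + X]exchange_big -big_split sum_torus; apply: ler_sum => a _ /=.
  rewrite -big_split; apply: ler_sum => b _; rewrite /normZ [(a, b).1]/= [(a, b).2]/=.
  have [ab|ba] := leqP (absZ a) (absZ b).
    by rewrite {2}/D ab mulr1 lerDr.
  by rewrite {1}/D (ltnW ba) mulr1 lerDl.
have h2 : \sum_a \sum_b D a b <= 2 * \sum_a ((absZ a < N.+1)%N%:R * (absZ a).+1%:R^-1).
  rewrite mulr_sumr; apply: ler_sum => a _; rewrite /D -mulr_sumr.
  apply: (le_trans (ler_wpM2l (decay_ge0 _) (card_absZ (absZ a)))).
  rewrite le_eqVlt; apply/orP; left; apply/eqP; rewrite /decay; field.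
  by rewrite addrC natr1 pnatr_eq0.
have i0 (j : nat) : 0 <= j.+1%:R^-1 :> R by rewrite invr_ge0.
have h3 := @sum_absZ (fun j => (j < N.+1)%N%:R * j.+1%:R^-1)
  (fun j => mulr_ge0 (ler0n R _) (i0 j)).
have h4 := @sum_indicator_le (fun j => j.+1%:R^-1) m N.+1 i0.
rewrite -/(harm R N.+1) in h4.
have h5 := le_trans h2 (ler_wpM2l (ler0n R 2) (le_trans h3 (ler_wpM2l (ler0n R 2) h4))).
by apply: (le_trans h1); apply: le_trans (lerD h5 h5) _; lra.
Qed.

Lemma log_test_energy : torus_energy log_test <= 128 / hN.
Proof.
apply: (@le_trans _ _ (\sum_(x : V) (8 / hN ^+ 2 * decay (normZ x)))).
  apply: ler_sum => x _.
  have [e1 e2] := normZ_east x; have [n1 n2] := normZ_north x.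
  have h1 := log_profile_sqr e1 e2; have h2 := log_profile_sqr n1 n2.
  have -> : 8 / hN ^+ 2 * decay (normZ x) =
      4 / hN ^+ 2 * decay (normZ x) + 4 / hN ^+ 2 * decay (normZ x) by ring.
  exact: lerD.
rewrite -mulr_sumr.
apply: (@le_trans _ _ (8 / hN ^+ 2 * (8 * harm R N.+1))).
  by rewrite ler_wpM2l// divr_ge0// sqr_ge0.
have hS : harm R N.+1 <= 2 * hN.
  rewrite harmS mulr2n mulrDl mul1r lerD2l (le_trans _ hN1)//.
  by rewrite invf_le1// ler1n.
apply: (@le_trans _ _ (8 / hN ^+ 2 * (8 * (2 * hN)))).
  by rewrite ler_wpM2l ?divr_ge0 ?sqr_ge0// ler_pM2l.
rewrite le_eqVlt; apply/orP; left; apply/eqP; field; by rewrite gt_eqF.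
Qed.

Lemma log_test_sqr : \sum_x log_test x ^+ 2 <= (2 * N.+1%:R) ^+ 2.
Proof.
pose c (a : Z) : R := (absZ a <= N)%N%:R.
apply: (@le_trans _ _ (\sum_(x : V) c x.1 * c x.2)).
  apply: ler_sum => x _; rewrite /log_test.
  have [xN|Nx] := leqP (normZ x) N; last first.
    by rewrite log_profile0 ?(ltnW Nx)// expr0n mulr_ge0.
  have : (absZ x.1 <= N)%N && (absZ x.2 <= N)%N by rewrite -geq_max.
  rewrite /c => /andP[-> ->]; rewrite mulr1 exprn_ile1//.
    by rewrite /log_profile le_max lexx.
  rewrite /log_profile ge_max ler01 gerBl divr_ge0 ?(ltW hN0)//.
  by apply: le_trans (harm_le (leq0n _)); rewrite /harm big_ord0.
rewrite sum_torus /=; have := card_absZ N; rewrite -/c => h.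
under eq_bigr do rewrite -mulr_sumr.
rewrite -mulr_suml expr2; apply: ler_pM => //; exact: sumr_ge0.
Qed.

Lemma torus_green_lower (r : R) (G : V -> R) : 0 < r <= 1 ->
  (forall x, killed (torus_step (k := k)) r G x = delta0 x) ->
  (G 0)^-1 <= 4 * r * N.+1%:R ^+ 2 + 32 / hN.
Proof.
move=> r01 GE; have /andP[r0 r1] := r01.
have f0 : log_test 0 = 1.
  rewrite /log_test /log_profile /normZ /absZ /= !min0n maxnn /harm big_ord0 mul0r subr0.
  by apply/max_idPr.
have := green_dirichlet (@torus_step_ge0 R k) (@torus_step1 R k) (@torus_stepN R k) r01 GE f0.
rewrite killed_energy; [|exact: torus_step1|exact: torus_stepN].
rewrite torus_energyE => /le_trans; apply; apply: lerD.
  have -> : 4 * r * N.+1%:R ^+ 2 = r * (2 * N.+1%:R) ^+ 2 by ring.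
  by rewrite ler_wpM2l ?(ltW r0)// log_test_sqr.
have E0 : 0 <= torus_energy log_test.
  by apply: sumr_ge0 => x _; rewrite addr_ge0 ?sqr_ge0.
have := log_test_energy; have := mulr_ge0 (ltW r0) E0.
have -> : 128 / hN = 4 * (32 / hN) by ring.
lra.
Qed.

End TestFunction.

(** * Quantitative bounds on the torus *)

Section TorusBounds.
Context {R : realType} (k : nat).
Notation m := k.+3.
Notation V := ('Z_m * 'Z_m)%type.
Notation w := (@torus_step R k).
Notation n := (#|torus_vertex m|%:R : R).

Let n0 : 0 < n.
Proof. by rewrite card_torus ltr0n. Qed.

Let nE : n = m%:R ^+ 2.
Proof. by rewrite card_torus natrM expr2. Qed.

Let m0 : 0 < m%:R :> R. Proof. by rewrite ltr0n. Qed.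

(** The flow bound is applied to G itself, whose mean is 1 / (r n) and whose energy is at most 8
    G(0); the latter needs 1 - r >= 1/2. *)
Lemma torus_green_upper (r lam : R) (G : V -> R) : 0 < r <= 2^-1 -> 0 < lam ->
  (forall x, killed w r G x = delta0 x) ->
  G 0 - (r * n)^-1 <= 16 * lam * G 0 + (harm R m + 1) / (2 * lam).
Proof.
move=> /andP[r0 r2] lam0 GE; have r01 : 0 < r <= 1 by rewrite r0/=; lra.
have E8 : torus_energy G <= 8 * G 0.
  have := green_energy GE.
  rewrite (killed_energy (@torus_step1 R k) (@torus_stepN R k)) torus_energyE.
  have E0 : 0 <= torus_energy G by apply: sumr_ge0 => x _; rewrite addr_ge0 ?sqr_ge0.
  have S0 : 0 <= r * \sum_x G x ^+ 2.
    by rewrite mulr_ge0 ?(ltW r0)// sumr_ge0// => x _; exact: sqr_ge0.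
  have : (2^-1 - r) * torus_energy G >= 0 by rewrite mulr_ge0// subr_ge0.
  by move: (r * \sum_x _) S0 => S S0; lra.
have := torus_flow G lam0.
rewrite (sum_green (@torus_step1 R k) (@torus_stepN R k) r01 GE) -invfM.
move=> /le_trans; apply; rewrite lerD2r.
have -> : 16 * lam * G 0 = 2 * lam * (8 * G 0) by ring.
by rewrite ler_pM2l// mulr_gt0.
Qed.

Let ln_m : 2 / 3 <= ln (m%:R : R).
Proof.
apply: (@le_trans _ _ (ln (3 : R))); last by rewrite ler_ln ?posrE// ler_nat.
have h : ln (1 + - (2 / 3) : R) <= - (2 / 3) by apply: le_ln1Dx; lra.
have e : 1 + - (2 / 3) = 3^-1 :> R by field.
by move: h; rewrite e lnV ?posrE// lerN2.
Qed.

Lemma green0_le (r : R) (G : V -> R) : 0 < r <= 1 ->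
  (forall x, killed w r G x = delta0 x) ->
  G 0 <= 2 / (r * n) + 32 * (harm R m + 1).
Proof.
move=> r01 GE; have /andP[r0 r1] := r01.
have h1 : 1 <= harm R m by exact: harm_ge1.
have rn0 : 0 < (r * n)^-1 by rewrite invr_gt0 mulr_gt0.
have [r2|r2] := lerP r 2^-1.
  have r02 : 0 < r <= 2^-1 by rewrite r0.
  (* With lam = 1/32 half of G(0) is absorbed on the left. *)
  have l0 : 0 < 32^-1 :> R by [].
  have := torus_green_upper r02 l0 GE.
  have -> : (harm R m + 1) / (2 * 32^-1) = 16 * (harm R m + 1) by field.
  by move: ((r * n)^-1) rn0 => a a0; lra.
have : G 0 <= r^-1.
  rewrite -(sum_green (@torus_step1 R k) (@torus_stepN R k) r01 GE) (bigD1 0)//= lerDl.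
  by apply: sumr_ge0 => x _; exact: (green_ge0 (@torus_step_ge0 R k) (@torus_step1 R k) r01 GE).
have : r^-1 <= 2 by rewrite -[2]invrK lef_pV2 ?posrE// ltW.
by move: ((r * n)^-1) rn0 => a a0; lra.
Qed.

Variables (p : R) (gam : config (torus_vertex m) -> R).
Hypothesis p01 : 0 < p <= 1.
Hypothesis vm : symmetric_voter (step w) p gam.

Let p0 : 0 < p. Proof. by case/andP: p01. Qed.

Lemma cube_root : exists2 N, (0 < N)%N & (N ^ 3 <= m < N.+1 ^ 3)%N.
Proof.
have ex : exists N, (N ^ 3 <= m)%N by exists 0%N.
have bd N : (N ^ 3 <= m)%N -> (N <= m)%N.
  by move=> h; apply: leq_trans h; case: N => // N; rewrite -{1}(expn1 N.+1) leq_pexp2l.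
case: (ex_maxnP ex bd) => N h1 h2; exists N; first by apply: (h2 1%N).
by rewrite h1 ltnNge; apply/negP => /h2; rewrite ltnn.
Qed.

Let lnn : R := ln n.

Let lnnE : lnn = 2 * ln m%:R.
Proof. by rewrite /lnn nE lnXn// mulr_natl. Qed.

(** Test functions of radius about m^(1/3) and a time scale about m: the logarithms are comparable
    to log n, the killing term 2/N is negligible, and the time scale stays far below n / log n. The
    constant is 204 = 6 (2 + 32). *)
Lemma torus_green_cube_root : exists N (Gr : V -> R),
  [/\ (0 < N)%N, (N <= 4 * m)%N,
      forall x, killed w (2 * N%:R)^-1 Gr x = delta0 x
    & (Gr 0)^-1 <= 204 / lnn].
Proof.
have [N N0 /andP[h1 h2]] := cube_root.
pose M := (N.+1 ^ 2 * N)%N.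
have M0 : (0 < M)%N by rewrite muln_gt0 expn_gt0.
have M0' : 0 < M%:R :> R by rewrite ltr0n.
have Mr : 0 < ((2 * M%:R)^-1 : R) <= 1.
  rewrite invr_gt0 mulr_gt0// invf_le1 ?mulr_gt0//= -natrM ler1n; lia.
have [Gr GrE] := green_exists (@torus_step_ge0 R k) (@torus_step1 R k) Mr.
exists M, Gr; split => //.
  by apply: (@leq_trans (4 * N ^ 3)); rewrite ?leq_mul2l//= /M !expnS; nia.
apply: (le_trans (torus_green_lower N0 Mr GrE)).
have hN : 1 <= harm R N by exact: harm_ge1.
have hNN : harm R N <= N%:R by exact: harm_le_nat.
have hl : lnn <= 6 * harm R N.
  rewrite lnnE; have : ln (m%:R : R) <= 3 * harm R N.
    apply: (@le_trans _ _ (3 * ln (N.+1%:R : R))); last first.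
      by rewrite ler_pM2l// ln_le_harm.
    rewrite mulr_natl -lnXn ?ltr0n// ler_ln ?posrE ?exprn_gt0 ?ltr0n//.
    by rewrite -natrX ler_nat ltnW.
  by lra.
have lnn0 : 0 < lnn by rewrite lnnE; have := ln_m; lra.
have N0' : 0 < N%:R :> R by rewrite ltr0n.
have -> : 4 * (2 * M%:R)^-1 * N.+1%:R ^+ 2 = 2 / N%:R :> R.
  rewrite /M natrM natrX; have : N.+1%:R != 0 :> R by rewrite pnatr_eq0.
  by move: (N.+1%:R : R) => y y0; field; rewrite gt_eqF//.
have i1 : N%:R^-1 <= (harm R N)^-1 by rewrite lef_pV2 ?posrE//; lra.
apply: (@le_trans _ _ (34 / harm R N)); first by lra.
rewrite ler_pdivrMr ?(lt_le_trans ltr01)// mulrAC ler_pdivlMr//; lra.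
Qed.

(** The crude bound G(0) <= 136 sqrt m is enough for the first N steps, since N <= 4 m and n = m^2;
    3264 is 16 times 204. *)
Lemma torus_interface_variance : 1 <= p * n * lnn ->
  interface_variance (step w) p gam <=
    2176 / Num.sqrt m%:R + 3264 / (p * n * lnn).
Proof.
move=> big; have lnn0 : 0 < lnn by rewrite lnnE; have := ln_m; lra.
have [G GE] := green_exists (@torus_step_ge0 R k) (@torus_step1 R k) p01.
have [N [Gr [N0 N4 GrE Grl]]] := torus_green_cube_root.
apply: (le_trans (interface_variance_green (@torus_step_ge0 R k) (@torus_step1 R k)
  (@torus_stepN R k) (@torus_step0 R k) vm GE N0 GrE)).
have G0 := green0_gt0 (@torus_step_ge0 R k) (@torus_step1 R k) (@torus_stepN R k) p01 GE.
have pn0 : 0 < p * n by rewrite mulr_gt0.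
apply: lerD; last first.
  rewrite invfM mulrA.
  have -> : 3264 / (p * n * lnn) = 16 / (p * n) * (204 / lnn) by field; rewrite !gt_eqF.
  by rewrite ler_wpM2l// divr_ge0// ltW.
have s0 : 0 < Num.sqrt m%:R :> R by rewrite sqrtr_gt0.
have sE : Num.sqrt m%:R ^+ 2 = m%:R :> R by rewrite sqr_sqrtr// ltW.
have s1 : 1 <= Num.sqrt m%:R :> R by rewrite -[leLHS]sqrtr1; apply: ler_wsqrtr; rewrite ler1n.
have G1 : G 0 <= 64 + 36 * ln m%:R.
  apply: (le_trans (green0_le p01 GE)).
  have h := @harm_le_ln R m isT.
  have : (p * n)^-1 <= lnn by rewrite -[leLHS]mul1r ler_pdivrMr// mulrC.
  by rewrite lnnE; lra.
have ls : ln m%:R <= 2 * Num.sqrt m%:R :> R.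
  rewrite -[in leLHS]sE lnXn// mulr_natl lerMn2r//=.
  have h : -1 < Num.sqrt m%:R - 1 :> R by lra.
  by have := le_ln1Dx h; rewrite subrKC; lra.
have G2 : G 0 <= 136 * Num.sqrt m%:R by lra.
rewrite nE.
apply: (@le_trans _ _ (4 * (4 * m%:R) * (136 * Num.sqrt m%:R) / m%:R ^+ 2)).
  rewrite ler_pM2r ?invr_gt0 ?exprn_gt0//.
  apply: ler_pM => //; first exact: ltW.
  by rewrite ler_pM2l// -natrM ler_nat.
move: (Num.sqrt m%:R) s0 sE => s s0 <-.
by rewrite le_eqVlt; apply/orP; left; apply/eqP; field; rewrite gt_eqF.
Qed.

(** E[M^2] / n^2 is 1 / (p n G(0)), the ratio of the mean of G to its maximum; the claim is that G
    is nearly flat when killing is weak. *)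
Lemma torus_magnetization_lower : p * n * lnn <= 2^-1 ->
  1 - 17 * Num.sqrt (2 * (p * n * lnn)) <=
    mean gam (fun xi => magnetization xi ^+ 2) / n ^+ 2.
Proof.
move=> small; have lnn0 : 2 / 3 * 2 <= lnn by rewrite lnnE; have := ln_m; lra.
have [G GE] := green_exists (@torus_step_ge0 R k) (@torus_step1 R k) p01.
have G0 := green0_gt0 (@torus_step_ge0 R k) (@torus_step1 R k) (@torus_stepN R k) p01 GE.
have pn0 : 0 < p * n by rewrite mulr_gt0.
have n1 : 1 <= n by rewrite card_torus ler1n.
have p2 : 0 < p <= 2^-1.
  rewrite p0; apply: le_trans small.
  rewrite -mulrA ler_peMr ?(ltW p0)//.
  by rewrite -[1]mulr1 ler_pM//; lra.
have qle := mean_magnetization_sqr_le vm.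
have qE : mean gam (fun xi => magnetization xi ^+ 2) / n ^+ 2 = (p * n * G 0)^-1.
  have e1 := mean_magnetization_sqr vm; have e2 := mean_interface_green (@torus_stepN R k) vm GE.
  have -> : mean gam (fun xi => magnetization xi ^+ 2) = n / (G 0 * p).
    rewrite -e2 -e1; field; by rewrite !gt_eqF.
  by field; rewrite !gt_eqF.
rewrite qE in qle *.
(* Used as the flow parameter, [s] balances 16 s against p n (harm + 1) / (2 s), which is at most s
   / 2. *)
set s := Num.sqrt _.
have s0 : 0 < s by rewrite sqrtr_gt0 mulr_gt0// mulr_gt0//; lra.
have sE : s ^+ 2 = 2 * (p * n * lnn) by rewrite sqr_sqrtr// mulr_ge0// mulr_ge0 ?(ltW pn0)//; lra.
have := torus_green_upper p2 s0 GE.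
have hm : p * n * (harm R m + 1) <= s ^+ 2.
  rewrite sE mulrCA ler_pM2l//; have := @harm_le_ln R m isT; have := ln_m.
  by rewrite lnnE; lra.
have iG : (G 0)^-1 <= p * n.
  by move: qle; rewrite invfM ler_pdivrMl// mulr1.
rewrite -(ler_pM2l (_ : 0 < (G 0)^-1)) ?invr_gt0//.
have -> : (G 0)^-1 * (G 0 - (p * n)^-1) = 1 - (p * n * G 0)^-1.
  by field; rewrite !gt_eqF.
have -> : (G 0)^-1 * (16 * s * G 0 + (harm R m + 1) / (2 * s)) =
    16 * s + (G 0)^-1 * (harm R m + 1) / (2 * s) by field; rewrite !gt_eqF.
have h1 : 1 <= harm R m by exact: harm_ge1.
have : (G 0)^-1 * (harm R m + 1) / (2 * s) <= s.
  rewrite ler_pdivrMr ?mulr_gt0//.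
  apply: (@le_trans _ _ (s ^+ 2)).
    apply: le_trans hm; rewrite ler_wpM2r//; lra.
  by rewrite mulrCA -expr2 ler_peMl ?sqr_ge0//; lra.
lra.
Qed.

End TorusBounds.

(** * Limit theorems on the torus *)

Section Torus.
Context {R : realType}.
Variables (p : nat -> R) (pi : forall m : nat, torus_vertex m -> R)
  (Gamma : forall m : nat, probability (config (torus_vertex m)) R).
Notation P m := (simple_random_walk (@torus_graph m)).
Hypothesis p01 : forall m, (3 <= m)%N -> 0 < p (m ^ 2)%N <= 1.
Hypothesis piS : forall m, (3 <= m)%N -> is_stationary (P m) (@pi m).
Hypothesis GammaS : forall m, (3 <= m)%N ->
  is_stationary_nvm (P m) (p (m ^ 2)%N) (Gamma m).

Let walkE k : P k.+3 = step (@torus_step R k).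
Proof. by apply/funext => u; apply/funext => v; exact: torus_walkE. Qed.

Let vm_near : \forall m \near \oo,
  symmetric_voter (P m) (p (m ^ 2)%N) (weight (Gamma m)).
Proof.
exists 3%N => // -[|[|[|k]]] //= _; rewrite walkE.
by apply: torus_voter; [exact: p01|exact: GammaS].
Qed.

Let piE_near : \forall m \near \oo, forall x, @pi m x = #|torus_vertex m|%:R^-1.
Proof.
by exists 3%N => // -[|[|[|k]]] //= _; apply: torus_stationary; exact: piS.
Qed.

Lemma torus_cvg_normal :
  p (m ^ 2)%N * (m ^ 2)%:R * ln (m ^ 2)%:R @[m --> \oo] --> +oo ->
  cvg_in_distribution Gamma
    (fun m => voter_W (@pi m) (Gamma m) : {RV (Gamma m) >-> R}) std_normal_law.
Proof.
move=> poo; apply: (cvg_std_normal vm_near piE_near).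
  apply/cvgryPge => A; near=> m.
  have m3 : (3 <= m)%N by near: m; exists 3%N.
  apply: (@le_trans _ _ (m%:R : R)).
    by near: m; have /cvgryPge := @cvgr_idn R; exact.
  move: m3; case: (m) => [|[|[|k]]] // _.
  by rewrite card_torus ler_nat leq_pmulr.
have h1 : 2176 / Num.sqrt m%:R @[m --> \oo] --> (0 : R).
  rewrite -[X in _ --> X](mulr0 2176); apply: cvgM; first exact: cvg_cst.
  apply/gtr0_cvgV0.
    by exists 1%N => // m /= m1; rewrite sqrtr_gt0 ltr0n.
  apply/cvgryPge => A; near=> m.
  apply: (@le_trans _ _ (Num.sqrt (A ^+ 2))); first by rewrite sqrtr_sqr ler_norm.
  apply: ler_wsqrtr.
  by near: m; have /cvgryPge := @cvgr_idn R; exact.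
have h2 : 3264 / (p (m ^ 2)%N * (m ^ 2)%:R * ln (m ^ 2)%:R) @[m --> \oo] --> (0 : R).
  rewrite -[X in _ --> X](mulr0 3264); apply: cvgM; first exact: cvg_cst.
  apply/gtr0_cvgV0 => //.
  by near=> m; near: m; move/cvgryPgt : poo; exact.
have h : 2176 / Num.sqrt m%:R + 3264 / (p (m ^ 2)%N * (m ^ 2)%:R * ln (m ^ 2)%:R)
    @[m --> \oo] --> (0 : R).
  by rewrite -[X in _ --> X](addr0 0); apply: cvgD.
apply: squeeze_cvgr (cvg_cst 0) h; near=> m.
have m3 : (3 <= m)%N by near: m; exists 3%N.
have v : symmetric_voter (P m) (p (m ^ 2)%N) (weight (Gamma m)) by near: m.
have big : 1 <= p (m ^ 2)%N * (m ^ 2)%:R * ln (m ^ 2)%:R.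
  by near: m; move/cvgryPge : poo; exact.
rewrite (mean_ge0 v) => [|xi]; last exact: sqr_ge0.
move: m3 v big.
case: (m) => [|[|[|k]]] //= k3 v big.
have e : (k.+3 ^ 2)%:R = #|torus_vertex k.+3|%:R :> R by rewrite card_torus -mulnn.
rewrite walkE e in v big *; move: (p (k.+3 ^ 2)%N) (p01 k3) v big => q q01 v big.
exact: torus_interface_variance q01 v big.
Unshelve. all: by end_near. Qed.

Lemma torus_cvg_bernoulli :
  p (m ^ 2)%N * (m ^ 2)%:R * ln (m ^ 2)%:R @[m --> \oo] --> (0 : R) ->
  cvg_in_distribution Gamma
    (fun m => voter_S (@pi m) : {RV (Gamma m) >-> R}) (bernoulli_law 2^-1).
Proof.
move=> p0; apply: (cvg_bernoulli vm_near piE_near).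
have lo : 1 - 17 * Num.sqrt (2 * (p (m ^ 2)%N * (m ^ 2)%:R * ln (m ^ 2)%:R))
    @[m --> \oo] --> (1 : R).
  rewrite -[X in _ --> X]subr0 -[X in _ - X](mulr0 17) -(@sqrtr0 R).
  apply: cvgB; first exact: cvg_cst.
  apply: cvgM; first exact: cvg_cst.
  apply: continuous_cvg; first exact: sqrt_continuous.
  by rewrite -(mulr0 2); apply: cvgM => //; exact: cvg_cst.
apply: (squeeze_cvgr _ lo (cvg_cst (1 : R))); near=> m.
have m3 : (3 <= m)%N by near: m; exists 3%N.
have v : symmetric_voter (P m) (p (m ^ 2)%N) (weight (Gamma m)) by near: m.
have small : p (m ^ 2)%N * (m ^ 2)%:R * ln (m ^ 2)%:R <= 2^-1.
  by near: m; move/cvgr_le : p0; apply.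
rewrite (mean_magnetization_sqr_le v) andbT.
move: m3 v small.
case: (m) => [|[|[|k]]] //= k3 v small.
have e : (k.+3 ^ 2)%:R = #|torus_vertex k.+3|%:R :> R by rewrite card_torus -mulnn.
rewrite walkE e in v small *; move: (p (k.+3 ^ 2)%N) (p01 k3) v small => q q01 v small.
exact: torus_magnetization_lower q01 v small.
Unshelve. all: by end_near. Qed.

End Torus.

Theorem proposition9 (R : realType) :
  (forall (p : nat -> R)
     (pi : forall n : nat, 'I_n -> R)
     (Gamma : forall n : nat, probability (config 'I_n) R),
   (forall n, (3 <= n)%N -> 0 < p n <= 1) ->
   (forall m n, (3 <= m)%N -> (m <= n)%N -> p n <= p m) ->
   (forall n, (3 <= n)%N ->
      is_stationary (simple_random_walk (@cycle_graph n)) (pi n)) ->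
   (forall n, (3 <= n)%N ->
      is_stationary_nvm (simple_random_walk (@cycle_graph n)) (p n)
        (Gamma n)) ->
   (p n * n%:R ^+ 2 @[n --> \oo] --> +oo ->
      cvg_in_distribution Gamma
        (fun n => voter_W (pi n) (Gamma n) : {RV (Gamma n) >-> R})
        std_normal_law)
   /\
   (p n * n%:R ^+ 2 @[n --> \oo] --> (0 : R) ->
      cvg_in_distribution Gamma
        (fun n => voter_S (pi n) : {RV (Gamma n) >-> R})
        (bernoulli_law 2^-1)))
  /\
  (forall (p : nat -> R)
     (pi : forall m : nat, torus_vertex m -> R)
     (Gamma : forall m : nat, probability (config (torus_vertex m)) R),
   (forall m, (3 <= m)%N -> 0 < p (m ^ 2)%N <= 1) ->
   (forall k m, (3 <= k)%N -> (k <= m)%N -> p (m ^ 2)%N <= p (k ^ 2)%N) ->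
   (forall m, (3 <= m)%N ->
      is_stationary (simple_random_walk (@torus_graph m)) (pi m)) ->
   (forall m, (3 <= m)%N ->
      is_stationary_nvm (simple_random_walk (@torus_graph m)) (p (m ^ 2)%N)
        (Gamma m)) ->
   (p (m ^ 2)%N * (m ^ 2)%:R * ln (m ^ 2)%:R @[m --> \oo] --> +oo ->
      cvg_in_distribution Gamma
        (fun m => voter_W (pi m) (Gamma m) : {RV (Gamma m) >-> R})
        std_normal_law)
   /\
   (p (m ^ 2)%N * (m ^ 2)%:R * ln (m ^ 2)%:R @[m --> \oo] --> (0 : R) ->
      cvg_in_distribution Gamma
        (fun m => voter_S (pi m) : {RV (Gamma m) >-> R})
        (bernoulli_law 2^-1))).
Proof.
split=> p pi Gamma p01 _ piS GammaS; split.
- exact: cycle_cvg_normal.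
- exact: cycle_cvg_bernoulli.
- exact: torus_cvg_normal.
- exact: torus_cvg_bernoulli.
Qed.
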